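(* Let $\tilde B$ be the resonant bilinear operator on divergence-free, mean-zero vector fields on $\mathbb{T}^3$ defined in the context. There is a constant $C>0$ such that $$\big|\big\langle \tilde B(u,v),u\big\rangle\big|\le C\,\|u\|_{L^2}\,\|u\|_{H^1}\,\|v\|_{H^1}\qquad\text{for all } u,v\in H^1 .$$ As a result, Leray weak solutions of the limit resonant equation $$\partial_t u+\tilde B(u,u)=\nu\Delta u\qquad(\nu>0)$$ are unique: if $u$ and $v$ are two Leray weak solutions (in the sense defined in the context) with the same initial datum $u_0\in L^2$, then $u(t)=v(t)$ in $L^2$ for all $t\ge 0$.
   Context: Let $\mathbb{T}^3=\mathbb{R}^3/\mathbb{Z}^3$ and $\mathbb{Z}^3_0=\mathbb{Z}^3\setminus\{0\}$. For $s\in\mathbb{R}$, $H^s$ is the Sobolev space of divergence-free, mean-zero, $\mathbb{R}^3$-valued vector fields (distributions) on $\mathbb{T}^3$; $L^2$ denotes $H^0$. Basis. For each $k\in\mathbb{Z}^3_0$ and $\sigma\in\{+1,-1\}$ choose a unit vector $\varphi_{k,\sigma}\in\mathbb{C}^3$ with $k\cdot\varphi_{k,\sigma}=0$ and $i\,k\times\varphi_{k,\sigma}=\sigma|k|\varphi_{k,\sigma}$, so that $\varphi_{k,\sigma}e^{2\pi i k\cdot x}$ is a divergence-free eigenvector of the curl operator with eigenvalue $2\pi\sigma|k|$. These fields form a complete orthonormal system of the (complexified) space $H^0$. Write $u=\sum_{k,\sigma}u_{k,\sigma}\varphi_{k,\sigma}e^{2\pi i k\cdot x}$, and $\|u\|_{H^s}^2=\sum_{k,\sigma}|k|^{2s}|u_{k,\sigma}|^2$.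 The pairing is $\langle f,g\rangle=\sum_{n,\sigma}f_{n,\sigma}\overline{g_{n,\sigma}}$ (the $L^2$ inner product, or the duality between $H^{-s}$ and $H^{s}$). Resonant operator. For $n\in\mathbb{Z}^3_0$ let $P_n$ be the orthogonal projection onto the plane orthogonal to $n$, and write $a\cdot b=\sum_j a_jb_j$. The operator $\tilde B(u,v)$ is defined by its components, for $n\in\mathbb{Z}^3_0$ and $\sigma\in\{+1,-1\}$, $$\tilde B(u,v)_{n,\sigma}=-2\pi\sum \sigma_2\,|m|\,u_{k,\sigma_1}v_{m,\sigma_2}\,P_n(\varphi_{k,\sigma_1}\times\varphi_{m,\sigma_2})\cdot\overline{\varphi_{n,\sigma}},$$ where the sum is over all $k,m\in\mathbb{Z}^3_0$, $\sigma_1,\sigma_2\in\{+1,-1\}$ with $k+m=n$ satisfying the resonance condition $$-\sigma_1\frac{k_3}{|k|}-\sigma_2\frac{m_3}{|m|}+\sigma\frac{n_3}{|n|}=0 .$$ (Without the resonance condition, the same formula gives the components of $P((\nabla\times v)\times u)$, where $P$ is the Leray projection; for $v=u$ this is the Navier-Stokes nonlinearity $P(u\cdot\nabla u)=P((\nabla\times u)\times u)$. The equation $\partial_tu+\tilde B(u,u)=\nu\Delta u$ arises as the large rotation limit of the 3D rotating Navier-Stokes equations.) Leray weak solution. Given $\nu>0$ and $u_0\in L^2$, a Leray weak solution of $\partial_tu+\tilde B(u,u)=\nu\Delta u$ with initial datum $u_0$ is a function $u:[0,\infty)\to L^2$ such that, for every $T>0$, $u\in L^\infty(0,T;L^2)\cap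 L^2(0,T;H^1)$; for every smooth divergence-free mean-zero vector field $\phi$ on $\mathbb{T}^3$ and every $t\ge0$, $$\langle u(t),\phi\rangle=\langle u_0,\phi\rangle-\int_0^t\langle\tilde B(u(s),u(s)),\phi\rangle\,ds+\nu\int_0^t\langle u(s),\Delta\phi\rangle\,ds ;$$ and the energy inequality holds: $$\|u(t)\|_{L^2}^2+2\nu\int_0^t\|\nabla u(s)\|_{L^2}^2\,ds\le\|u_0\|_{L^2}^2,\qquad t\ge0 .$$ *)

(* Defs.v *)
From HB Require Import structures.
From mathcomp Require Import all_boot all_order all_algebra.
From mathcomp Require Export complex.
From mathcomp Require Import all_classical all_reals all_analysis.

Set Implicit Arguments.
Unset Strict Implicit.
Unset Printing Implicit Defensive.

Import Order.TTheory GRing.Theory Num.Theory.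
Import numFieldNormedType.Exports.

Local Open Scope classical_set_scope.
Local Open Scope ring_scope.
Local Open Scope complex_scope.

Section Sums.
Context {R : realType} {I : choiceType}.

Definition cmod (z : R[i]) : R := Normc.normc z.

Definition abs_summable (D : set I) (f : I -> R[i]) : Prop :=
  summable D (fun i => (cmod (f i))%:E).

(* Unordered sums over an arbitrary index set, as the sum of the positive part
   minus the sum of the negative part. They are meaningful only when the family
   is absolutely summable. *)
Definition rsum (D : set I) (f : I -> R) : R :=
  fine (\esum_(i in D) (EFin \o f)^\+ i - \esum_(i in D) (EFin \o f)^\- i)%E.

Definition csum (D : set I) (f : I -> R[i]) : R[i] :=
  rsum D (fun i => complex.Re (f i)) +i* rsum D (fun i => complex.Im (f i)).

End Sums.

Section TimeIntegral.
Context {R : realType}.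

Definition cintegral (D : set R) (f : R -> R[i]) : R[i] :=
  (\int[lebesgue_measure]_(s in D) complex.Re (f s))
  +i* (\int[lebesgue_measure]_(s in D) complex.Im (f s)).

Definition cmeasurable_fun (D : set R) (f : R -> R[i]) : Prop :=
  measurable_fun D (fun s => complex.Re (f s)) /\
  measurable_fun D (fun s => complex.Im (f s)).

End TimeIntegral.

Section Vectors.
Context {R : realType}.
Implicit Types (k n : 'rV[int]_3) (a b : 'rV[R[i]]_3).

(* Bilinear, not Hermitian. *)
Definition dotv a b : R[i] := \sum_(j < 3) a 0 j * b 0 j.

Definition conjv a : 'rV[R[i]]_3 := map_mx conjc a.

(* The indices j + 1 and j + 2 are taken modulo 3. *)
Definition crossv a b : 'rV[R[i]]_3 :=
  \row_(j < 3) (a 0 (j + 1) * b 0 (j + 2%:R) - a 0 (j + 2%:R) * b 0 (j + 1)).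

Definition cvec k : 'rV[R[i]]_3 := map_mx (fun z : int => z%:~R) k.

Definition klen k : R := Num.sqrt (\sum_(j < 3) (k 0 j)%:~R ^+ 2).

Definition proj_perp n a : 'rV[R[i]]_3 :=
  a - (dotv a (cvec n) / dotv (cvec n) (cvec n)) *: cvec n.

End Vectors.

(* A sign sigma is encoded by a boolean: false for +1, true for -1. *)
Definition mode : Type := ('rV[int]_3 * bool)%type.

Definition modes : set mode := [set a | a.1 != 0].

Section Fields.
Context {R : realType}.

Definition sgnb (sigma : bool) : R := (-1) ^+ sigma.

Definition helical_basis (phi : 'rV[int]_3 -> bool -> 'rV[R[i]]_3) : Prop :=
  forall k sigma, k != 0 ->
    [/\ dotv (phi k sigma) (conjv (phi k sigma)) = 1,
        dotv (cvec k) (phi k sigma) = 0 &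
        'i%C *: crossv (cvec k) (phi k sigma)
          = (sgnb sigma * klen k)%:C *: phi k sigma].

(* A vector-valued distribution on the torus R^3/Z^3 is identified with the
   family of its Fourier coefficients: u stands for the sum over k of
   u k * exp(2 pi i k.x). *)
Definition vfield : Type := 'rV[int]_3 -> 'rV[R[i]]_3.

Variable phi : 'rV[int]_3 -> bool -> 'rV[R[i]]_3.
Implicit Types (u v psi : vfield).

(* For k != 0, (phi k false, phi k true) is an orthonormal basis of the plane
   orthogonal to k, so the component u_{k,sigma} of a divergence-free u is the
   Hermitian product of u k with phi k sigma. *)
Definition component u (a : mode) : R[i] :=
  dotv (u a.1) (conjv (phi a.1 a.2)).

Definition sobolev_normsq (s : R) u : \bar R :=
  \esum_(a in modes) ((klen a.1) `^ (2 * s) * cmod (component u a) ^+ 2)%:E.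

Definition sobolev (s : R) u : Prop :=
  [/\ u 0 = 0 (* mean zero *),
      forall k, dotv (cvec k) (u k) = 0 (* divergence free *),
      forall k, u (- k) = conjv (u k) (* real valued *) &
      (sobolev_normsq s u < +oo)%E].

Definition sobolev_norm (s : R) u : R := Num.sqrt (fine (sobolev_normsq s u)).

(* By Sobolev embedding, smoothness is membership in every H^N. *)
Definition smooth_field psi : Prop := forall N : nat, sobolev N%:R psi.

Definition pderiv (j : 'I_3) u : vfield :=
  fun k => ('i%C * (2 * pi)%:C * (k 0 j)%:~R) *: u k.

Definition laplacian u : vfield :=
  fun k => \sum_(j < 3) pderiv j (pderiv j u) k.

Definition grad_normsq u : \bar R :=
  (\sum_(j < 3) sobolev_normsq 0 (pderiv j u))%E.

Definition pairing (f g : mode -> R[i]) : R[i] :=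
  csum modes (fun a => f a * conjc (g a)).

Definition freq (a : mode) : R :=
  sgnb a.2 * (a.1 0 ord_max)%:~R / klen a.1.

Definition resonant_pairs (c : mode) : set (mode * mode) :=
  [set p | [/\ modes p.1, modes p.2, p.1.1 + p.2.1 = c.1 &
               - freq p.1 - freq p.2 + freq c = 0]].

Definition Btilde_term u v (c : mode) (p : mode * mode) : R[i] :=
  (sgnb p.2.2 * klen p.2.1)%:C * component u p.1 * component v p.2
  * dotv (proj_perp c.1 (crossv (phi p.1.1 p.1.2) (phi p.2.1 p.2.2)))
         (conjv (phi c.1 c.2)).

Definition Btilde u v (c : mode) : R[i] :=
  - (2 * pi)%:C * csum (resonant_pairs c) (Btilde_term u v c).

(* All the series in < Btilde (u, v), psi > converge absolutely. *)
Definition Btilde_pairing_converges u v psi : Prop :=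
  (forall c, modes c -> abs_summable (resonant_pairs c) (Btilde_term u v c)) /\
  abs_summable modes (fun c => Btilde u v c * conjc (component psi c)).

(* L^2 being separable, weak and strong measurability agree (Pettis). *)
Definition L2_measurable (U : R -> vfield) : Prop :=
  forall f, sobolev 0 f ->
    cmeasurable_fun `[0, +oo[
      (fun s => pairing (component (U s)) (component f)).

Definition leray_solution (nu : R) (u0 : vfield) (U : R -> vfield) : Prop :=
  [/\ sobolev 0 u0,
      (forall t, 0 <= t -> sobolev 0 (U t)) /\ L2_measurable U,
      forall T, 0 < T ->
        (exists M : R, {ae lebesgue_measure, forall s : R,
           0 < s < T -> (sobolev_normsq 0 (U s) <= M%:E)%E}) /\
        (\int[lebesgue_measure]_(s in `]0%R, T[) sobolev_normsq 1 (U s)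
           < +oo)%E,
      forall psi t, smooth_field psi -> 0 <= t ->
        pairing (component (U t)) (component psi)
        = pairing (component u0) (component psi)
          - cintegral `[0, t]
              (fun s => pairing (Btilde (U s) (U s)) (component psi))
          + nu%:C * cintegral `[0, t]
              (fun s => pairing (component (U s)) (component (laplacian psi)))
    & forall t, 0 <= t ->
        (sobolev_normsq 0 (U t)
         + (2 * nu)%:E * \int[lebesgue_measure]_(s in `[0%R, t])
                           grad_normsq (U s)
         <= sobolev_normsq 0 u0)%E].

End Fields.
Arguments vfield R : clear implicits.

(* Main.v *)
Require Import Defs.
From mathcomp Require Import all_boot all_order all_algebra.
From mathcomp Require Import all_classical all_reals all_analysis.
From mathcomp Require Import measurable_realfun.
From mathcomp Require Import ring lra zify.
Import Order.TTheory GRing.Theory Num.Theory.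
Import numFieldNormedType.Exports.

(* In a resonant triad k + m = n one may assume |k| <= |n|, up to exchanging the
   roles of k and n. For fixed n and signs, squaring the resonance condition twice
   gives a polynomial equation of degree 8 in k_3, so only O(|n|^2) wave numbers
   k with |k| <= |n| can occur, one power of |n| less than without resonance.
   Cauchy-Schwarz then yields the trilinear bound
     sum |m| a_k b_m d_n <= C |b|_1 (|a|_0 |d|_1 + |a|_1 |d|_0).

   For two solutions u and v with difference w,
     < B(u,u) - B(v,v), w > = < B(w,u), w > + < B(v,w), w >,
   and the second term, where the derivative falls on w, is symmetrized by the
   involution exchanging m and -n: the helical structure makes the two factors
   |m| and |n| combine into one bounded by |k|. Hence the modal energy identity
   and Young's inequality give
     |w(t)|_0^2 <= C int_0^t (|u|_1^2 + |v|_1^2) |w|_0^2,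
   and Gronwall's lemma concludes. *)

Set Implicit Arguments.
Unset Strict Implicit.
Unset Printing Implicit Defensive.

Local Open Scope classical_set_scope.
Local Open Scope ring_scope.
Local Open Scope complex_scope.

(** * Unordered sums *)

(** The gain of one power of |n| balances the estimate exactly: the factor |m| is paid by |b|_1, and
    under the square root the number O(|n|^2) of pairs attached to n is paid by |d|_1^2. With the
    O(|n|^3) pairs of the full nonlinearity half a power of |n| would remain.

    Weak solutions may be tested only against smooth real fields, so w is not an admissible test
    field and its energy identity is not directly available. Each Fourier coefficient of w, however,
    solves an integral equation in time. The chain rule for its squared modulus needs only an
    integrable derivative, and the resulting identities are summed over the modes by dominated
    convergence. This is why the nonlinear terms are also estimated with the modulus inside the
    series: such a bound, a constant times |u|_1^2 + |v|_1^2, is integrable in time and dominates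
    the partial sums, while the signed estimate is applied to the full sum. Since H^1 norms are
    finite at almost every time only, these bounds hold almost everywhere, whereas the L^2 bounds
    hold at every time by the energy inequality. *)

Section UnorderedSums.
Context {R : realType} {T : choiceType}.
Implicit Types (D : set T) (f g : T -> R).

Lemma esumZl D (c : R) (a : T -> \bar R) : 0 <= c ->
  (forall i, D i -> 0 <= a i)%E ->
  (\esum_(i in D) (c%:E * a i) = c%:E * \esum_(i in D) a i)%E.
Proof.
move=> c0 a0; have [->|cn0] := eqVneq c 0.
  by rewrite mul0e esum1// => i _; rewrite mul0e.
have {cn0}c0 : 0 < c by rewrite lt_neqAle eq_sym cn0.
(* One inequality suffices: applied to [c] and then to its inverse, it gives both directions. *)
have le_scale (d : R) (b : T -> \bar R) : 0 < d -> (forall i, D i -> 0 <= b i)%E ->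
    (\esum_(i in D) (d%:E * b i) <= d%:E * \esum_(i in D) b i)%E.
  move=> d0 b0; apply: ge_ereal_sup => _ [X [finX XD]] <-.
  rewrite (_ : (\sum_(x \in X) (d%:E * b x) = d%:E * \sum_(x \in X) b x)%E).
    by rewrite lee_pmul2l ?lte_fin//; apply: ereal_sup_ubound; exists X.
  rewrite !fsbig_finite//= !big_seq ge0_sume_distrr//.
  by move=> i; rewrite in_fset_set// inE => /XD/b0.
apply/eqP; rewrite eq_le le_scale//=.
rewrite -lee_pdivlMl//; apply: le_trans (le_scale _ _ _ _); last 2 first.
- by rewrite invr_gt0.
- by move=> i Di; rewrite mule_ge0 ?lee_fin ?(ltW c0)// a0.
apply: le_esum => i Di; rewrite muleA -EFinM mulVf ?mul1e//; exact: lt0r_neq0.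
Qed.

Lemma summableP D f :
  summable D (EFin \o f) <-> (\esum_(i in D) `|f i|%:E < +oo)%E.
Proof. by []. Qed.

Lemma summable_le D f g : (forall i, D i -> `|f i| <= g i) ->
  (\esum_(i in D) (g i)%:E < +oo)%E -> summable D (EFin \o f).
Proof.
by move=> fg; apply: le_lt_trans; apply: le_esum => i Di; rewrite lee_fin fg.
Qed.

Lemma summable_esum D f : (forall i, D i -> 0 <= f i) ->
  (\esum_(i in D) (f i)%:E < +oo)%E -> summable D (EFin \o f).
Proof. by move=> f0; apply: summable_le => i Di; rewrite ger0_norm// f0. Qed.

Lemma esum_fin D f : (forall i, D i -> 0 <= f i) ->
  (\esum_(i in D) (f i)%:E < +oo)%E ->
  (\esum_(i in D) (f i)%:E)%E \is a fin_num.
Proof.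
by move=> f0 fy; rewrite ge0_fin_numE//; apply: esum_ge0 => i Di; rewrite lee_fin f0.
Qed.

Lemma eq_rsum D f g : (forall i, D i -> f i = g i) -> rsum D f = rsum D g.
Proof.
move=> fg; rewrite /rsum; congr (fine (_ - _)%E); apply: eq_esum => i Di;
by rewrite ?funeposE ?funenegE /= fg.
Qed.

(** The difference of two finite nonnegative sums depends only on the difference of the families, so
    any nonnegative decomposition may replace the positive and negative parts in the definition of
    [rsum]. *)
Lemma rsumB_ge0 D f g : (forall i, D i -> 0 <= f i) ->
  (forall i, D i -> 0 <= g i) -> (\esum_(i in D) (f i)%:E < +oo)%E ->
  (\esum_(i in D) (g i)%:E < +oo)%E ->
  rsum D (fun i => f i - g i) =
    fine (\esum_(i in D) (f i)%:E)%E - fine (\esum_(i in D) (g i)%:E)%E.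
Proof.
move=> f0 g0 fy gy; rewrite -fineB ?esum_fin// /rsum.
by rewrite -(@esumB _ _ D (EFin \o f) (EFin \o g))//; apply: summable_esum.
Qed.

Lemma rsum_ge0E D f : (forall i, D i -> 0 <= f i) ->
  (\esum_(i in D) (f i)%:E < +oo)%E ->
  rsum D f = fine (\esum_(i in D) (f i)%:E)%E.
Proof.
move=> f0 fy; rewrite (@eq_rsum _ _ (fun i => f i - 0)); last first.
  by move=> i _; rewrite subr0.
by rewrite rsumB_ge0// (esum1 (a := fun=> 0%:E)) ?subr0 ?ltry.
Qed.

Lemma summable_posneg D f : summable D (EFin \o f) ->
  (\esum_(i in D) (Num.max (f i) 0)%:E < +oo)%E /\
  (\esum_(i in D) (Num.max (- f i) 0)%:E < +oo)%E.
Proof.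
by move=> /summableP h; split; apply: le_lt_trans h; apply: le_esum => i _;
  rewrite lee_fin ge_max normr_ge0 andbT ?ler_norm// -normrN ler_norm.
Qed.

Lemma rsum_posneg D f : summable D (EFin \o f) ->
  rsum D f = fine (\esum_(i in D) (Num.max (f i) 0)%:E)%E
             - fine (\esum_(i in D) (Num.max (- f i) 0)%:E)%E.
Proof.
move=> /summable_posneg[fp fn]; rewrite -rsumB_ge0//; last 2 first.
- by move=> i _; rewrite le_max lexx orbT.
- by move=> i _; rewrite le_max lexx orbT.
by apply: eq_rsum => i _; rewrite !maxEle; case: ifP; case: ifP; lra.
Qed.

Lemma ler_norm_rsum D f (M : R) :
  (\esum_(i in D) `|f i|%:E <= M%:E)%E -> `|rsum D f| <= M.
Proof.
move=> fM; have fs : summable D (EFin \o f) by apply: le_lt_trans fM (ltry _).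
have [fp fn] := summable_posneg fs.
have p0 i : D i -> 0 <= Num.max (f i) 0 by rewrite le_max lexx orbT.
have n0 i : D i -> 0 <= Num.max (- f i) 0 by rewrite le_max lexx orbT.
rewrite rsum_posneg//.
have : fine (\esum_(i in D) (Num.max (f i) 0)%:E)%E
   + fine (\esum_(i in D) (Num.max (- f i) 0)%:E)%E <= M.
  rewrite -fineD ?esum_fin// -lee_fin fineK; last by rewrite fin_numD !esum_fin.
  rewrite -esumD; try by move=> i Di; rewrite lee_fin ?p0 ?n0.
  apply: le_trans fM; apply: le_esum => i Di; rewrite -EFinD lee_fin.
  by rewrite !maxEle; case: ifP; case: ifP; case: (ler0P (f i)); lra.
have : 0 <= fine (\esum_(i in D) (Num.max (f i) 0)%:E)%E.
  by apply/fine_ge0/esum_ge0 => i Di; rewrite lee_fin p0.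
have : 0 <= fine (\esum_(i in D) (Num.max (- f i) 0)%:E)%E.
  by apply/fine_ge0/esum_ge0 => i Di; rewrite lee_fin n0.
by move=> *; rewrite ler_norml; apply/andP; split; lra.
Qed.

Lemma rsum_set1_supp D f x : D x -> (forall i, D i -> i != x -> f i = 0) ->
  summable D (EFin \o f) /\ rsum D f = f x.
Proof.
move=> Dx fx.
have h (g : T -> R) : (forall i, 0 <= g i) -> (forall i, D i -> i != x -> g i = 0) ->
    (\esum_(i in D) (g i)%:E = (g x)%:E)%E.
  move=> g0 gx; rewrite (esumID [set x])//; last by move=> i _; rewrite lee_fin.
  rewrite [X in (_ + X)%E]esum1 ?adde0; last first.
    by move=> i [Di /eqP ix]; rewrite gx.
  rewrite setI1 mem_set// esum_set1// lee_fin//.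
have fs : summable D (EFin \o f).
  by apply/summableP; rewrite h ?ltry// => i Di ix; rewrite fx// normr0.
split=> //; rewrite rsum_posneg// !h/=.
- by rewrite !maxEle; case: ifP; case: ifP; lra.
- by move=> i; rewrite le_max lexx orbT.
- by move=> i Di ix; rewrite fx// oppr0 maxxx.
- by move=> i; rewrite le_max lexx orbT.
- by move=> i Di ix; rewrite fx// maxxx.
Qed.

End UnorderedSums.

Lemma reindex_rsum {R : realType} {T T' : choiceType} (D : set T) (D' : set T')
    (e : T -> T') (f : T' -> R) :
  set_bij D D' e -> rsum D' f = rsum D (f \o e).
Proof.
by move=> De; rewrite /rsum; congr (fine (_ - _)%E); rewrite (reindex_esum D D' e)//;
  apply: eq_esum => i _; rewrite ?funeposE ?funenegE.
Qed.

(** Tonelli is applied to the positive and to the negative parts separately. Their inner sums form a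
    nonnegative decomposition of the outer family but not its canonical one, since both may be
    nonzero at the same index; [rsumB_ge0] bridges this gap. *)
Lemma rsum_rsum {R : realType} {T1 T2 : choiceType} (D : set T1)
    (J : T1 -> set T2) (f : T1 -> T2 -> R) :
  summable (D `*`` J) (fun k => (f k.1 k.2)%:E) ->
  rsum D (fun i => rsum (J i) (f i)) = rsum (D `*`` J) (fun k => f k.1 k.2).
Proof.
move=> fs; have fsE : (\esum_(i in D) \esum_(j in J i) `|f i j|%:E < +oo)%E.
  by rewrite esum_esum// => i j _ _; rewrite lee_fin.
have [fp fn] := summable_posneg (f := fun k => f k.1 k.2) fs.
have fi i : D i -> summable (J i) (EFin \o f i).
  move=> Di; apply/summableP; apply: le_lt_trans fsE.
  rewrite [leRHS](esumID [set i])// ?setI1 ?mem_set// ?esum_set1 ?leeDl//.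
  - by apply: esum_ge0 => k _; apply: esum_ge0 => l _; rewrite lee_fin.
  - by apply: esum_ge0 => l _; rewrite lee_fin.
  - by move=> k _; apply: esum_ge0 => l _; rewrite lee_fin.
rewrite [RHS]rsum_posneg//.
have p0 i j : 0 <= Num.max (f i j) 0 by rewrite le_max lexx orbT.
have n0 i j : 0 <= Num.max (- f i j) 0 by rewrite le_max lexx orbT.
have Ep := esum_esum (I := D) (J := J) (a := fun i j => (Num.max (f i j) 0)%:E).
have En := esum_esum (I := D) (J := J) (a := fun i j => (Num.max (- f i j) 0)%:E).
move: fp fn; rewrite -Ep -?En; try by move=> i j _ _; rewrite lee_fin ?p0 ?n0.
move=> fp fn.
have pE i : D i -> (\esum_(j in J i) (Num.max (f i j) 0)%:E =
     (fine (\esum_(j in J i) (Num.max (f i j) 0)%:E))%:E)%E.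
  move=> Di; rewrite fineK// esum_fin//.
  by have [] := summable_posneg (fi _ Di).
have nE i : D i -> (\esum_(j in J i) (Num.max (- f i j) 0)%:E =
     (fine (\esum_(j in J i) (Num.max (- f i j) 0)%:E))%:E)%E.
  move=> Di; rewrite fineK// esum_fin//.
  by have [] := summable_posneg (fi _ Di).
move: fp fn; rewrite (eq_esum pE) (eq_esum nE) => fp fn.
rewrite -rsumB_ge0//.
- by apply: eq_rsum => i Di; rewrite rsum_posneg//; exact: fi.
- move=> i _; apply/fine_ge0/esum_ge0 => j _.
  by rewrite lee_fin le_max lexx orbT.
- move=> i _; apply/fine_ge0/esum_ge0 => j _.
  by rewrite lee_fin le_max lexx orbT.
Qed.

(** * Countable sums as limits along an enumeration *)

Section CountableSums.
Context {R : realType} {T : countType}.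
Implicit Types (D : set T) (f g : T -> R).

(* The extension by zero of the restriction of f to D, read along the canonical
   enumeration of T. *)
Definition enumf D f (n : nat) : R :=
  if pickle_inv n is Some x then (if x \in D then f x else 0) else 0.

Lemma esum_enumf D f : (forall i, 0 <= f i) ->
  (\esum_(i in D) (f i)%:E = \sum_(0 <= n <oo) (enumf D f n)%:E)%E.
Proof.
move=> f0; have e0 n : 0 <= enumf D f n.
  by rewrite /enumf; case: pickle_inv => // x; case: ifP.
rewrite nneseries_esumT; last by move=> n; rewrite lee_fin.
rewrite [LHS]esum_mkcond.
transitivity (\esum_(n in range (@pickle T)) (enumf D f n)%:E)%E.
  rewrite esum_image; last by move=> x y _ _; exact: (pcan_inj pickleK).
  by apply: eq_esum => x _; rewrite /enumf pickleK_inv; case: ifP.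
rewrite esum_mkcond; apply: eq_esum => n _; case: ifPn => //.
rewrite notin_setE/= => nP; rewrite /enumf.
case E : (pickle_inv n) => [x|]//; exfalso; apply: nP; exists x => //.
by have := @pickle_invK T n; rewrite E.
Qed.

Lemma cvg_enumf_ge0 D f : (forall i, 0 <= f i) ->
  (\esum_(i in D) (f i)%:E < +oo)%E ->
  (fun N => \sum_(0 <= n < N) enumf D f n) @ \oo -->
    fine (\esum_(i in D) (f i)%:E)%E.
Proof.
move=> f0; rewrite esum_enumf// => fy.
have e0 n : 0 <= enumf D f n.
  by rewrite /enumf; case: pickle_inv => // x; case: ifP.
have es : summable xpredT (EFin \o enumf D f).
  rewrite /summable (eq_esum (b := EFin \o enumf D f)); last first.
    by move=> n _ /=; rewrite ger0_norm.
  by rewrite -(nneseries_esum (P := xpredT))// => n _; rewrite lee_fin.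
have e0' i : true -> (0 <= (EFin \o enumf D f) i)%E by rewrite lee_fin.
have /= -> := summable_nneseries_lim e0' es.
exact: summable_cvg e0' es.
Qed.

(** Along one fixed enumeration the unordered sum is a limit of finite sums, so linearity is
    inherited from sequences and dominated convergence in time becomes applicable. *)
Lemma cvg_enumf D f : summable D (EFin \o f) ->
  (fun N => \sum_(0 <= n < N) enumf D f n) @ \oo --> rsum D f.
Proof.
move=> fs; have [fp fn] := summable_posneg fs; rewrite rsum_posneg//.
rewrite [X in X @ _](_ : _ = (fun N =>
   \sum_(0 <= n < N) enumf D (fun i => Num.max (f i) 0) n -
   \sum_(0 <= n < N) enumf D (fun i => Num.max (- f i) 0) n)).
  by apply: cvgB; apply: cvg_enumf_ge0 => // i; rewrite le_max lexx orbT.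
apply/funext => N; rewrite -sumrB; apply: eq_bigr => n _; rewrite /enumf.
case: pickle_inv => [x|]; last by rewrite subr0.
by case: ifP => _; [rewrite !maxEle; case: ifP; case: ifP; lra|rewrite subr0].
Qed.

Lemma rsumD D f g : summable D (EFin \o f) -> summable D (EFin \o g) ->
  rsum D (fun i => f i + g i) = rsum D f + rsum D g.
Proof.
move=> fs gs; have fgs : summable D (EFin \o (fun i => f i + g i)).
  by have := summableD fs gs.
apply: (cvg_unique _ (cvg_enumf fgs)); first exact: Rhausdorff.
rewrite [X in X @ _](_ : _ = (fun N =>
   \sum_(0 <= n < N) enumf D f n + \sum_(0 <= n < N) enumf D g n)).
  by apply: cvgD; exact: cvg_enumf.
apply/funext => N; rewrite -big_split; apply: eq_bigr => n _; rewrite /enumf /=.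
by case: pickle_inv => [x|]; [case: ifP => //|]; rewrite addr0.
Qed.

Lemma summableZ D f (c : R) : summable D (EFin \o f) ->
  summable D (EFin \o (fun i => c * f i)).
Proof.
move=> /summableP fs; apply/summableP.
rewrite (eq_esum (b := fun i => `|c|%:E * `|f i|%:E)%E); last first.
  by move=> i _; rewrite normrM EFinM.
rewrite esumZl//; apply: lte_mul_pinfty => //.
Qed.

Lemma rsumZ D f (c : R) : summable D (EFin \o f) ->
  rsum D (fun i => c * f i) = c * rsum D f.
Proof.
move=> fs; apply: (cvg_unique _ (cvg_enumf (summableZ c fs))).
  exact: Rhausdorff.
rewrite [X in X @ _](_ : _ = (fun N => c * \sum_(0 <= n < N) enumf D f n)).
  by apply: cvgMr; exact: cvg_enumf.
apply/funext => N; rewrite mulr_sumr; apply: eq_bigr => n _; rewrite /enumf.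
by case: pickle_inv => [x|]; [case: ifP => //|]; rewrite mulr0.
Qed.

Lemma rsumB D f g : summable D (EFin \o f) -> summable D (EFin \o g) ->
  rsum D (fun i => f i - g i) = rsum D f - rsum D g.
Proof.
move=> fs gs; rewrite -[in RHS]mulN1r -rsumZ// -rsumD//; last exact: summableZ.
by apply: eq_rsum => i _; rewrite mulN1r.
Qed.

Section Measurability.
Context {d : measure_display} {X : measurableType d} (A : set X).

Lemma measurable_esum D (f : T -> X -> R) : (forall i x, 0 <= f i x) ->
  (forall i, D i -> measurable_fun A (f i)) ->
  measurable_fun A ((fun x => \esum_(i in D) (f i x)%:E)%E : X -> \bar R).
Proof.
move=> f0 mf; under eq_fun do rewrite esum_enumf//.
apply: ge0_emeasurable_sum => [n x Ax _|n _].
  by rewrite lee_fin /enumf; case: pickle_inv => // y; case: ifP.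
apply/measurable_EFinP; rewrite /enumf; case: pickle_inv => [y|]; last exact: measurable_cst.
case yD : (y \in D); last exact: measurable_cst.
by apply: mf; exact: set_mem.
Qed.

Lemma measurable_rsum D (f : T -> X -> R) :
  (forall i, D i -> measurable_fun A (f i)) ->
  measurable_fun A (fun x => rsum D (f^~ x)).
Proof.
move=> mf; rewrite /rsum; apply: (measurableT_comp (fine_measurable (@measurableT _ _))).
apply: emeasurable_funB.
- rewrite [X in measurable_fun _ X](_ : _ =
      ((fun x => \esum_(i in D) (Num.max (f i x) 0)%:E)%E : X -> \bar R)).
    apply: measurable_esum => [i x|i Di]; first by rewrite le_max lexx orbT.
    by apply: measurable_maxr => //; exact: mf.
  by apply/funext => x; apply: eq_esum => i _; rewrite funeposE /= EFin_max.
- rewrite [X in measurable_fun _ X](_ : _ =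
      ((fun x => \esum_(i in D) (Num.max (- f i x) 0)%:E)%E : X -> \bar R)).
    apply: measurable_esum => [i x|i Di]; first by rewrite le_max lexx orbT.
    by apply: measurable_maxr => //; apply: measurableT_comp => //; exact: mf.
  by apply/funext => x; apply: eq_esum => i _; rewrite funenegE /= EFin_max.
Qed.

End Measurability.

End CountableSums.

(** * The modulus of complex numbers *)

Section ComplexModulus.
Context {R : realType}.

(* A constant, so that rewriting does not depend on how the 0 and 1 of 'i are
   elaborated. *)
Definition imC : R[i] := 'i%C.

Implicit Types (z w : R[i]) (x : R).

Lemma cmod_ge0 z : 0 <= cmod z.
Proof. by case: z => a b; rewrite /cmod /= sqrtr_ge0. Qed.

Lemma cmodM z w : cmod (z * w) = cmod z * cmod w.
Proof. exact: Normc.normcM. Qed.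

Lemma cmodN z : cmod (- z) = cmod z.
Proof. by case: z => a b; rewrite /cmod /= !sqrrN. Qed.

Lemma cmodJ z : cmod (conjc z) = cmod z.
Proof. by case: z => a b; rewrite /cmod /= !sqrrN. Qed.

Lemma cmodC x : cmod x%:C = `|x|.
Proof. by rewrite /cmod /= expr0n addr0 sqrtr_sqr. Qed.

Lemma cmod0 : cmod (0 : R[i]) = 0.
Proof. by rewrite (cmodC 0) normr0. Qed.

Lemma cmod_i : cmod imC = 1.
Proof. by rewrite /cmod /= expr0n add0r expr1n sqrtr1. Qed.

Lemma ler_cmodD z w : cmod (z + w) <= cmod z + cmod w.
Proof. exact: le_normcD. Qed.

Lemma ler_cmodB z w : cmod (z - w) <= cmod z + cmod w.
Proof. by rewrite (le_trans (ler_cmodD _ _))// cmodN. Qed.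

Lemma sqr_cmod z : cmod z ^+ 2 = complex.Re z ^+ 2 + complex.Im z ^+ 2.
Proof. by case: z => a b; rewrite /cmod /= sqr_sqrtr// addr_ge0// sqr_ge0. Qed.

Lemma mulcJ z : z * conjc z = (cmod z ^+ 2)%:C.
Proof.
rewrite sqr_cmod; case: z => a b.
by apply/eqP; rewrite eq_complex /=; apply/andP; split; apply/eqP; ring.
Qed.

Lemma ler_norm_Re z : `|complex.Re z| <= cmod z.
Proof.
rewrite -ler_sqr ?nnegrE ?cmod_ge0// sqr_cmod -normrX ger0_norm ?sqr_ge0//.
by rewrite lerDl sqr_ge0.
Qed.

Lemma ler_norm_Im z : `|complex.Im z| <= cmod z.
Proof.
rewrite -ler_sqr ?nnegrE ?cmod_ge0// sqr_cmod -normrX ger0_norm ?sqr_ge0//.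
by rewrite lerDr sqr_ge0.
Qed.

Lemma ler_cmod_ReIm z : cmod z <= `|complex.Re z| + `|complex.Im z|.
Proof.
rewrite [X in cmod X]complexE (le_trans (ler_cmodD _ _))// cmodM -/imC cmod_i mul1r.
by rewrite !cmodC.
Qed.

Lemma cmod_eq0 z : cmod z = 0 -> z = 0.
Proof. exact: Normc.eq0_normc. Qed.

End ComplexModulus.

(** The computation behind [hprojE]: z = i, x = sigma |k|, y = 1/x, and a is the cross product of k
    with w. On the plane orthogonal to k, taking the cross product with k twice is multiplication by
    -|k|^2 = -x^2. *)
Lemma scaler_eigen (K : comNzRingType) (V : lmodType K) (c x y z : K) (a w : V) :
  z * z = -1 -> x * y = 1 ->
  z *: (c *: (a + y *: (z *: - ((x * x) *: w)))) =
    x *: (c *: (w + y *: (z *: a))).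
Proof.
move=> zz xy; rewrite !(scalerDr, scalerN, scalerA) addrC -scaleNr.
congr (_ *: _ + _ *: _).
  rewrite (_ : - _ = - (z * z) * (x * y) * (c * x)); last ring.
  by rewrite zz xy; ring.
rewrite (_ : x * c * _ = (x * y) * (z * c)); last ring.
by rewrite xy mul1r.
Qed.

(** * Helical vector algebra *)

Section VectorAlgebra.
Context {R : realType}.
Implicit Types (a b c d u v w : 'rV[R[i]]_3) (x y : R[i]) (k : 'rV[int]_3).

Lemma sum_ord3 (V : nmodType) (F : 'I_3 -> V) :
  \sum_(j < 3) F j = F 0 + F 1 + F 2%:R.
Proof.
rewrite !big_ord_recl big_ord0 addr0 addrA.
by congr (F _ + F _ + F _); apply/val_inj.
Qed.

Lemma ord3P (P : 'I_3 -> Prop) : P 0 -> P 1 -> P 2%:R -> forall j, P j.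
Proof.
move=> P0 P1 P2 [[|[|[|//]]] h].
- by rewrite (_ : Ordinal h = 0) //; apply/val_inj.
- by rewrite (_ : Ordinal h = 1) //; apply/val_inj.
- by rewrite (_ : Ordinal h = 2%:R) //; apply/val_inj.
Qed.

Lemma row3P a b : a 0 0 = b 0 0 -> a 0 1 = b 0 1 -> a 0 2%:R = b 0 2%:R -> a = b.
Proof.
move=> e0 e1 e2; apply/matrixP => i j; rewrite (ord1 i).
by elim/ord3P : j.
Qed.

Lemma dotvE a b :
  dotv a b = a 0 0 * b 0 0 + a 0 1 * b 0 1 + a 0 2%:R * b 0 2%:R.
Proof. by rewrite /dotv sum_ord3. Qed.

Lemma crossv0E a b : crossv a b 0 0 = a 0 1 * b 0 2%:R - a 0 2%:R * b 0 1.
Proof. by rewrite mxE !add0r. Qed.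

Lemma crossv1E a b : crossv a b 0 1 = a 0 2%:R * b 0 0 - a 0 0 * b 0 2%:R.
Proof.
rewrite mxE (_ : 1 + 1 = 2%:R :> 'I_3); last exact/val_inj.
by rewrite (_ : 1 + 2%:R = 0 :> 'I_3)//; exact/val_inj.
Qed.

Lemma crossv2E a b : crossv a b 0 2%:R = a 0 0 * b 0 1 - a 0 1 * b 0 0.
Proof.
rewrite mxE (_ : 2%:R + 1 = 0 :> 'I_3); last exact/val_inj.
by rewrite (_ : 2%:R + 2%:R = 1 :> 'I_3)//; exact/val_inj.
Qed.

Lemma dotvC a b : dotv a b = dotv b a.
Proof. by rewrite !dotvE; ring. Qed.

Lemma dotvDl a b c : dotv (a + b) c = dotv a c + dotv b c.
Proof. by rewrite !dotvE !mxE; ring. Qed.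

Lemma dotvDr a b c : dotv c (a + b) = dotv c a + dotv c b.
Proof. by rewrite !dotvE !mxE; ring. Qed.

Lemma dotvZl x a b : dotv (x *: a) b = x * dotv a b.
Proof. by rewrite !dotvE !mxE; ring. Qed.

Lemma dotvZr x a b : dotv a (x *: b) = x * dotv a b.
Proof. by rewrite !dotvE !mxE; ring. Qed.

Lemma dotv0l b : dotv 0 b = 0.
Proof. by rewrite !dotvE !mxE; ring. Qed.

Lemma dotvNl a b : dotv (- a) b = - dotv a b.
Proof. by rewrite !dotvE !mxE; ring. Qed.

Lemma crossvC a b : crossv a b = - crossv b a.
Proof.
by apply: row3P; rewrite [RHS]mxE !(crossv0E, crossv1E, crossv2E); ring.
Qed.

Lemma crossvZl x a b : crossv (x *: a) b = x *: crossv a b.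
Proof.
by apply: row3P; rewrite [RHS]mxE !(crossv0E, crossv1E, crossv2E) !mxE; ring.
Qed.

Lemma crossvZr x a b : crossv a (x *: b) = x *: crossv a b.
Proof.
by apply: row3P; rewrite [RHS]mxE !(crossv0E, crossv1E, crossv2E) !mxE; ring.
Qed.

Lemma crossvDr a b c : crossv a (b + c) = crossv a b + crossv a c.
Proof.
by apply: row3P; rewrite [RHS]mxE !(crossv0E, crossv1E, crossv2E) !mxE; ring.
Qed.

Lemma crossvNl a b : crossv (- a) b = - crossv a b.
Proof.
by apply: row3P; rewrite [RHS]mxE !(crossv0E, crossv1E, crossv2E) !mxE; ring.
Qed.

Lemma dotv_crossC a b c : dotv (crossv a b) c = - dotv (crossv a c) b.
Proof. by rewrite !dotvE !(crossv0E, crossv1E, crossv2E); ring. Qed.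

Lemma crossv_crossl u v w :
  crossv (crossv u v) w = dotv u w *: v - dotv v w *: u.
Proof.
apply: row3P; rewrite [RHS]mxE ![in RHS]mxE !dotvE;
by rewrite !(crossv0E, crossv1E, crossv2E); ring.
Qed.

Lemma crossv_crossr u v w :
  crossv u (crossv v w) = dotv u w *: v - dotv u v *: w.
Proof.
apply: row3P; rewrite [RHS]mxE ![in RHS]mxE !dotvE;
by rewrite !(crossv0E, crossv1E, crossv2E); ring.
Qed.

Lemma conjvE a i j : conjv a i j = conjc (a i j).
Proof. by rewrite mxE. Qed.

Lemma conjvK : involutive (@conjv R).
Proof. by move=> a; apply/matrixP => i j; rewrite !conjvE conjcK. Qed.

Lemma dotv_conj a b : dotv (conjv a) (conjv b) = conjc (dotv a b).
Proof. by rewrite !dotvE !conjvE !rmorphD !rmorphM. Qed.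

Lemma conjvZ x a : conjv (x *: a) = conjc x *: conjv a.
Proof. by apply/matrixP => i j; rewrite !mxE rmorphM. Qed.

Lemma conjvD a b : conjv (a + b) = conjv a + conjv b.
Proof. by apply/matrixP => i j; rewrite !mxE rmorphD. Qed.

Lemma crossv_conj a b : crossv (conjv a) (conjv b) = conjv (crossv a b).
Proof.
by apply: row3P; rewrite conjvE !(crossv0E, crossv1E, crossv2E) !conjvE;
   rewrite rmorphB !rmorphM.
Qed.

Lemma conjv_cvec k : conjv (cvec k : 'rV[R[i]]_3) = cvec k.
Proof. by apply/matrixP => i j; rewrite !mxE rmorph_int. Qed.

Lemma cvecD k l : cvec (k + l) = cvec k + cvec l :> 'rV[R[i]]_3.
Proof. by apply/matrixP => i j; rewrite !mxE rmorphD. Qed.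

Lemma cvecN k : cvec (- k) = - cvec k :> 'rV[R[i]]_3.
Proof. by apply/matrixP => i j; rewrite !mxE rmorphN. Qed.

Lemma intr_complex (z : int) : (z%:~R : R[i]) = (z%:~R : R)%:C.
Proof. by rewrite rmorph_int. Qed.

Lemma klen_ge0 k : 0 <= klen k :> R.
Proof. exact: sqrtr_ge0. Qed.

Lemma sqr_klen k :
  klen k ^+ 2 = (k 0 0)%:~R ^+ 2 + (k 0 1)%:~R ^+ 2 + (k 0 2%:R)%:~R ^+ 2 :> R.
Proof. by rewrite sqr_sqrtr sum_ord3 ?addr_ge0 ?sqr_ge0. Qed.

Lemma klenN k : klen (- k) = klen k :> R.
Proof.
by rewrite /klen; congr Num.sqrt; apply: eq_bigr => j _; rewrite mxE rmorphN sqrrN.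
Qed.

Lemma ler_norm_klen k j : `|(k 0 j)%:~R| <= klen k :> R.
Proof.
rewrite -ler_sqr ?nnegrE ?klen_ge0// sqr_klen -normrX ger0_norm ?sqr_ge0//.
have h0 := sqr_ge0 ((k 0 0)%:~R : R); have h1 := sqr_ge0 ((k 0 1)%:~R : R).
have h2 := sqr_ge0 ((k 0 2%:R)%:~R : R).
by elim/ord3P : j; lra.
Qed.

Lemma klen_ge1 k : k != 0 -> 1 <= klen k :> R.
Proof.
move=> k0; have [j kj] : exists j, k 0 j != 0.
  apply/existsP; apply: contraNT k0; rewrite negb_exists => /forallP h.
  by apply/eqP/matrixP => i j; rewrite (ord1 i) mxE; apply/eqP; rewrite -[_ == _]negbK h.
apply: le_trans (ler_norm_klen k j).
rewrite -intr_norm (_ : 1 = 1%:~R)// ler_int.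
by rewrite -gtz0_ge1 normr_gt0.
Qed.

Lemma klen_gt0 k : k != 0 -> 0 < klen k :> R.
Proof. by move=> /klen_ge1; apply: lt_le_trans. Qed.

Lemma dotv_cvec k : dotv (cvec k) (cvec k) = (klen k ^+ 2)%:C :> R[i].
Proof.
by rewrite dotvE !mxE sqr_klen !rmorphD /= !rmorphXn /= -!intr_complex.
Qed.

Lemma sgnb_sq (s : bool) : sgnb s * sgnb s = 1 :> R.
Proof. by case: s; rewrite /sgnb ?expr0 ?expr1 ?mulrNN mulr1. Qed.

Lemma norm_sgnb (s : bool) : `|sgnb s| = 1 :> R.
Proof. by rewrite /sgnb normrX normrN1 expr1n. Qed.

Lemma sqr_imC : (imC : R[i]) * imC = -1.
Proof. by rewrite -expr2; exact: sqr_i. Qed.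

Lemma conj_imC : conjc (imC : R[i]) = - (imC : R[i]).
Proof. by apply/eqP; rewrite eq_complex /= oppr0 !eqxx. Qed.

(** The operator i k x is antisymmetric for the bilinear product. Since conjugation negates
    eigenvalues, this also gives the Hermitian orthogonality of the two helicities in [phi_orth]. *)
Lemma dotv_eigen0 k a b x : x != 0 ->
  imC *: crossv (cvec k) a = x *: a -> imC *: crossv (cvec k) b = x *: b ->
  dotv a b = 0.
Proof.
move=> x0 ea eb; apply/eqP.
have e1 : x * dotv a b = imC * dotv (crossv (cvec k) a) b by rewrite -!dotvZl ea.
have e2 : x * dotv b a = imC * dotv (crossv (cvec k) b) a by rewrite -!dotvZl eb.
have : x * dotv a b = - (x * dotv a b).
  by rewrite [in LHS]e1 dotv_crossC mulrN -e2 dotvC.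
by move/eqP; rewrite -addr_eq0 -mulr2n mulrn_eq0 /= mulf_eq0 (negPf x0).
Qed.

Lemma eigen_conj k a (x : R) : imC *: crossv (cvec k) a = x%:C *: a ->
  imC *: crossv (cvec k) (conjv a) = (- x)%:C *: conjv a.
Proof.
move=> /(congr1 (@conjv R)); rewrite !conjvZ conj_imC conjc_real -crossv_conj conjv_cvec.
by move=> e; rewrite rmorphN /= scaleNr -e scaleNr opprK.
Qed.

(** Eigenspaces for nonzero eigenvalues are lines, shown without a dimension count. Since a.b = 0
    and a.c = 1, the double cross product a x (b x c) equals b. The eigenvalue equation for b makes
    b x c a multiple of k, so b is a multiple of k x a, that is, of a. *)
Lemma eigen_unique k a b c x : x != 0 ->
  imC *: crossv (cvec k) a = x *: a -> imC *: crossv (cvec k) b = x *: b ->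
  dotv (cvec k) c = 0 -> dotv a c = 1 -> b = dotv b c *: a.
Proof.
move=> x0 ea eb kc ac; apply: (scalerI x0).
have ab : dotv a b = 0 by apply: dotv_eigen0 ea eb.
have bE : b = crossv a (crossv b c).
  by rewrite crossv_crossr ac ab scale1r scale0r subr0.
have bc : x *: crossv b c = - (imC * dotv b c) *: cvec k.
  rewrite -crossvZl -eb crossvZl crossv_crossl kc scale0r sub0r scalerN.
  by rewrite scalerA scaleNr.
have -> : x *: b = crossv a (x *: crossv b c) by rewrite crossvZr -bE.
rewrite bc crossvZr crossvC scalerN scaleNr opprK [RHS]scalerA [x * _]mulrC.
by rewrite -[RHS]scalerA -ea scalerA [dotv b c * _]mulrC.
Qed.

(* Expanding the iterated cross products, the derivatives falling on a and b
   recombine into one falling on k. *)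
Lemma triple_eigen (k m n : 'rV[int]_3) f a b x y : k + m + n = 0 ->
  dotv (cvec k) f = 0 -> dotv (cvec m) a = 0 -> dotv (cvec n) b = 0 ->
  imC *: crossv (cvec m) a = x *: a -> imC *: crossv (cvec n) b = y *: b ->
  (x - y) * dotv (crossv f a) b =
    - imC * (dotv f a * dotv (cvec k) b + dotv f b * dotv (cvec k) a).
Proof.
move=> kmn kf ma nb ea eb.
have kmn0 u : dotv (cvec k) u + dotv (cvec m) u + dotv (cvec n) u = 0.
  by rewrite -!dotvDl -!cvecD kmn dotvE !mxE; ring.
have -> : (x - y) * dotv (crossv f a) b =
   imC * dotv (crossv f (crossv (cvec m) a)) b -
   imC * dotv (crossv f a) (crossv (cvec n) b).
  rewrite mulrBl; congr (_ - _); first last.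
    by rewrite -!dotvZr eb.
  by rewrite -!dotvZl -crossvZr -[in RHS]crossvZr ea.
have idn : dotv (crossv f (crossv (cvec m) a)) b -
   dotv (crossv f a) (crossv (cvec n) b) =
   dotv f a * dotv (cvec m) b + dotv f b * dotv (cvec n) a
   - dotv a b * (dotv (cvec m) f + dotv (cvec n) f) :> R[i].
  by rewrite !dotvE !(crossv0E, crossv1E, crossv2E); ring.
have := kmn0 f; rewrite kf add0r => mnf.
have := kmn0 a; rewrite ma addr0 => /eqP; rewrite addrC addr_eq0 => /eqP na.
have := kmn0 b; rewrite nb addr0 => /eqP; rewrite addrC addr_eq0 => /eqP mb.
by rewrite -mulrBr idn mnf na mb; ring.
Qed.

End VectorAlgebra.

(** * Helical decomposition of a field *)

Section HelicalBasis.
Context {R : realType}.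
Variable phi : 'rV[int]_3 -> bool -> 'rV[R[i]]_3.
Hypothesis phi_basis : helical_basis phi.
Implicit Types (u v w : vfield R) (k : 'rV[int]_3) (a : mode).

(** Unlike the coefficient, this vector does not depend on the phase of the chosen unit eigenvector,
    as [hprojE] shows; the reality condition therefore takes the clean form of [hproj_negm]. *)
Definition hproj w a : 'rV[R[i]]_3 := component phi w a *: phi a.1 a.2.

Lemma phi_eigen k s : k != 0 ->
  imC *: crossv (cvec k) (phi k s) = (sgnb s * klen k)%:C *: phi k s.
Proof. by move=> k0; have [_ _ e] := phi_basis s k0; exact: e. Qed.

Lemma sgn_klen_neq0 k (s : bool) : k != 0 -> (sgnb s * klen k)%:C != 0 :> R[i].
Proof.
move=> k0; apply/eqP => /(congr1 (@cmod R)); rewrite cmodC cmod0 normrM norm_sgnb mul1r.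
by move/eqP; rewrite normr_eq0 gt_eqF ?klen_gt0.
Qed.

(** With A = i k x and x = sigma |k|, the square of A is x^2 on the plane orthogonal to k, so (1 +
    A/x)/2 is the spectral projector for x. Its value at w is an eigenvector with the same
    coefficient against the conjugate of phi, and [eigen_unique] identifies it. *)
Lemma hprojE w k s : k != 0 -> dotv (cvec k) (w k) = 0 ->
  hproj w (k, s) =
    2^-1 *: (w k + (sgnb s / klen k)%:C *: (imC *: crossv (cvec k) (w k))).
Proof.
move=> k0 kw; have [ph1 kph _] := phi_basis s k0; have eph := phi_eigen s k0.
have L0 : klen k != 0 :> R by rewrite gt_eqF ?klen_gt0.
set x := (sgnb s * klen k)%:C : R[i]; set y := (sgnb s / klen k)%:C : R[i].
have xy : x * y = 1.
  by rewrite -rmorphM /= mulrACA sgnb_sq mul1r mulfV// rmorph1.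
have x2 : x * x = dotv (cvec k) (cvec k).
  by rewrite dotv_cvec -rmorphM /= mulrACA sgnb_sq mul1r -expr2.
set b := RHS.
have eb : imC *: crossv (cvec k) b = x *: b.
  rewrite /b crossvZr crossvDr !crossvZr crossv_crossr kw scale0r sub0r -x2.
  exact: scaler_eigen sqr_imC xy.
have kb : dotv (conjv (phi k s)) (cvec k) = 0.
  by rewrite -conjv_cvec dotv_conj dotvC kph conjc0.
have bph : dotv b (conjv (phi k s)) = dotv (w k) (conjv (phi k s)).
  have := eigen_conj eph; rewrite -/x => econj.
  rewrite /b dotvZl dotvDl !dotvZl dotv_crossC.
  have -> : imC * - dotv (crossv (cvec k) (conjv (phi k s))) (w k) =
     x * dotv (w k) (conjv (phi k s)).
    by rewrite mulrN -[in LHS]dotvZl econj rmorphN /= -/x dotvZl mulNr opprK dotvC.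
  by rewrite mulrA [y * x]mulrC xy; field.
rewrite /hproj /component /= -bph; symmetry; apply: (eigen_unique (sgn_klen_neq0 s k0) eph eb) => //.
by rewrite dotvC.
Qed.

Lemma hproj_sum w k : k != 0 -> dotv (cvec k) (w k) = 0 ->
  w k = hproj w (k, false) + hproj w (k, true).
Proof.
move=> k0 kw; rewrite !hprojE// -scalerDr /sgnb expr0 expr1 mulN1r mul1r rmorphN /= scaleNr.
set c := _ *: (imC *: _); rewrite addrACA subrr addr0.
have h2 : (2 : R[i]) != 0 by rewrite pnatr_eq0.
by apply: (scalerI h2); rewrite scalerA divff// scale1r scaler_nat mulr2n.
Qed.

Lemma hproj_eigen w k s : k != 0 ->
  imC *: crossv (cvec k) (hproj w (k, s)) =
    (sgnb s * klen k)%:C *: hproj w (k, s).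
Proof.
move=> k0; have eph := phi_eigen s k0.
by rewrite /hproj /= crossvZr scalerA [imC * _]mulrC -scalerA eph !scalerA mulrC.
Qed.

Lemma hproj_perp w k s : k != 0 -> dotv (cvec k) (hproj w (k, s)) = 0.
Proof.
by move=> k0; have [_ kph _] := phi_basis s k0; rewrite /hproj dotvZr kph mulr0.
Qed.

(** The sign is kept: conjugating an eigenvector of i k x gives an eigenvector of i (-k) x with the
    same eigenvalue. *)
Definition negm a : mode := (- a.1, a.2).

Lemma negmK : involutive negm.
Proof. by case=> k s; rewrite /negm /= opprK. Qed.

Lemma modes_negm a : modes (negm a) <-> modes a.
Proof. by rewrite /modes /= oppr_eq0. Qed.

Lemma hproj_negm w a : modes a -> dotv (cvec a.1) (w a.1) = 0 ->
  w (- a.1) = conjv (w a.1) -> hproj w (negm a) = conjv (hproj w a).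
Proof.
case: a => k s; rewrite /modes /= => k0 kw wN.
have kwN : dotv (cvec (- k)) (w (- k)) = 0.
  by rewrite wN cvecN dotvNl -conjv_cvec dotv_conj kw conjc0 oppr0.
rewrite !hprojE ?oppr_eq0// klenN wN conjvZ conjvD !conjvZ conj_imC conjc_real.
rewrite cvecN crossvNl -crossv_conj conjv_cvec scalerN scaleNr.
by congr (_ *: _); rewrite conjc_inv conjc_nat.
Qed.

Lemma cmod_phi k s j : k != 0 -> cmod (phi k s 0 j) <= 1.
Proof.
move=> k0; have [+ _ _] := phi_basis s k0.
rewrite dotvE !conjvE !mulcJ -!rmorphD /= => /complexI h.
rewrite -(@ler_pXn2r _ 2%N) ?nnegrE ?cmod_ge0// expr1n.
have h0 := sqr_ge0 (cmod (phi k s 0 0)); have h1 := sqr_ge0 (cmod (phi k s 0 1)).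
have h2 := sqr_ge0 (cmod (phi k s 0 2%:R)).
by elim/ord3P : j; lra.
Qed.

Lemma cmod_dotv (a b : 'rV[R[i]]_3) (x y : R) :
  (forall j, cmod (a 0 j) <= x) -> (forall j, cmod (b 0 j) <= y) ->
  cmod (dotv a b) <= 3 * x * y.
Proof.
move=> ax by_; rewrite dotvE.
have h j : cmod (a 0 j * b 0 j) <= x * y.
  by rewrite cmodM ler_pM ?cmod_ge0.
apply: le_trans (ler_cmodD _ _) _.
have := ler_cmodD (a 0 0 * b 0 0) (a 0 1 * b 0 1).
have := h 0; have := h 1; have := h 2%:R; lra.
Qed.

Lemma cmod_crossv (a b : 'rV[R[i]]_3) (x y : R) :
  (forall j, cmod (a 0 j) <= x) -> (forall j, cmod (b 0 j) <= y) ->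
  forall j, cmod (crossv a b 0 j) <= 2 * x * y.
Proof.
move=> ax by_ j; rewrite mxE.
have h i l : cmod (a 0 i * b 0 l) <= x * y.
  by rewrite cmodM ler_pM ?cmod_ge0.
apply: le_trans (ler_cmodB _ _) _.
have := h (j + 1) (j + 2%:R); have := h (j + 2%:R) (j + 1); lra.
Qed.

Lemma cmod_hproj w a j : modes a -> cmod (hproj w a 0 j) <= cmod (component phi w a).
Proof.
by move=> a0; rewrite mxE cmodM ler_piMr ?cmod_ge0// cmod_phi.
Qed.

Lemma phi_orth k s : k != 0 -> dotv (phi k s) (conjv (phi k (~~ s))) = 0.
Proof.
move=> k0; have e1 := phi_eigen s k0; have e2 := phi_eigen (~~ s) k0.
apply: (dotv_eigen0 (sgn_klen_neq0 s k0) e1).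
rewrite (eigen_conj e2); congr (_%:C *: _).
by case: s {e1 e2}; rewrite /sgnb /= ?expr0 ?expr1; ring.
Qed.

(** The vector removed by the projection is parallel to n, hence orthogonal to phi; every
    interaction coefficient is thus a plain triple product. *)
Lemma dotv_proj_perp n s (a : 'rV[R[i]]_3) : n != 0 ->
  dotv (proj_perp n a) (conjv (phi n s)) = dotv a (conjv (phi n s)).
Proof.
move=> n0; have [_ kph _] := phi_basis s n0.
rewrite /proj_perp dotvDl dotvNl dotvZl.
have -> : dotv (cvec n) (conjv (phi n s)) = 0.
  by rewrite -(conjv_cvec n) dotv_conj kph conjc0.
by rewrite mulr0 subr0.
Qed.

End HelicalBasis.

(** * Counting resonances *)

Section FiniteCounting.

Lemma size_fibers (T T' : eqType) (f : T -> T') (L : seq T') (s : seq T) (B : nat) :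
  (forall x, x \in s -> f x \in L) ->
  (forall l, (size [seq x <- s | f x == l] <= B)%N) -> (size s <= B * size L)%N.
Proof.
elim: L s => [|l L IH] s sL sB.
  by case: s sL {sB} => // x s /(_ x); rewrite mem_head => /(_ isT).
rewrite -(count_predC (fun x => f x == l)) -!size_filter /= mulnS leq_add//.
apply: IH => [x|l'].
  rewrite mem_filter /= => /andP[fxl xs].
  by have := sL _ xs; rewrite inE (negPf fxl).
apply: leq_trans (sB l'); rewrite -filter_predI !size_filter.
by apply: sub_count => x /= /andP[].
Qed.

Lemma size_inj (T T' : eqType) (f : T -> T') (L : seq T') (s : seq T) :
  uniq s -> {in s &, injective f} -> (forall x, x \in s -> f x \in L) ->
  (size s <= size L)%N.
Proof.
move=> us fi sL; rewrite -(size_map f); apply: uniq_leq_size.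
  by rewrite map_inj_in_uniq.
by move=> _ /mapP[x xs ->]; exact: sL.
Qed.

Definition int_box (N : nat) : seq int := [seq i%:Z - N%:Z | i <- iota 0 (2 * N).+1].

Definition int_box2 (N : nat) : seq (int * int) :=
  [seq (x, y) | x <- int_box N, y <- int_box N].

Lemma mem_int_box (N : nat) (x : int) : (`|x| <= N)%N -> x \in int_box N.
Proof.
move=> xN; apply/mapP; exists (absz (x + N%:Z)).
  by rewrite mem_iota; lia.
by lia.
Qed.

Lemma mem_int_box2 (N : nat) (x y : int) :
  (`|x| <= N)%N -> (`|y| <= N)%N -> (x, y) \in int_box2 N.
Proof. by move=> xN yN; apply/allpairsP; exists (x, y); rewrite !mem_int_box. Qed.

Lemma size_int_box2 (N : nat) : size (int_box2 N) = ((2 * N).+1 ^ 2)%N.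
Proof. by rewrite size_allpairs !size_map size_iota. Qed.

End FiniteCounting.

Section ResonanceCounting.
Context {R : realType}.
Implicit Types (k m n : 'rV[int]_3) (s : seq 'rV[int]_3).

(* Squaring A + B = c twice with A = +-x/sqrt(p+x^2) and
   B = +-(z-x)/sqrt(q+(z-x)^2) gives a polynomial equation of degree 8 in x,
   with leading coefficient c^2(c^2-4). *)
Lemma resonance_roots (p q z c : R) (xs : seq R) : c != 0 -> c ^+ 2 <= 1 -> uniq xs ->
  (forall x, x \in xs ->
    (c ^+ 2 * ((p + x ^+ 2) * (q + (z - x) ^+ 2)) - x ^+ 2 * (q + (z - x) ^+ 2)
      - (z - x) ^+ 2 * (p + x ^+ 2)) ^+ 2
    = 4 * (x ^+ 2 * (q + (z - x) ^+ 2)) * ((z - x) ^+ 2 * (p + x ^+ 2))) ->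
  (size xs <= 8)%N.
Proof.
move=> c0 c1 uxs xsE; pose g := q + z ^+ 2.
(* [D] is the expression under the square on the left, [E] and [F] are the two products on the
   right, all expanded in x with q + (z - x)^2 = g - 2 z x + x^2. *)
pose D := Poly [:: c ^+ 2 * p * g - z ^+ 2 * p; - 2 * z * p * (c ^+ 2 - 1);
   c ^+ 2 * (p + g) - g - p - z ^+ 2; - 2 * z * (c ^+ 2 - 2); c ^+ 2 - 2].
pose E := Poly [:: 0; 0; g; - 2 * z; 1].
pose F := Poly [:: z ^+ 2 * p; - 2 * z * p; p + z ^+ 2; - 2 * z; 1].
pose W := D * D - (4 *: E) * F.
have W8 : W`_8 = c ^+ 2 * (c ^+ 2 - 4).
  by rewrite /W coefB !coefM !big_ord_recl !big_ord0 !coefZ !coef_Poly /=; ring.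
have W0 : W != 0.
  apply/eqP => W0; move: W8; rewrite W0 coef0 => /esym/eqP.
  (* The bound c^2 <= 1 excludes c^2 = 4. *)
  rewrite mulf_eq0 expf_eq0 /= (negPf c0) /= => /eqP; lra.
have Wroot : all (root W) xs.
  apply/allP => x xxs; rewrite /root /W hornerD hornerN !hornerM hornerZ !horner_Poly /=.
  rewrite /= subr_eq0; apply/eqP.
  have := xsE _ xxs; rewrite /g => h.
  transitivity ((c ^+ 2 * ((p + x ^+ 2) * (q + (z - x) ^+ 2)) - x ^+ 2 * (q + (z - x) ^+ 2)
      - (z - x) ^+ 2 * (p + x ^+ 2)) ^+ 2); first by ring.
  by rewrite h; ring.
rewrite -ltnS; apply: leq_trans (max_poly_roots W0 Wroot uxs) _.
rewrite (leq_trans (size_polyD _ _))// size_polyN geq_max; apply/andP; split.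
  rewrite (leq_trans (size_polyMleq _ _))//.
  by have : (size D <= 5)%N := size_Poly _; move: (size D) => d; lia.
rewrite (leq_trans (size_polyMleq _ _))//.
have : (size (4 *: E) <= 5)%N by rewrite (leq_trans (size_scale_leq _ _))// size_Poly.
have : (size F <= 5)%N := size_Poly _.
by move: (size F) (size (4 *: E)) => f e; lia.
Qed.

Lemma ord_max3 : ord_max = 2%:R :> 'I_3.
Proof. exact/val_inj. Qed.

Lemma freqE (a : mode) : freq a = sgnb a.2 * (a.1 0 2%:R)%:~R / klen a.1 :> R.
Proof. by rewrite /freq ord_max3. Qed.

Lemma sqr_freq (a : mode) : modes a ->
  freq a ^+ 2 * klen a.1 ^+ 2 = ((a.1 0 2%:R)%:~R ^+ 2 : R).
Proof.
move=> a0; have k0 : klen a.1 != 0 :> R by rewrite gt_eqF// klen_gt0.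
by rewrite freqE -exprMn divfK// exprMn expr2 sgnb_sq mul1r.
Qed.

(** For A + B = c one has (c^2 - A^2 - B^2)^2 = 4 A^2 B^2, where the signs have disappeared;
    multiplying by |k|^4 |m|^4 clears the denominators. *)
Lemma resonance_eq k m n (s1 s2 s3 : bool) : k != 0 -> m != 0 -> k + m = n ->
  freq (k, s1) + freq (m, s2) = freq (n, s3) :> R ->
  let x := (k 0 2%:R)%:~R : R in let y := (m 0 2%:R)%:~R : R in
  let c := freq (n, s3) : R in
  (c ^+ 2 * (klen k ^+ 2 * klen m ^+ 2) - x ^+ 2 * klen m ^+ 2 - y ^+ 2 * klen k ^+ 2) ^+ 2
   = 4 * (x ^+ 2 * klen m ^+ 2) * (y ^+ 2 * klen k ^+ 2).
Proof.
move=> k0 m0 kmn /= <-.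
rewrite -(sqr_freq (a := (k, s1)))// -(sqr_freq (a := (m, s2)))//=.
by ring.
Qed.

Lemma klen_coord k m j : klen k <= klen m :> R ->
  (`|k 0%R j| <= Num.truncn (klen m : R))%N.
Proof.
move=> km; rewrite truncn_ge_nat ?klen_ge0// natr_absz intr_norm.
exact: le_trans (ler_norm_klen k j) km.
Qed.

Lemma row3_int_inj k m : k 0 0 = m 0 0 -> k 0 1 = m 0 1 -> k 0 2%:R = m 0 2%:R -> k = m.
Proof.
move=> e0 e1 e2; apply/matrixP => i j; rewrite (ord1 i); by elim/ord3P : j.
Qed.

Lemma resonance_count n (s1 s2 s3 : bool) s : n != 0 -> uniq s ->
  (forall k, k \in s -> [/\ k != 0, n - k != 0, klen k <= klen n :> R &
    freq (k, s1) + freq (n - k, s2) = freq (n, s3) :> R]) ->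
  (size s <= 8 * (2 * Num.truncn (klen n : R)).+1 ^ 2)%N.
Proof.
move=> n0 us sP; set N := Num.truncn _; rewrite -size_int_box2.
have sbox k : k \in s -> forall j, (`|k 0%R j| <= N)%N.
  by move=> /sP[_ _ kn _] j; exact: klen_coord.
(* If n_3 is nonzero, so is the frequency of n, and each line of fixed (k_1, k_2) carries at most 8
   resonant points. *)
have [n3|n3] := eqVneq (n 0 2%:R) 0; last first.
  apply: (size_fibers (f := fun k => (k 0 0, k 0 1))) => [k ks|[a b]].
    by rewrite mem_int_box2// sbox.
  pose xs := [seq (k 0 2%:R)%:~R : R | k <- s & (k 0 0, k 0 1) == (a, b)].
  have <- : size xs = size [seq k : 'rV[int]_3 <- s | (k 0 0, k 0 1) == (a, b)] by rewrite size_map.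
  have c0 : freq (n, s3) != 0 :> R.
    rewrite freqE /=; apply: mulf_neq0; last by rewrite invr_neq0// gt_eqF ?klen_gt0.
    by apply: mulf_neq0; rewrite ?intr_eq0// /sgnb signr_eq0.
  apply: (@resonance_roots (a%:~R ^+ 2 + b%:~R ^+ 2)
    ((n 0 0 - a)%:~R ^+ 2 + (n 0 1 - b)%:~R ^+ 2) (n 0 2%:R)%:~R (freq (n, s3)) xs) => //.
  - have := sqr_freq (a := (n, s3)) n0.
    have L2 : 0 < klen n ^+ 2 :> R by rewrite exprn_gt0// klen_gt0.
    move=> /= h; rewrite -(ler_pM2r L2) h mul1r sqr_klen lerDr.
    by rewrite addr_ge0 ?sqr_ge0.
  - rewrite map_inj_in_uniq ?filter_uniq// => k m.
    rewrite !mem_filter => /andP[/eqP[ka kb] _] /andP[/eqP[ma mb] _] /intr_inj km.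
    by apply: row3_int_inj; rewrite ?ka ?kb.
  - move=> x /mapP[k]; rewrite mem_filter => /andP[/eqP[ka kb] /sP[k0 nk0 _ kres]] ->.
    have knk : k + (n - k) = n by rewrite addrC subrK.
    have := resonance_eq k0 nk0 knk kres => /=.
    by rewrite !sqr_klen !mxE ka kb -!intrB.
have fn0 : freq (n, s3) = 0 :> R by rewrite freqE /= n3 mulr0 mul0r.
(* For n_3 = 0 the polynomial degenerates, since c = 0. But then m_3 = -k_3 and the resonance reads
   sigma_1 k_3/|k| = sigma_2 k_3/|m|: either k_3 = 0 or |k| = |m|, and the latter is the plane 2 k.n
   = |n|^2. Each of the two planes contributes at most (2N+1)^2 points. *)
have sP' k : k \in s -> k 0 2%:R != 0 ->
    2 * ((k 0 0)%:~R * (n 0 0)%:~R + (k 0 1)%:~R * (n 0 1)%:~R)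
    = (n 0 0)%:~R ^+ 2 + (n 0 1)%:~R ^+ 2 :> R.
  move=> /sP[k0 nk0 _]; rewrite fn0 !freqE /= !mxE n3 sub0r rmorphN /= => kres k3.
  have Lk : klen k != 0 :> R by rewrite gt_eqF// klen_gt0.
  have Lm : klen (n - k) != 0 :> R by rewrite gt_eqF// klen_gt0.
  have x0 : (k 0 2%:R)%:~R != 0 :> R by rewrite intr_eq0.
  have e : sgnb s1 * klen (n - k) = sgnb s2 * klen k :> R.
    apply: (mulIf x0); apply/eqP; rewrite -subr_eq0; apply/eqP.
    transitivity ((sgnb s1 * (k 0 2%:R)%:~R / klen k
       + sgnb s2 * - (k 0 2%:R)%:~R / klen (n - k)) * (klen k * klen (n - k)) : R).
      by field; rewrite Lk Lm.
    by rewrite kres mul0r.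
  have : klen (n - k) ^+ 2 = klen k ^+ 2 :> R.
    have := congr1 (fun x => x ^+ 2) e.
    by rewrite !exprMn ![sgnb _ ^+ 2]expr2 !sgnb_sq !mul1r.
  by rewrite !sqr_klen !mxE n3 sub0r !rmorphD !rmorphN /=; lra.
rewrite (leq_trans (_ : _ <= size (int_box2 N) + size (int_box2 N))%N)//; last by lia.
rewrite -(count_predC (fun k : 'rV[int]_3 => k 0 2%:R == 0)) -!size_filter leq_add//.
  apply: (size_inj (f := fun k => (k 0 0, k 0 1))); first exact: filter_uniq.
    move=> k m; rewrite !mem_filter => /andP[/eqP k3 _] /andP[/eqP m3 _] [e0 e1].
    by apply: row3_int_inj; rewrite ?k3 ?m3.
  by move=> k; rewrite mem_filter => /andP[_ ks]; rewrite mem_int_box2// sbox.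
(* The plane is parametrized by the two coordinates that omit one in which n does not vanish. *)
have [n1|n1] := eqVneq (n 0 0) 0.
  have n2 : n 0 1 != 0.
    by apply: contraNN n0 => /eqP n2; apply/eqP/row3_int_inj; rewrite !mxE.
  apply: (size_inj (f := fun k => (k 0 0, k 0 2%:R))); first exact: filter_uniq.
    move=> k m; rewrite !mem_filter => /andP[/= k3 ks] /andP[/= m3 ms] [e0 e2].
    apply: row3_int_inj => //; apply: (@intr_inj R).
    have := sP' _ ks k3; rewrite -(sP' _ ms m3) n1.
    have n2' : (n 0 1)%:~R != 0 :> R by rewrite intr_eq0.
    by rewrite !mulr0 !add0r => h; apply: (mulIf n2'); lra.
  by move=> k; rewrite mem_filter => /andP[_ ks]; rewrite mem_int_box2// sbox.
apply: (size_inj (f := fun k => (k 0 1, k 0 2%:R))); first exact: filter_uniq.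
  move=> k m; rewrite !mem_filter => /andP[/= k3 ks] /andP[/= m3 ms] [e1 e2].
  apply: row3_int_inj => //; apply: (@intr_inj R).
  have := sP' _ ks k3; rewrite -(sP' _ ms m3) e1.
  have n1' : (n 0 0)%:~R != 0 :> R by rewrite intr_eq0.
  by move=> h; apply: (mulIf n1'); lra.
by move=> k; rewrite mem_filter => /andP[_ ks]; rewrite mem_int_box2// sbox.
Qed.

Definition low_pairs (c : mode) : set (mode * mode) :=
  resonant_pairs (R := R) c `&` [set p | klen p.1.1 <= klen c.1 :> R].

(** For N the integer part of |n|, four sign pairs with at most 8 (2N+1)^2 wave vectors each give 32
    (2N+1)^2 <= 32 (3N)^2 = 2 * 12^2 N^2; the last inequality uses N >= 1. *)
Lemma low_pairs_count (c : mode) : modes c ->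
  (\esum_(p in low_pairs c) 1%:E <= (2 * 12 ^+ 2 * klen c.1 ^+ 2)%:E :> \bar R)%E.
Proof.
case: c => n s3 n0; rewrite /modes /= in n0.
set N := Num.truncn (klen n : R).
apply: ge_ereal_sup => _ [X [finX XD]] <-.
rewrite fsbig_finite//= sumEFin lee_fin.
set fs := finmap.enum_fset _; rewrite -/fs.
have ufs : uniq fs by exact: finmap.fset_uniq.
rewrite big_const_seq count_predT iter_addr addr0.
have XP p : p \in fs -> low_pairs (n, s3) p.
  by rewrite /fs in_fset_set// inE => /XD.
have sX : (size fs <= (8 * (2 * N).+1 ^ 2) * 4)%N.
  apply: (size_fibers (f := fun p => (p.1.2, p.2.2))
    (L := [:: (true, true); (true, false); (false, true); (false, false)])).
    by move=> [[k [|]] [m [|]]].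
  move=> [s1 s2].
  rewrite -(size_map (fun p => p.1.1)).
  apply: (@resonance_count n s1 s2 s3) => //.
    rewrite map_inj_in_uniq ?filter_uniq// => -[[k b1] [m b2]] [[k' b1'] [m' b2']].
    rewrite !mem_filter /= => /andP[/eqP[-> ->] /XP[[_ _ /= km _] _]].
    move=> /andP[/eqP[-> ->] /XP[[_ _ /= km' _] _]] kk'.
    by move: km; rewrite -km' kk' => /addrI ->.
  move=> _ /mapP[[[k b1] [m b2]] + ->] /=.
  rewrite mem_filter /= => /andP[/eqP[-> ->] /XP[[/= k0 m0 km res] kn]].
  have nk : n - k = m by rewrite -km addrC addKr.
  rewrite nk; split=> //.
  by move: res; rewrite /= => res; lra.
have N1 : (1 <= N)%N by rewrite truncn_gt0 klen_ge1.
have NL : N%:R <= klen n :> R by rewrite truncn_le klen_ge0.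
have h : ((8 * (2 * N).+1 ^ 2) * 4 <= 2 * 12 ^ 2 * N ^ 2)%N by nia.
have castE (a x y : nat) : (a * x ^ 2 * y ^ 2)%:R = a%:R * x%:R ^+ 2 * y%:R ^+ 2 :> R.
  by rewrite natrM (natrM _ a) !natrX.
move: (leq_trans sX h); rewrite -(ler_nat R) => /le_trans; apply.
rewrite castE; apply: ler_wpM2l; first by rewrite mulr_ge0 ?sqr_ge0.
by apply: lerXn2r; rewrite ?nnegrE ?klen_ge0.
Qed.

End ResonanceCounting.

(** * Comparison of sums over different index sets *)

Section EsumTransport.
Context {R : realType}.

Lemma esumZ_ge0 (T : choiceType) (D : set T) (c : R) (f : T -> R) :
  0 <= c -> (forall i, 0 <= f i) ->
  (\esum_(i in D) (c * f i)%:E = c%:E * \esum_(i in D) (f i)%:E)%E.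
Proof. by move=> c0 f0; rewrite -esumZl// => i _; rewrite lee_fin. Qed.

Lemma esum_subset (T : choiceType) (A B : set T) (f : T -> \bar R) :
  A `<=` B -> (forall i, B i -> 0 <= f i)%E ->
  (\esum_(i in A) f i <= \esum_(i in B) f i)%E.
Proof.
move=> AB f0; rewrite (esumID A B)// (setIidr AB) leeDl//.
by apply: esum_ge0 => i [/f0].
Qed.

Lemma esum_inj_le (T T' : choiceType) (A : set T) (B : set T') (e : T -> T')
    (f : T' -> \bar R) :
  set_inj A e -> (forall i, A i -> B (e i)) -> (forall j, B j -> 0 <= f j)%E ->
  (\esum_(i in A) f (e i) <= \esum_(j in B) f j)%E.
Proof.
move=> ei eAB f0; rewrite -esum_image//; apply: esum_subset => // _ [i Ai <-].
exact: eAB.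
Qed.

Lemma esum_bool (x : \bar R) : (0 <= x)%E -> (\esum_(b in [set: bool]) x = x + x)%E.
Proof.
move=> x0; rewrite (esumID [set true])//.
rewrite (_ : _ `&` [set true] = [set true]); last by rewrite setTI.
rewrite (_ : _ `&` ~` [set true] = [set false]); last first.
  by apply/seteqP; split=> [[]|[]] //= [].
by rewrite !esum_set1.
Qed.

Lemma esum_mul_le (T T' : choiceType) (A : set T) (B : set T') (f : T -> R)
    (g : T' -> R) (x y : R) : 0 <= y -> (forall i, 0 <= f i) -> (forall j, 0 <= g j) ->
  (\esum_(i in A) (f i)%:E <= x%:E)%E -> (\esum_(j in B) (g j)%:E <= y%:E)%E ->
  (\esum_(p in A `*`` (fun=> B)) (f p.1 * g p.2)%:E <= (x * y)%:E)%E.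
Proof.
move=> y0 f0 g0 fx gy; rewrite -(esum_esum (a := fun i j => (f i * g j)%:E)); last first.
  by move=> i j _ _; rewrite lee_fin mulr_ge0.
apply: (@le_trans _ _ (\esum_(i in A) (y * f i)%:E)%E).
  apply: le_esum => i _; rewrite esumZ_ge0// mulrC EFinM.
  by rewrite lee_wpmul2l// lee_fin.
by rewrite esumZ_ge0// mulrC EFinM lee_wpmul2l// lee_fin.
Qed.

(** Cauchy-Schwarz is recovered from weighted Young inequalities by optimizing the weight: l = y/x.
    When x = 0 a large l contradicts t > 0, when y = 0 a small one does. *)
Lemma le_scaled_sum (t x y : R) : 0 <= t -> 0 <= x -> 0 <= y ->
  (forall l, 0 < l -> t <= l * x ^+ 2 + l^-1 * y ^+ 2) -> t <= 2 * (x * y).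
Proof.
move=> t0 x0 y0 h; have [x00|xn0] := eqVneq x 0.
  rewrite x00 in h *.
  rewrite mul0r mulr0 leNgt; apply/negP => tp.
  have l0 : 0 < (y ^+ 2 + 1) / t by rewrite divr_gt0// ltr_pwDr// sqr_ge0.
  have := h _ l0; rewrite expr0n mulr0 add0r invf_div leNgt => /negP; apply.
  rewrite mulrAC ltr_pdivrMr ?ltr_pwDr ?sqr_ge0//.
  by rewrite ltr_pM2l// ltrDl.
have [y00|yn0] := eqVneq y 0.
  rewrite y00 in h *.
  rewrite !mulr0 leNgt; apply/negP => tp.
  have l0 : 0 < t / (x ^+ 2 + 1) by rewrite divr_gt0// ltr_pwDr// sqr_ge0.
  have := h _ l0; rewrite expr0n mulr0 addr0 leNgt => /negP; apply.
  rewrite mulrAC ltr_pdivrMr ?ltr_pwDr ?sqr_ge0//.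
  by rewrite ltr_pM2l// ltrDl.
have l0 : 0 < y / x by rewrite divr_gt0// lt_neqAle eq_sym ?xn0 ?yn0.
apply: (le_trans (h _ l0)); rewrite le_eqVlt; apply/orP; left; apply/eqP.
by field; rewrite xn0 yn0.
Qed.

End EsumTransport.

(** * The trilinear estimate over resonant triads *)

Section TrilinearEstimate.
Context {R : realType}.
Implicit Types (a b d : mode -> R).

(** A point is (n, (k, m)), signs included. The output mode comes first so that the set is fibred
    over n, as are the sums that define a pairing with [Btilde]. *)
Definition triads : set (mode * (mode * mode)) :=
  modes `*`` (fun c => resonant_pairs (R := R) c).

Definition low_triads : set (mode * (mode * mode)) :=
  modes `*`` (fun c => low_pairs (R := R) c).

(** Young's inequality with weight l separates (a b)^2 from d^2. The first sum costs a factor 2, the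
    sign of n being the only freedom left by (k, m). In the second, the count 2 * 12^2 |n|^2 is
    exactly the H^1 weight of d. The optimal l gives 2 * 12 = 24. *)
Lemma low_triads_le a b d (A B D : R) : 0 <= A -> 0 <= B -> 0 <= D ->
  (\esum_(i in modes) (a i ^+ 2)%:E <= (A ^+ 2)%:E)%E ->
  (\esum_(i in modes) (b i ^+ 2)%:E <= (B ^+ 2)%:E)%E ->
  (\esum_(i in modes) (klen i.1 ^+ 2 * d i ^+ 2)%:E <= (D ^+ 2)%:E)%E ->
  (forall i, 0 <= a i) -> (forall i, 0 <= b i) -> (forall i, 0 <= d i) ->
  (\esum_(x in low_triads) (a x.2.1 * b x.2.2 * d x.1)%:E <= (24 * (A * B * D))%:E)%E.
Proof.
move=> A0 B0 D0 aA bB dD a0 b0 d0.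
have ab : (\esum_(x in low_triads) ((a x.2.1 * b x.2.2) ^+ 2)%:E
    <= (2 * (A * B) ^+ 2)%:E)%E.
  pose f (p : mode * mode) := a p.1 ^+ 2 * b p.2 ^+ 2.
  have f0 p : 0 <= f p by rewrite mulr_ge0 ?sqr_ge0.
  have fAB : (\esum_(p in modes `*`` (fun=> modes)) (f p)%:E <= ((A * B) ^+ 2)%:E)%E.
    rewrite exprMn; apply: (esum_mul_le (f := fun i => a i ^+ 2) (g := fun i => b i ^+ 2)) => //.
    - exact: sqr_ge0.
    - by move=> i; exact: sqr_ge0.
    - by move=> i; exact: sqr_ge0.
  (* The wave vector n = k + m is forgotten but its sign is kept, which makes the map injective. *)
  pose e (x : mode * (mode * mode)) := (x.1.2, x.2).
  rewrite (eq_esum (b := fun x => (f (e x).2)%:E)); last first.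
    by move=> x _; rewrite /f exprMn.
  apply: (@le_trans _ _ (\esum_(y in [set: bool] `*`` (fun=> modes `*`` (fun=> modes)))
      (f y.2)%:E)%E).
    apply: (esum_inj_le (e := e) (f := fun y => (f y.2)%:E)).
    - move=> [[n s] [[k s1] [m s2]]] [[n' s'] [[k' s1'] [m' s2']]].
      rewrite !inE => -[_ [[_ _ /= kmn _] _]] [_ [[_ _ /= kmn' _] _]] [-> ek -> em ->].
      by rewrite -kmn -kmn' ek em.
    - by move=> [c [k m]] [_ [[/= k0 m0 _ _] _]].
    - by move=> y _; rewrite lee_fin.
  rewrite -(esum_esum (a := fun _ p => (f p)%:E)); last by move=> *; rewrite lee_fin.
  rewrite esum_bool; last by apply: esum_ge0 => p _; rewrite lee_fin.
  by rewrite mulr2n mulrDl mul1r EFinD leeD.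
have dd : (\esum_(x in low_triads) (d x.1 ^+ 2)%:E <= (2 * 12 ^+ 2 * D ^+ 2)%:E)%E.
  rewrite -(esum_esum (a := fun c _ => (d c ^+ 2)%:E)); last first.
    by move=> *; rewrite lee_fin sqr_ge0.
  apply: (@le_trans _ _ (\esum_(c in modes) (2 * 12 ^+ 2 * (klen c.1 ^+ 2 * d c ^+ 2))%:E)%E).
    apply: le_esum => c c0.
    rewrite (eq_esum (b := fun=> (d c ^+ 2 * 1)%:E)); last by move=> *; rewrite mulr1.
    rewrite esumZ_ge0 ?sqr_ge0// mulrA mulrC [leRHS]EFinM.
    by rewrite lee_wpmul2l ?lee_fin ?sqr_ge0// low_pairs_count.
  rewrite esumZ_ge0//; last by move=> i; rewrite mulr_ge0 ?sqr_ge0.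
  by rewrite [leRHS]EFinM lee_wpmul2l// lee_fin mulr_ge0// sqr_ge0.
set S := esum _ _.
have S0 : (0 <= S)%E by apply: esum_ge0 => x _; rewrite lee_fin !mulr_ge0.
have Sl l : 0 < l -> (S <= (l * (A * B) ^+ 2 + l^-1 * (12 * D) ^+ 2)%:E)%E.
  move=> l0; apply: (@le_trans _ _ (\esum_(x in low_triads)
     (((l / 2) * (a x.2.1 * b x.2.2) ^+ 2)%:E + ((l^-1 / 2) * d x.1 ^+ 2)%:E))%E).
    apply: le_esum => x _; rewrite -EFinD lee_fin.
    move: (a x.2.1 * b x.2.2) (d x.1) => u v; rewrite -subr_ge0.
    rewrite (_ : _ - _ = l^-1 / 2 * (l * u - v) ^+ 2); last by field; rewrite gt_eqF.
    by rewrite mulr_ge0 ?sqr_ge0// divr_ge0// invr_ge0 ltW.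
  have l20 : 0 <= l / 2 by rewrite divr_ge0// ltW.
  have li20 : 0 <= l^-1 / 2 by rewrite divr_ge0// invr_ge0 ltW.
  rewrite esumD; try by move=> *; rewrite lee_fin mulr_ge0 ?sqr_ge0.
  rewrite !esumZ_ge0//; try by move=> *; rewrite sqr_ge0.
  rewrite EFinD leeD//.
    rewrite [leRHS](_ : _ = ((l / 2) * (2 * (A * B) ^+ 2))%:E).
      by rewrite [leRHS]EFinM lee_wpmul2l// lee_fin.
    by congr (_%:E); field.
  rewrite [leRHS](_ : _ = ((l^-1 / 2) * (2 * 12 ^+ 2 * D ^+ 2))%:E).
    by rewrite [leRHS]EFinM lee_wpmul2l// lee_fin.
  by congr (_%:E); field; rewrite gt_eqF.
have Sfin : S \is a fin_num.
  by rewrite ge0_fin_numE//; apply: le_lt_trans (Sl 1 ltr01) (ltry _).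
rewrite -(fineK Sfin) lee_fin (_ : 24 * _ = 2 * (A * B * (12 * D))); last by ring.
apply: le_scaled_sum; rewrite ?mulr_ge0//; first exact: fine_ge0.
by move=> l l0; rewrite -lee_fin fineK// Sl.
Qed.

Lemma freq_negm (i : mode) : freq (negm i) = - freq i :> R.
Proof. by rewrite !freqE /= klenN mxE rmorphN /= mulrN mulNr. Qed.

Lemma esum_negm (f : mode -> R) :
  (\esum_(i in modes) (f (negm i))%:E = \esum_(i in modes) (f i)%:E)%E.
Proof.
rewrite [RHS](reindex_esum modes modes negm)//; split.
- by move=> i /modes_negm.
- by move=> i j _ _; exact: (can_inj negmK).
- by move=> i i0; exists (negm i); [exact/modes_negm|rewrite negmK].
Qed.

Lemma trilinear a b d (A0 A1 B1 D0 D1 : R) :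
  0 <= A0 -> 0 <= A1 -> 0 <= B1 -> 0 <= D0 -> 0 <= D1 ->
  (\esum_(i in modes) (a i ^+ 2)%:E <= (A0 ^+ 2)%:E)%E ->
  (\esum_(i in modes) (klen i.1 ^+ 2 * a i ^+ 2)%:E <= (A1 ^+ 2)%:E)%E ->
  (\esum_(i in modes) (klen i.1 ^+ 2 * b i ^+ 2)%:E <= (B1 ^+ 2)%:E)%E ->
  (\esum_(i in modes) (d i ^+ 2)%:E <= (D0 ^+ 2)%:E)%E ->
  (\esum_(i in modes) (klen i.1 ^+ 2 * d i ^+ 2)%:E <= (D1 ^+ 2)%:E)%E ->
  (forall i, 0 <= a i) -> (forall i, 0 <= b i) -> (forall i, 0 <= d i) ->
  (\esum_(x in triads) (klen x.2.2.1 * a x.2.1 * b x.2.2 * d x.1)%:E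
    <= (24 * B1 * (A0 * D1 + A1 * D0))%:E)%E.
Proof.
move=> A00 A10 B10 D00 D10 aA0 aA1 bB1 dD0 dD1 a0 b0 d0.
pose b' i := klen i.1 * b i.
have b'0 i : 0 <= b' i by rewrite mulr_ge0 ?klen_ge0.
have bB1' : (\esum_(i in modes) (b' i ^+ 2)%:E <= (B1 ^+ 2)%:E)%E.
  by apply: le_trans bB1; apply: le_esum => i _; rewrite /b' exprMn.
have bB1N : (\esum_(i in modes) (b' (negm i) ^+ 2)%:E <= (B1 ^+ 2)%:E)%E.
  by rewrite (esum_negm (fun i => b' i ^+ 2)).
rewrite (eq_esum (b := fun x => (a x.2.1 * b' x.2.2 * d x.1)%:E)); last first.
  by move=> x _; congr (_%:E); rewrite /b'; ring.
pose low : set (mode * (mode * mode)) := [set x | klen x.2.1.1 <= klen x.1.1 :> R].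
rewrite (esumID low); last by move=> x _; rewrite lee_fin !mulr_ge0 ?klen_ge0.
rewrite mulrDr EFinD; apply: leeD.
  rewrite (_ : triads `&` low = low_triads); last first.
    by apply/seteqP; split=> [x [[x1 x2] xl]|x [x1 [x2 xl]]].
  by rewrite (_ : 24 * B1 * _ = 24 * (A0 * B1 * D1)); [exact: low_triads_le|ring].
(* The relation k + m = n is rewritten as n + (-m) = k; frequencies being odd, resonance persists. A
   triad with |k| > |n| becomes a low one with a and d exchanged, whence the second term of the
   bound. *)
pose e (x : mode * (mode * mode)) := (x.2.1, (x.1, negm x.2.2)).
rewrite (eq_esum (b := fun x => (d (e x).2.1 * b' (negm (e x).2.2) * a (e x).1)%:E)); last first.
  by move=> x _; congr (_%:E); rewrite /e /= negmK; ring.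
apply: (@le_trans _ _ (\esum_(y in low_triads) (d y.2.1 * b' (negm y.2.2) * a y.1)%:E)%E).
  apply: (esum_inj_le (e := e) (f := fun y => (d y.2.1 * b' (negm y.2.2) * a y.1)%:E)).
  - move=> [c [k [m s]]] [c' [k' [m' s']]] _ _ [-> -> em ->].
    by rewrite (oppr_inj em).
  - move=> [c [k m]] [[/= c0 [/= k0 m0 kmc res]] /negP]; rewrite -ltNge => kc.
    split=> //; split=> /=; last exact: ltW.
    split=> //=; first exact/modes_negm.
      by rewrite -kmc addrK.
    by move: res; rewrite freq_negm; lra.
  - by move=> y _; rewrite lee_fin !mulr_ge0 ?klen_ge0.
rewrite (_ : 24 * B1 * _ = 24 * (D0 * B1 * A1)); last ring.
exact: (low_triads_le (b := fun i => b' (negm i))).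
Qed.

End TrilinearEstimate.

(** * Complex sums and the resonant bilinear form *)

Section ComplexSums.
Context {R : realType}.

Lemma complex_eqP (z w : R[i]) :
  complex.Re z = complex.Re w -> complex.Im z = complex.Im w -> z = w.
Proof. by move=> re im; apply/eqP; rewrite eq_complex re im !eqxx. Qed.

Lemma cReM (z w : R[i]) : complex.Re (z * w) =
  complex.Re z * complex.Re w - complex.Im z * complex.Im w.
Proof. by case: z => a b; case: w => c d. Qed.

Lemma cImM (z w : R[i]) : complex.Im (z * w) =
  complex.Re z * complex.Im w + complex.Im z * complex.Re w.
Proof. by case: z => a b; case: w => c d. Qed.

Lemma cReD (z w : R[i]) : complex.Re (z + w) = complex.Re z + complex.Re w.
Proof. by case: z => a b; case: w => c d. Qed.

Lemma cImD (z w : R[i]) : complex.Im (z + w) = complex.Im z + complex.Im w.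
Proof. by case: z => a b; case: w => c d. Qed.

Lemma cReN (z : R[i]) : complex.Re (- z) = - complex.Re z.
Proof. by case: z. Qed.

Lemma cImN (z : R[i]) : complex.Im (- z) = - complex.Im z.
Proof. by case: z. Qed.

Section AbsSummable.
Context {T : choiceType}.
Implicit Types (D : set T) (f g : T -> R[i]).

Lemma abs_summableE D f :
  abs_summable D f <-> (\esum_(i in D) (cmod (f i))%:E < +oo)%E.
Proof.
rewrite /abs_summable /summable (eq_esum (b := fun i => (cmod (f i))%:E))// => i _.
by rewrite /= ger0_norm// cmod_ge0.
Qed.

Lemma abs_summable_le D f (M : R) :
  (\esum_(i in D) (cmod (f i))%:E <= M%:E)%E -> abs_summable D f.
Proof. by move=> h; apply/abs_summableE; apply: le_lt_trans h (ltry _). Qed.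

Lemma abs_summable_Re D f : abs_summable D f ->
  summable D (EFin \o (fun i => complex.Re (f i))).
Proof.
by move=> /abs_summableE; apply: summable_le => i _; exact: ler_norm_Re.
Qed.

Lemma abs_summable_Im D f : abs_summable D f ->
  summable D (EFin \o (fun i => complex.Im (f i))).
Proof.
by move=> /abs_summableE; apply: summable_le => i _; exact: ler_norm_Im.
Qed.

Lemma eq_csum D f g : (forall i, D i -> f i = g i) -> csum D f = csum D g.
Proof.
by move=> fg; rewrite /csum; congr (_ +i* _); apply: eq_rsum => i Di; rewrite fg.
Qed.

Lemma eq_abs_summable D f g : (forall i, D i -> f i = g i) ->
  abs_summable D f -> abs_summable D g.
Proof.
move=> fg /abs_summableE h; apply/abs_summableE.
by rewrite -(@eq_esum _ _ _ (fun i => (cmod (f i))%:E))// => i Di; rewrite fg.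
Qed.

(** The factor 2 comes from estimating the real and imaginary parts separately. *)
Lemma cmod_csum D f (M : R) : (\esum_(i in D) (cmod (f i))%:E <= M%:E)%E ->
  cmod (csum D f) <= 2 * M.
Proof.
move=> fM; apply: le_trans (ler_cmod_ReIm _) _; rewrite mulr2n mulrDl mul1r.
apply: lerD; apply: ler_norm_rsum; apply: le_trans fM; apply: le_esum => i _;
  rewrite lee_fin.
  exact: ler_norm_Re.
exact: ler_norm_Im.
Qed.

End AbsSummable.

Lemma reindex_csum {T T' : choiceType} (D : set T) (D' : set T') (e : T -> T')
    (f : T' -> R[i]) :
  set_bij D D' e -> csum D' f = csum D (f \o e).
Proof. by move=> De; rewrite /csum !(reindex_rsum _ De). Qed.

Section IteratedSums.
Context {T1 T2 : choiceType} (D : set T1) (J : T1 -> set T2) (f : T1 -> T2 -> R[i]).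
Hypothesis fs : abs_summable (D `*`` J) (fun k => f k.1 k.2).

Lemma abs_summable_section i : D i -> abs_summable (J i) (f i).
Proof.
move=> Di; apply/abs_summableE; move/abs_summableE : fs; apply: le_lt_trans.
apply: (esum_inj_le (e := fun j => (i, j)) (f := fun k => (cmod (f k.1 k.2))%:E)) => //.
- by move=> j j' _ _ [].
- by move=> k _; rewrite lee_fin cmod_ge0.
Qed.

Lemma esum_cmod_csum : (\esum_(i in D) (cmod (csum (J i) (f i)))%:E <=
  2%:E * \esum_(k in D `*`` J) (cmod (f k.1 k.2))%:E)%E.
Proof.
rewrite -(esum_esum (a := fun i j => (cmod (f i j))%:E)); last first.
  by move=> *; rewrite lee_fin cmod_ge0.
have fE i : D i -> (\esum_(j in J i) (cmod (f i j))%:E =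
    (fine (\esum_(j in J i) (cmod (f i j))%:E))%:E)%E.
  move=> Di; rewrite fineK// esum_fin//; first by move=> *; exact: cmod_ge0.
  by apply/abs_summableE; exact: abs_summable_section.
pose F i := fine (\esum_(j in J i) (cmod (f i j))%:E)%E.
rewrite [X in (_ * X)%E](eq_esum (b := fun i => (F i)%:E)); last exact: fE.
have F0 i : 0 <= F i by apply/fine_ge0/esum_ge0 => *; rewrite lee_fin cmod_ge0.
rewrite -esumZ_ge0//; apply: le_esum => i Di; rewrite lee_fin; apply: cmod_csum.
by rewrite fE.
Qed.

Lemma abs_summable_csum : abs_summable D (fun i => csum (J i) (f i)).
Proof.
apply/abs_summableE; apply: le_lt_trans esum_cmod_csum _.
by apply: lte_mul_pinfty => //; apply/abs_summableE.
Qed.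

Lemma csum_csum : csum D (fun i => csum (J i) (f i)) = csum (D `*`` J) (fun k => f k.1 k.2).
Proof.
rewrite /csum /=; congr (_ +i* _).
  rewrite (rsum_rsum (f := fun i j => complex.Re (f i j)))//.
  exact: (abs_summable_Re fs).
rewrite (rsum_rsum (f := fun i j => complex.Im (f i j)))//.
exact: (abs_summable_Im fs).
Qed.

End IteratedSums.

Section CountableComplexSums.
Context {T : countType}.
Implicit Types (D : set T) (f g : T -> R[i]).

Lemma csumD D f g : abs_summable D f -> abs_summable D g ->
  csum D (fun i => f i + g i) = csum D f + csum D g.
Proof.
move=> fs gs; apply: complex_eqP; rewrite ?cReD ?cImD /=.
  rewrite -rsumD; [|exact: abs_summable_Re..].
  by apply: eq_rsum => i _; rewrite cReD.
rewrite -rsumD; [|exact: abs_summable_Im..].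
by apply: eq_rsum => i _; rewrite cImD.
Qed.

Lemma csumZ D f (z : R[i]) : abs_summable D f ->
  csum D (fun i => z * f i) = z * csum D f.
Proof.
move=> fs; have re := abs_summable_Re fs; have im := abs_summable_Im fs.
apply: complex_eqP; rewrite ?cReM ?cImM /=.
  rewrite -!rsumZ// -rsumB; [|exact: summableZ..].
  by apply: eq_rsum => i _; rewrite cReM.
rewrite -!rsumZ// -rsumD; [|exact: summableZ..].
by apply: eq_rsum => i _; rewrite cImM.
Qed.

Lemma abs_summableZ D f (z : R[i]) : abs_summable D f ->
  abs_summable D (fun i => z * f i).
Proof.
move=> /abs_summableE fs; apply/abs_summableE.
rewrite (eq_esum (b := fun i => (cmod z * cmod (f i))%:E)); last first.
  by move=> i _; rewrite cmodM.
rewrite esumZ_ge0 ?cmod_ge0//; last by move=> *; exact: cmod_ge0.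
by apply: lte_mul_pinfty => //; rewrite lee_fin cmod_ge0.
Qed.

Lemma abs_summableD D f g : abs_summable D f -> abs_summable D g ->
  abs_summable D (fun i => f i + g i).
Proof.
move=> /abs_summableE fs /abs_summableE gs; apply/abs_summableE.
apply: le_lt_trans (lte_add_pinfty fs gs); rewrite -esumD;
  try by move=> *; rewrite lee_fin cmod_ge0.
by apply: le_esum => i _; rewrite -EFinD lee_fin ler_cmodD.
Qed.

Lemma csumB D f g : abs_summable D f -> abs_summable D g ->
  csum D (fun i => f i - g i) = csum D f - csum D g.
Proof.
move=> fs gs; rewrite -[in RHS]mulN1r -csumZ// -csumD//; last exact: abs_summableZ.
by apply: eq_csum => i _; rewrite mulN1r.
Qed.

Lemma csum_set1_supp D f x : D x -> (forall i, D i -> i != x -> f i = 0) ->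
  abs_summable D f /\ csum D f = f x.
Proof.
move=> Dx fx.
have [s _] := @rsum_set1_supp R T D (fun i => cmod (f i)) x Dx
   (fun i Di ix => etrans (congr1 (@cmod R) (fx i Di ix)) (@cmod0 R)).
split=> //; apply: complex_eqP => /=.
  by have [] := @rsum_set1_supp R T D (fun i => complex.Re (f i)) x Dx
   (fun i Di ix => congr1 (@complex.Re R) (fx i Di ix)).
by have [] := @rsum_set1_supp R T D (fun i => complex.Im (f i)) x Dx
   (fun i Di ix => congr1 (@complex.Im R) (fx i Di ix)).
Qed.

End CountableComplexSums.

End ComplexSums.

(** * Estimates for the resonant bilinear form *)

Section NonlinearEstimates.
Context {R : realType}.
Variable phi : 'rV[int]_3 -> bool -> 'rV[R[i]]_3.
Hypothesis phi_basis : helical_basis phi.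
Implicit Types (u v w : vfield R) (x : mode * (mode * mode)) (i c : mode).

Definition amp u i : R := cmod (component phi u i).

Lemma amp_ge0 u i : 0 <= amp u i.
Proof. exact: cmod_ge0. Qed.

Lemma sobolev_normsq0 u :
  (sobolev_normsq phi 0 u = \esum_(i in modes) (amp u i ^+ 2)%:E)%E.
Proof.
by apply: eq_esum => i _; rewrite mulr0 powRr0 mul1r.
Qed.

Lemma sobolev_normsq1 u :
  (sobolev_normsq phi 1 u = \esum_(i in modes) (klen i.1 ^+ 2 * amp u i ^+ 2)%:E)%E.
Proof.
by apply: eq_esum => i _; rewrite mulr1 powR_mulrn ?klen_ge0.
Qed.

Lemma sobolev_normsq_ge0 s u : (0 <= sobolev_normsq phi s u)%E.
Proof.
by apply: esum_ge0 => i _; rewrite lee_fin mulr_ge0 ?powR_ge0 ?sqr_ge0.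
Qed.

Lemma sobolev_normsq01 u : (sobolev_normsq phi 0 u <= sobolev_normsq phi 1 u)%E.
Proof.
rewrite sobolev_normsq0 sobolev_normsq1; apply: le_esum => i i0; rewrite lee_fin.
rewrite -[leLHS]mul1r ler_wpM2r ?sqr_ge0// exprn_ege1//.
exact: klen_ge1.
Qed.

Lemma sobolev_norm_ge0 s u : 0 <= sobolev_norm phi s u.
Proof. exact: sqrtr_ge0. Qed.

Lemma sobolev_normsqE s u : (sobolev_normsq phi s u < +oo)%E ->
  (sobolev_normsq phi s u = (sobolev_norm phi s u ^+ 2)%:E)%E.
Proof.
move=> uy; rewrite sqr_sqrtr ?fine_ge0 ?sobolev_normsq_ge0// fineK//.
by rewrite ge0_fin_numE// sobolev_normsq_ge0.
Qed.

Definition solenoidal u :=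
  (forall k, dotv (cvec k) (u k) = 0) /\ (forall k, u (- k) = conjv (u k)).

Lemma componentB u v i :
  component phi (fun k => u k - v k) i = component phi u i - component phi v i.
Proof. by rewrite /component dotvDl dotvNl. Qed.

Definition triad_term u v w x : R[i] :=
  Btilde_term phi u v x.1 x.2 * conjc (component phi w x.1).

Lemma cmod_Btilde_term u v c (p : mode * mode) : modes c -> modes p.1 -> modes p.2 ->
  cmod (Btilde_term phi u v c p) <= 6 * (klen p.2.1 * amp u p.1 * amp v p.2).
Proof.
move=> c0 p0 q0; rewrite /Btilde_term dotv_proj_perp// !cmodM cmodC normrM norm_sgnb.
rewrite mul1r ger0_norm ?klen_ge0// -/(amp u p.1) -/(amp v p.2).
rewrite mulrC ler_wpM2r ?mulr_ge0 ?klen_ge0 ?amp_ge0//.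
(* The entries of a cross product of unit vectors are at most 2 in modulus, and the scalar product
   has 3 terms. *)
have -> : 6 = 3 * (2 * 1 * 1) * 1 :> R by ring.
apply: cmod_dotv => j; last by rewrite conjvE cmodJ cmod_phi.
by apply: cmod_crossv => l; exact: cmod_phi.
Qed.

Lemma triads_modes x : triads (R := R) x -> [/\ modes x.1, modes x.2.1 & modes x.2.2].
Proof. by move=> [x1 [x2 x3 _ _]]. Qed.

Lemma cmod_triad_term u v w x : triads (R := R) x ->
  cmod (triad_term u v w x) <=
    6 * (klen x.2.2.1 * amp u x.2.1 * amp v x.2.2 * amp w x.1).
Proof.
move=> /triads_modes[x1 x2 x3]; rewrite /triad_term cmodM cmodJ -/(amp w x.1) mulrA.
by rewrite ler_wpM2r ?amp_ge0// cmod_Btilde_term.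
Qed.

Definition H1 u := (sobolev_normsq phi 1 u < +oo)%E.

Lemma H1_0 u : H1 u -> (sobolev_normsq phi 0 u < +oo)%E.
Proof. by apply: le_lt_trans; exact: sobolev_normsq01. Qed.

Let n0 := sobolev_norm phi 0.
Let n1 := sobolev_norm phi 1.

Lemma H1_amp0 u : H1 u ->
  (\esum_(i in modes) (amp u i ^+ 2)%:E <= (n0 u ^+ 2)%:E)%E.
Proof. by move=> uH; rewrite -sobolev_normsq0 -sobolev_normsqE// H1_0. Qed.

Lemma H1_amp1 u : H1 u ->
  (\esum_(i in modes) (klen i.1 ^+ 2 * amp u i ^+ 2)%:E <= (n1 u ^+ 2)%:E)%E.
Proof. by move=> uH; rewrite -sobolev_normsq1 -sobolev_normsqE. Qed.

Lemma amp_trilinear u v w : H1 u -> H1 v -> H1 w ->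
  (\esum_(x in triads (R := R)) (klen x.2.2.1 * amp u x.2.1 * amp v x.2.2 * amp w x.1)%:E
    <= (24 * n1 v * (n0 u * n1 w + n1 u * n0 w))%:E)%E.
Proof.
move=> uH vH wH.
by apply: (trilinear _ _ _ _ _ (H1_amp0 uH) (H1_amp1 uH) (H1_amp1 vH) (H1_amp0 wH)
  (H1_amp1 wH)); first [exact: sobolev_norm_ge0|exact: amp_ge0].
Qed.

Lemma triad_term_bound u v w : H1 u -> H1 v -> H1 w ->
  (\esum_(x in triads (R := R)) (cmod (triad_term u v w x))%:E
    <= (144 * n1 v * (n0 u * n1 w + n1 u * n0 w))%:E)%E.
Proof.
move=> uH vH wH.
apply: (@le_trans _ _ (\esum_(x in triads (R := R))
   (6 * (klen x.2.2.1 * amp u x.2.1 * amp v x.2.2 * amp w x.1))%:E)%E).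
  by apply: le_esum => x xt; rewrite lee_fin cmod_triad_term.
rewrite esumZ_ge0//; last by move=> x; rewrite !mulr_ge0 ?klen_ge0 ?amp_ge0.
rewrite [leRHS](_ : _ = (6 * (24 * n1 v * (n0 u * n1 w + n1 u * n0 w)))%:E); last first.
  by congr (_%:E); ring.
by rewrite [leRHS]EFinM lee_wpmul2l// amp_trilinear.
Qed.

Lemma abs_summable_triad_term u v w : H1 u -> H1 v -> H1 w ->
  abs_summable (triads (R := R)) (triad_term u v w).
Proof. by move=> uH vH wH; apply: abs_summable_le (triad_term_bound uH vH wH). Qed.

(** The trilinear estimate with the indicator of c as third factor, for which D0 = 1 and D1 = |c|.
    It controls a single mode of the nonlinearity, which makes the modal equations integrable in
    time. *)
Lemma abs_summable_Btilde_term u v c : H1 u -> H1 v -> modes c ->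
  abs_summable (resonant_pairs (R := R) c) (Btilde_term phi u v c) /\
  cmod (csum (resonant_pairs (R := R) c) (Btilde_term phi u v c))
    <= 288 * n1 v * (n0 u * klen c.1 + n1 u).
Proof.
move=> uH vH c0; pose d i : R := (i == c)%:R.
have d0 i : 0 <= d i by rewrite /d ler0n.
have dsupp (f : mode -> R) : (forall i, 0 <= f i) ->
    (\esum_(i in modes) (f i * d i ^+ 2)%:E = (f c)%:E)%E.
  move=> f0; rewrite (esumID [set c]) => [|i _]; last by rewrite lee_fin mulr_ge0 ?sqr_ge0.
  rewrite [X in (_ + X)%E]esum1 ?adde0; last first.
    by move=> i [_ /eqP /negPf ic]; rewrite /d ic expr0n mulr0.
  rewrite setIC setIidl; last by move=> i ->.
  by rewrite esum_set1 /d ?eqxx ?expr1n ?mulr1// lee_fin.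
have dD0 : (\esum_(i in modes) (d i ^+ 2)%:E <= (1 ^+ 2)%:E)%E.
  rewrite (eq_esum (b := fun i => (1 * d i ^+ 2)%:E)) => [|i _]; last by rewrite mul1r.
  by rewrite (dsupp (fun=> 1))// expr1n.
have dD1 : (\esum_(i in modes) (klen i.1 ^+ 2 * d i ^+ 2)%:E <= (klen c.1 ^+ 2)%:E)%E.
  by rewrite (dsupp (fun i => klen i.1 ^+ 2))// => i; rewrite sqr_ge0.
have B : (\esum_(p in resonant_pairs (R := R) c) (cmod (Btilde_term phi u v c p))%:E
    <= (144 * n1 v * (n0 u * klen c.1 + n1 u))%:E)%E.
  pose g x := klen x.2.2.1 * amp u x.2.1 * amp v x.2.2 * d x.1.
  have g0 x : 0 <= g x by rewrite /g !mulr_ge0 ?klen_ge0 ?amp_ge0.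
  apply: (@le_trans _ _ (\esum_(p in resonant_pairs (R := R) c) (6 * g (c, p))%:E)%E).
    apply: le_esum => p [p0 q0 _ _]; rewrite lee_fin /g /d eqxx mulr1.
    exact: cmod_Btilde_term.
  rewrite esumZ_ge0//.
  rewrite [leRHS](_ : _ = (6 * (24 * n1 v * (n0 u * klen c.1 + n1 u * 1)))%:E); last first.
    by congr (_%:E); ring.
  rewrite [leRHS]EFinM lee_wpmul2l//.
  apply: le_trans (trilinear (a := amp u) (b := amp v) _ _ _ _ _ (H1_amp0 uH)
     (H1_amp1 uH) (H1_amp1 vH) dD0 dD1 _ _ _);
    rewrite ?sobolev_norm_ge0 ?klen_ge0//; try by move=> ?; exact: amp_ge0.
  apply: (esum_inj_le (e := fun p => (c, p)) (f := fun x => (g x)%:E)) => //.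
    by move=> p p' _ _ [].
  by move=> x _; rewrite lee_fin.
split; first exact: abs_summable_le B.
apply: le_trans (cmod_csum B) _.
by rewrite le_eqVlt; apply/orP; left; apply/eqP; ring.
Qed.

Lemma Btilde_conjE u v w c : H1 u -> H1 v -> modes c ->
  Btilde phi u v c * conjc (component phi w c) =
  csum (resonant_pairs (R := R) c)
    (fun p => - (2 * pi)%:C * triad_term u v w (c, p)).
Proof.
move=> uH vH c0; have [Bs _] := abs_summable_Btilde_term uH vH c0.
rewrite (eq_csum (g := fun p =>
  (- (2 * pi)%:C * conjc (component phi w c)) * Btilde_term phi u v c p)); last first.
  by move=> p _; rewrite /triad_term /=; ring.
by rewrite csumZ// /Btilde; ring.
Qed.

Lemma Btilde_pairing_csum u v w : H1 u -> H1 v -> H1 w ->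
  Btilde_pairing_converges phi u v w /\
  pairing (Btilde phi u v) (component phi w) =
    - (2 * pi)%:C * csum (triads (R := R)) (triad_term u v w).
Proof.
move=> uH vH wH; have ts := abs_summable_triad_term uH vH wH.
have ts' := abs_summableZ (- (2 * pi)%:C) ts.
have E c : modes c -> csum (resonant_pairs (R := R) c)
    (fun p => - (2 * pi)%:C * triad_term u v w (c, p)) =
    Btilde phi u v c * conjc (component phi w c).
  by move=> c0; rewrite Btilde_conjE.
split; first split.
- by move=> c c0; have [] := abs_summable_Btilde_term uH vH c0.
- apply: eq_abs_summable E _.
  by apply: (abs_summable_csum (f := fun c p => - (2 * pi)%:C * triad_term u v w (c, p)));
   apply: eq_abs_summable ts' => -[].
- rewrite /pairing -(eq_csum E).
  rewrite (csum_csum (f := fun c p => - (2 * pi)%:C * triad_term u v w (c, p))).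
    by rewrite -csumZ//; apply: eq_csum => -[].
  by apply: eq_abs_summable ts' => -[].
Qed.

(** The modulus stands inside the sum over output modes. A bound on the pairing alone would not
    dominate the partial sums of the modal energies. *)
Lemma Btilde_abs_estimate u v w : H1 u -> H1 v -> H1 w ->
  (\esum_(c in modes) (cmod (Btilde phi u v c * conjc (component phi w c)))%:E
    <= (576 * pi * n1 v * (n0 u * n1 w + n1 u * n0 w))%:E)%E.
Proof.
move=> uH vH wH; have ts := abs_summable_triad_term uH vH wH.
pose f c p := - (2 * pi)%:C * triad_term u v w (c, p).
have fs : abs_summable (modes `*`` (fun c => resonant_pairs (R := R) c)) (fun k => f k.1 k.2).
  by apply: eq_abs_summable (abs_summableZ (- (2 * pi)%:C) ts) => -[].
rewrite (eq_esum (b := fun c => (cmod (csum (resonant_pairs (R := R) c) (f c)))%:E)); last first.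
  by move=> c c0; rewrite Btilde_conjE.
apply: le_trans (esum_cmod_csum fs) _.
rewrite (eq_esum (b := fun x => (2 * pi * cmod (triad_term u v w x))%:E)); last first.
  by move=> -[c p] _; rewrite /f cmodM cmodN cmodC ger0_norm// mulr_ge0 ?pi_ge0.
rewrite esumZ_ge0; last 2 first.
- by rewrite mulr_ge0 ?pi_ge0.
- by move=> x; exact: cmod_ge0.
have h := triad_term_bound uH vH wH.
rewrite muleA -EFinM.
rewrite [leRHS](_ : _ = ((2 * (2 * pi)) * (144 * n1 v * (n0 u * n1 w + n1 u * n0 w)))%:E).
  by rewrite [leRHS]EFinM lee_wpmul2l// lee_fin !mulr_ge0 ?pi_ge0.
by congr (_%:E); ring.
Qed.

Theorem Btilde_estimate u v w : H1 u -> H1 v -> H1 w ->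
  cmod (pairing (Btilde phi u v) (component phi w))
    <= 576 * pi * n1 v * (n0 u * n1 w + n1 u * n0 w).
Proof.
move=> uH vH wH; have [_ ->] := Btilde_pairing_csum uH vH wH.
rewrite cmodM cmodN cmodC ger0_norm ?mulr_ge0 ?pi_ge0//.
have := cmod_csum (triad_term_bound uH vH wH) => h.
rewrite [leRHS](_ : _ = 2 * pi * (2 * (144 * n1 v * (n0 u * n1 w + n1 u * n0 w)))); last ring.
by rewrite ler_wpM2l// mulr_ge0// pi_ge0.
Qed.

(* The involution exchanging the roles of m and -n in a resonant triad
   k + m = n. *)
Definition triad_flip x : mode * (mode * mode) := (negm x.2.2, (x.2.1, negm x.1)).

Lemma triad_flip_bij : set_bij (triads (R := R)) (triads (R := R)) triad_flip.
Proof.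
have inv x : triad_flip (triad_flip x) = x.
  by case: x => c [p q]; rewrite /triad_flip /= !negmK.
have st x : triads (R := R) x -> triads (R := R) (triad_flip x).
  case: x => c [p q] [/= c0 [/= p0 q0 pq res]].
  split; first exact/modes_negm.
  split=> //=; first exact/modes_negm.
    by rewrite -pq opprD addrA subrr add0r.
  by move: res; rewrite !freq_negm; lra.
split=> //.
- by move=> x y _ _ /(congr1 triad_flip); rewrite !inv.
- by move=> x xt; exists (triad_flip x); [exact: st|rewrite inv].
Qed.

(** With f, a, b the helical parts of v at k, of w at m and of w at -n, the two terms are sigma_2
    |m| and -sigma |n| times the same triple product (f x a).b. By [triple_eigen] their sum is -i
    times f.a k.b + f.b k.a, where only |k| occurs; each product costs 3 * 3, hence 18. *)
Lemma triad_term_flip v w x : solenoidal w -> triads (R := R) x ->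
  cmod (triad_term v w w x + triad_term v w w (triad_flip x)) <=
    18 * (klen x.2.1.1 * amp v x.2.1 * amp w x.2.2 * amp w x.1).
Proof.
case: x => c [p q] [wd wr] [/= c0 [/= p0 q0 pq res]].
have nc0 : modes (negm c) by exact/modes_negm.
have nq0 : modes (negm q) by exact/modes_negm.
pose f := hproj phi v p; pose a := hproj phi w q; pose b := hproj phi w (negm c).
have bE : b = conjv (hproj phi w c) by rewrite /b hproj_negm.
have aE : hproj phi w (negm q) = conjv a by rewrite hproj_negm.
have tE : triad_term v w w (c, (p, q)) =
    (sgnb q.2 * klen q.1)%:C * dotv (crossv f a) b.
  rewrite /triad_term /Btilde_term /= dotv_proj_perp// bE /f /a /hproj.
  by rewrite conjvZ crossvZl crossvZr !dotvZl dotvZr; ring.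
have tfE : triad_term v w w (triad_flip (c, (p, q))) =
    (sgnb c.2 * klen c.1)%:C * dotv (crossv f b) a.
  rewrite -[a in RHS]conjvK -aE.
  rewrite /triad_term /Btilde_term /= dotv_proj_perp// klenN /f /b /hproj /=.
  by rewrite conjvZ crossvZl crossvZr !dotvZl dotvZr; ring.
rewrite tE tfE (dotv_crossC f b) mulrN -mulrBl.
have kmn : p.1 + q.1 + (negm c).1 = 0 by rewrite pq subrr.
rewrite (triple_eigen (x := (sgnb q.2 * klen q.1)%:C) (y := (sgnb c.2 * klen c.1)%:C) kmn); last 5 first.
- by rewrite /f; case: (p) p0 => k s k0; exact: hproj_perp.
- by rewrite /a; case: (q) q0 => k s k0; exact: hproj_perp.
- by rewrite /b; case: (negm c) nc0 => k s k0; exact: hproj_perp.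
- by rewrite /a; case: (q) q0 => k s k0; exact: hproj_eigen.
- rewrite /b -(klenN c.1) /negm; apply: hproj_eigen => //.
have ap j : cmod (f 0 j) <= amp v p by exact: cmod_hproj.
have aq j : cmod (a 0 j) <= amp w q by exact: cmod_hproj.
have ac j : cmod (b 0 j) <= amp w c.
  by rewrite bE conjvE cmodJ; exact: cmod_hproj.
have kp j : cmod ((cvec p.1 : 'rV[R[i]]_3) 0 j) <= klen p.1.
  by rewrite mxE intr_complex cmodC; exact: ler_norm_klen.
rewrite cmodM cmodN cmod_i mul1r.
apply: le_trans (ler_cmodD _ _) _; rewrite !cmodM.
have h1 : cmod (dotv f a) * cmod (dotv (cvec p.1) b) <=
   (3 * amp v p * amp w q) * (3 * klen p.1 * amp w c).
  by rewrite ler_pM ?cmod_ge0//; apply: cmod_dotv.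
have h2 : cmod (dotv f b) * cmod (dotv (cvec p.1) a) <=
   (3 * amp v p * amp w c) * (3 * klen p.1 * amp w q).
  by rewrite ler_pM ?cmod_ge0//; apply: cmod_dotv.
apply: le_trans (lerD h1 h2) _.
by rewrite le_eqVlt; apply/orP; left; apply/eqP; ring.
Qed.

(** Exchanging k and m moves the weight |k| left by the symmetrization to the middle factor, where
    [amp_trilinear] expects it. *)
Lemma triads_swap_bij :
  set_bij (triads (R := R)) (triads (R := R)) (fun x => (x.1, (x.2.2, x.2.1))).
Proof.
have st x : triads (R := R) x -> triads (R := R) (x.1, (x.2.2, x.2.1)).
  case: x => c [p q] [/= c0 [/= p0 q0 pq res]].
  by split=> //; split=> //=; [rewrite addrC|lra].
split=> //.
- by move=> [c [p q]] [c' [p' q']] _ _ /= [-> -> ->].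
- by move=> [c [p q]] xt; exists (c, (q, p)) => //; exact: (st _ xt).
Qed.

Lemma csum_triad_term_flip v w : H1 v -> H1 w -> solenoidal w ->
  cmod (csum (triads (R := R)) (triad_term v w w)) <= 864 * n1 v * n0 w * n1 w.
Proof.
move=> vH wH ws; have ts := abs_summable_triad_term vH wH wH.
have tfs : abs_summable (triads (R := R)) (fun x => triad_term v w w (triad_flip x)).
  move/abs_summableE : ts => ts; apply/abs_summableE.
  by rewrite -(reindex_esum _ _ _ (fun x => (cmod (triad_term v w w x))%:E) triad_flip_bij).
(* The flip permutes the triads, so the symmetrized terms add up to twice the sum; this 2 will
   cancel the one lost in [cmod_csum]. *)
have twice : 2 * csum (triads (R := R)) (triad_term v w w) =
   csum (triads (R := R)) (fun x => triad_term v w w x + triad_term v w w (triad_flip x)).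
  rewrite csumD//.
  by rewrite -[X in _ = _ + X](reindex_csum (triad_term v w w) triad_flip_bij) mulr2n mulrDl mul1r.
have bd : (\esum_(x in triads (R := R))
   (cmod (triad_term v w w x + triad_term v w w (triad_flip x)))%:E
   <= (864 * n1 v * n0 w * n1 w)%:E)%E.
  pose g x := klen x.2.2.1 * amp w x.2.1 * amp v x.2.2 * amp w x.1.
  have g0 x : 0 <= g x by rewrite /g !mulr_ge0 ?klen_ge0 ?amp_ge0.
  apply: (@le_trans _ _ (\esum_(x in triads (R := R)) (18 * g (x.1, (x.2.2, x.2.1)))%:E)%E).
    apply: le_esum => x xt; rewrite lee_fin.
    apply: le_trans (triad_term_flip _ ws xt) _.
    by rewrite le_eqVlt; apply/orP; left; apply/eqP; rewrite /g /=; ring.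
  rewrite esumZ_ge0// -(reindex_esum _ _ _ (fun x => (g x)%:E) triads_swap_bij).
  (* 864 = 18 * 24 * 2, the two terms of the trilinear bound being equal here. *)
  rewrite [leRHS](_ : _ = (18 * (24 * n1 v * (n0 w * n1 w + n1 w * n0 w)))%:E); last first.
    by congr (_%:E); ring.
  by rewrite [leRHS]EFinM lee_wpmul2l// amp_trilinear.
have := cmod_csum bd; rewrite -twice cmodM.
rewrite (_ : 2 = 2%:C :> R[i]); last by rewrite rmorph_nat.
by rewrite cmodC ger0_norm// ler_pM2l.
Qed.

Lemma sobolev_normsqB s u v : (sobolev_normsq phi s u < +oo)%E ->
  (sobolev_normsq phi s v < +oo)%E ->
  (sobolev_normsq phi s (fun k => u k - v k)%R <=
    2%:E * (sobolev_normsq phi s u + sobolev_normsq phi s v))%E.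
Proof.
move=> uy vy; rewrite -esumD; try by move=> *; rewrite lee_fin mulr_ge0 ?powR_ge0 ?sqr_ge0.
rewrite -esumZl//; last first.
  by move=> i _; apply: adde_ge0; rewrite lee_fin mulr_ge0 ?powR_ge0 ?sqr_ge0.
apply: le_esum => i _; rewrite -EFinD -EFinM lee_fin -mulrDr [leRHS]mulrCA.
rewrite ler_wpM2l ?powR_ge0// componentB.
have := ler_cmodB (component phi u i) (component phi v i).
have := cmod_ge0 (component phi u i - component phi v i).
have := cmod_ge0 (component phi u i); have := cmod_ge0 (component phi v i).
move: (cmod _) (cmod _) (cmod _) => x y z x0 y0 z0 h.
apply: (@le_trans _ _ ((y + z) ^+ 2)); first by rewrite lerXn2r ?nnegrE ?addr_ge0.
have := sqr_ge0 (y - z); nra.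
Qed.

Lemma H1B u v : H1 u -> H1 v -> H1 (fun k => u k - v k).
Proof.
move=> uH vH; apply: le_lt_trans (sobolev_normsqB uH vH) _.
by apply: lte_mul_pinfty => //; exact: lte_add_pinfty.
Qed.

Lemma solenoidalB u v : solenoidal u -> solenoidal v -> solenoidal (fun k => u k - v k).
Proof.
move=> [ud ur] [vd vr]; split=> k.
  by rewrite dotvDr ud add0r -scaleN1r dotvZr vd mulr0.
by rewrite ur vr -scaleN1r -[in RHS]scaleN1r conjvD conjvZ rmorphN rmorph1.
Qed.

(* B(u,u) - B(v,v) = B(w,u) + B(v,w) with w = u - v. *)
Lemma Btilde_difference u v : H1 u -> H1 v -> solenoidal u -> solenoidal v ->
  let w : vfield R := fun k => u k - v k in
  abs_summable modes
    (fun c => (Btilde phi u u c - Btilde phi v v c) * conjc (component phi w c)) /\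
  cmod (csum modes
    (fun c => (Btilde phi u u c - Btilde phi v v c) * conjc (component phi w c)))
   <= 1728 * pi * (n1 u + n1 v) * n0 w * n1 w.
Proof.
move=> uH vH us vs w; have wH : H1 w by exact: H1B.
have ws : solenoidal w by exact: solenoidalB.
have [[_ suu] euu] := Btilde_pairing_csum uH uH wH.
have [[_ svv] evv] := Btilde_pairing_csum vH vH wH.
have [[_ swu] ewu] := Btilde_pairing_csum wH uH wH.
have [[_ svw] evw] := Btilde_pairing_csum vH wH wH.
split.
  apply: eq_abs_summable (abs_summableD suu (abs_summableZ (-1) svv)) => c _.
  by rewrite mulN1r mulrBl.
rewrite (eq_csum (g := fun c => Btilde phi u u c * conjc (component phi w c) -
   Btilde phi v v c * conjc (component phi w c))); last by move=> c _; rewrite mulrBl.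
move: euu evv; rewrite /pairing => euu evv.
rewrite (csumB suu svv) euu evv -mulrBr -csumB; last 2 first.
- exact: abs_summable_triad_term.
- exact: abs_summable_triad_term.
rewrite (eq_csum (g := fun x => triad_term w u w x + triad_term v w w x)); last first.
  by move=> x _; rewrite /triad_term /Btilde_term !componentB; ring.
rewrite csumD; [|exact: abs_summable_triad_term..].
rewrite mulrDr -ewu; apply: le_trans (ler_cmodD _ _) _.
have h1 := Btilde_estimate wH uH wH.
have h2 := csum_triad_term_flip vH wH ws.
rewrite (cmodM (- _)) cmodN cmodC ger0_norm ?mulr_ge0 ?pi_ge0//.
have h2' : 2 * pi * cmod (csum (triads (R := R)) (triad_term v w w)) <=
   2 * pi * (864 * n1 v * n0 w * n1 w) by rewrite ler_wpM2l// mulr_ge0// pi_ge0.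
apply: le_trans (lerD h1 h2') _.
(* The two pairings give 1152 pi |u|_1 and 1728 pi |v|_1; the larger constant serves for both, and
   the difference is the surplus in |u|_1. *)
rewrite -subr_ge0.
rewrite (_ : _ - _ = 576 * pi * n1 u * n0 w * n1 w); last ring.
have hu : 0 <= n1 u := sobolev_norm_ge0 1 u.
have hw0 : 0 <= n0 w := sobolev_norm_ge0 0 w.
have hw1 : 0 <= n1 w := sobolev_norm_ge0 1 w.
have pi0 := pi_ge0 R.
clear -hu hw0 hw1 pi0; move: (n1 u) (n0 w) (n1 w) (pi : R) hu hw0 hw1 pi0 => x y z t *.
by rewrite -!mulrA; apply: mulr_ge0; [exact: ler0n|rewrite !mulr_ge0].
Qed.

End NonlinearEstimates.

(** * Time integrals *)

Section RealIntegrable.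
Context {d : measure_display} {T : measurableType d} {R : realType}.
Variable mu : {measure set T -> \bar R}.

Lemma RintegrableD (D : set T) (f g : T -> R) : measurable D ->
  mu.-integrable D (EFin \o f) -> mu.-integrable D (EFin \o g) ->
  mu.-integrable D (EFin \o (fun s => f s + g s)).
Proof. by move=> mD fi gi; have := integrableD mD fi gi. Qed.

Lemma RintegrableZ (D : set T) (f : T -> R) (c : R) : measurable D ->
  mu.-integrable D (EFin \o f) -> mu.-integrable D (EFin \o (fun s => c * f s)).
Proof. by move=> mD fi; have := integrableZl mD c fi. Qed.

Lemma RintegrableB (D : set T) (f g : T -> R) : measurable D ->
  mu.-integrable D (EFin \o f) -> mu.-integrable D (EFin \o g) ->
  mu.-integrable D (EFin \o (fun s => f s - g s)).
Proof. by move=> mD fi gi; have := integrableB mD fi gi. Qed.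

End RealIntegrable.

Section RealIntegrals.
Context {R : realType}.
Notation mu := (@lebesgue_measure R).
Implicit Types (f h y : R -> R) (t : R).

Lemma integrable_subitv (a b t T : R) f : a <= b -> b <= t -> t <= T ->
  mu.-integrable `[a, T] (EFin \o f) -> mu.-integrable `[b, t] (EFin \o f).
Proof.
move=> ab bt tT; apply: integrableS => //.
by apply: subset_itv; rewrite bnd_simp.
Qed.

Lemma integral_tail (t s : R) f : 0 <= s -> s <= t ->
  mu.-integrable `[0, t] (EFin \o f) ->
  \int[mu]_(x in `[s, t]) f x = \int[mu]_(x in `[0, t]) f x - \int[mu]_(x in `[0, s]) f x.
Proof.
move=> s0 st fi; rewrite Rintegral_itvB ?bnd_simp//.
rewrite Rintegral_itv_obnd_cbnd//.
apply: integrableS fi => //; apply: subset_itv; rewrite bnd_simp//.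
Qed.

(* Fubini on the triangle y <= x of the square [0,t]^2. *)
Lemma sqr_integral t f : 0 <= t -> mu.-integrable `[0, t] (EFin \o f) ->
  let X s := \int[mu]_(r in `[0, s]) f r in
  mu.-integrable `[0, t] (EFin \o (fun s => f s * X s)) /\
  X t ^+ 2 = 2 * \int[mu]_(s in `[0, t]) (f s * X s).
Proof.
move=> t0 fi X; pose D : set (measurableTypeR R) := `[0, t]%classic; pose g := f \_ D.
have mD : measurable D by exact: measurable_itv.
have gi : mu.-integrable setT (EFin \o g).
  by rewrite -restrict_EFin; apply/(integrable_mkcond _ mD).
have mg : measurable_fun setT g by apply/measurable_EFinP; exact: measurable_int gi.
(* [K] integrates in y to f(x) X(x), and in x to f(y) (X(t) - X(y)). Equality of the iterated
   integrals says that the integral of f X is X(t)^2 minus itself. Extending [f] by zero to [g] lets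
   both integrals run over the whole line. *)
pose K (z : measurableTypeR R * measurableTypeR R) : \bar R := if z.2 <= z.1 then (g z.1 * g z.2)%:E else 0%E.
have mK : measurable_fun setT K.
  apply: measurable_fun_ifT => //.
    by apply: measurable_fun_ler; [exact: measurable_snd|exact: measurable_fst].
  apply/measurable_EFinP; apply: measurable_funM.
    by apply: measurableT_comp => //; exact: measurable_fst.
  by apply: measurableT_comp => //; exact: measurable_snd.
have fi' s r : 0 <= s -> s <= r -> r <= t -> mu.-integrable `[s, r] (EFin \o f).
  by move=> s0 sr rt; apply: integrable_subitv fi.
have gE x : x \notin `[0, t] -> g x = 0.
  by move=> xD; rewrite /g patchE ifF//; apply/negbTE; rewrite mem_setE.
have gE' x : x \in `[0, t] -> g x = f x.
  by move=> xD; rewrite /g patchE ifT//; rewrite mem_setE.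
have FK (x : R) : (\int[mu]_y K (x, y) = (g x * X x)%:E)%E.
  have [xD|xD] := boolP (x \in `[0, t]); last first.
    rewrite gE// mul0r; apply: integral0_eq => y _; rewrite /K /=.
    by rewrite gE// mul0r if_same.
  rewrite (_ : (fun y : R => K (x, y)) =
     ((fun y : R => ((g x)%:E * (f y)%:E)%E) \_ (`[0, x]%classic : set R))); last first.
    apply/funext => y; rewrite patchE mem_setE /K /= in_itv /=.
    have [yx|yx] := leP y x; rewrite ?andbF// andbT.
    have [y0|y0] := leP 0 y; last by rewrite (gE y) ?mulr0// in_itv /= leNgt y0.
    by rewrite (gE' y)// in_itv /= y0 (le_trans yx)//; move: xD; rewrite in_itv /= => /andP[].
  move: xD; rewrite in_itv /= => /andP[x0 xt].
  rewrite -integral_mkcond integralZl//; last by have := fi' 0 x (lexx _) x0 xt.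
  rewrite EFinM /X /Rintegral fineK//; apply: integrable_fin_num => //.
  by have := fi' 0 x (lexx _) x0 xt.
have GK (y : R) : (\int[mu]_x K (x, y) = (g y * (X t - X y))%:E)%E.
  have [yD|yD] := boolP (y \in `[0, t]); last first.
    rewrite (gE y)// mul0r; apply: integral0_eq => x _; rewrite /K /=.
    by rewrite (gE y)// mulr0 if_same.
  rewrite (_ : (fun x : R => K (x, y)) =
     ((fun x : R => ((g y)%:E * (f x)%:E)%E) \_ (`[y, t]%classic : set R))); last first.
    apply/funext => x; rewrite patchE mem_setE /K /= in_itv /=.
    have [yx|yx] := leP y x => //=.
    have [xt|xt] := leP x t; last first.
      by rewrite (gE x) ?mul0r// in_itv /= (lt_geF xt) andbF.
    rewrite (gE' x) ?EFinM 1?muleC// in_itv /= xt andbT (le_trans _ yx)//.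
    by move: yD; rewrite in_itv /= => /andP[].
  move: yD; rewrite in_itv /= => /andP[y0 yt].
  rewrite -integral_mkcond integralZl//; last by have := fi' y t y0 yt (lexx _).
  rewrite -(integral_tail y0 yt fi) EFinM /Rintegral fineK//.
  by apply: integrable_fin_num => //; have := fi' y t y0 yt (lexx _).
(* |K(x,y)| is at most |g(x)| |g(y)|, whose double integral is the square of the L^1 norm of [g]. *)
have iK : (mu \x mu)%E.-integrable setT K.
  have [_] := integrable12ltyP mu mu mK; apply.
  pose n := (\int[mu]_y `|(g y)%:E|)%E.
  have nfin : (n < +oo)%E by have /integrableP[_] := gi.
  have n0 : (0 <= n)%E by apply: integral_ge0.
  have mag : measurable_fun setT (fun x => `|(g x)%:E|)%E.
    by apply: measurableT_comp => //; exact: measurable_int gi.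
  apply: (@le_lt_trans _ _ (\int[mu]_x (n * `|(g x)%:E|))%E).
    apply: ge0_le_integral => //.
    - by move=> x _; apply: integral_ge0.
    - apply: (measurable_fun_fubini_tonelli_F (abse \o K)).
        by apply: measurableT_comp.
      by move=> z; exact: abse_ge0.
    - exact: measurable_funeM.
    - move=> x _; rewrite muleC -ge0_integralZl//.
      apply: ge0_le_integral => //.
      + by apply: measurableT_comp => //; exact: measurableT_comp mK (measurable_pair1 _).
      + exact: measurable_funeM.
      + move=> y _; rewrite /K; case: ifP => _; first by rewrite EFinM abseM.
        by rewrite abse0 mule_ge0.
  by rewrite ge0_integralZl//; apply: lte_mul_pinfty => //; rewrite ge0_fin_numE.
have iF := integrable_fubini_F iK.
have e : (\int[mu]_x (g x * X x)%:E = \int[mu]_y (g y * (X t - X y))%:E)%E.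
  transitivity (\int[mu]_x \int[mu]_y K (x, y))%E.
    by apply: eq_integral => x _; rewrite FK.
  by rewrite (Fubini iK); apply: eq_integral => y _; exact: GK.
have iFX : mu.-integrable `[0, t] (EFin \o (fun s => f s * X s)).
  apply/(integrable_mkcond _ mD).
  rewrite (_ : _ \_ _ = (fun x => \int[mu]_y K (x, y))%E)//.
  by apply/funext => x; rewrite FK patchE /g patchE; case: ifP => //; rewrite mul0r.
split=> //.
have h : \int[mu]_(s in `[0, t]) (f s * X s) = \int[mu]_(s in `[0, t]) (f s * (X t - X s)).
  rewrite Rintegral_mkcond [RHS]Rintegral_mkcond /Rintegral; congr fine.
  transitivity (\int[mu]_x (g x * X x)%:E)%E.
    by apply: eq_integral => x _; rewrite /g !patchE; case: ifP => //; rewrite mul0r.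
  rewrite e; apply: eq_integral => x _.
  by rewrite /g !patchE; case: ifP => //; rewrite mul0r.
have iX : mu.-integrable `[0, t] (EFin \o (fun s => f s * X t)).
  by have := integrableZr mD (X t) fi.
have h' : \int[mu]_(s in `[0, t]) (f s * (X t - X s)) =
    X t * X t - \int[mu]_(s in `[0, t]) (f s * X s).
  transitivity (\int[mu]_(s in `[0, t]) (f s * X t - f s * X s)).
    by apply: eq_Rintegral => s _; rewrite mulrBr.
  by rewrite RintegralB// RintegralZr.
by rewrite expr2 mulr2n mulrDl mul1r [X in X + _]h h' subrK.
Qed.

(** As [y] is not assumed continuous, no integrating factor is used. On an interval where the
    integral [H] of [h] grows by at most 1/2, and before which [y] vanishes, inserting a bound y <=
    B into the inequality returns y <= B/2; iteration from [M] forces y = 0. Finitely many such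
    intervals cover [0, T]. *)
Lemma gronwall_zero (T M : R) h y : 0 <= T -> mu.-integrable `[0, T] (EFin \o h) ->
  mu.-integrable `[0, T] (EFin \o (fun s => h s * y s)) ->
  (forall s, 0 <= s <= T -> 0 <= h s) -> (forall s, 0 <= s <= T -> 0 <= y s <= M) ->
  (forall t, 0 <= t <= T -> y t <= \int[mu]_(s in `[0, t]) (h s * y s)) ->
  forall t, 0 <= t <= T -> y t = 0.
Proof.
move=> T0 hi hyi h0 yM yI.
pose H t := \int[mu]_(s in `[0, t]) h s.
have hi' a b : 0 <= a -> a <= b -> b <= T -> mu.-integrable `[a, b] (EFin \o h).
  by move=> a0 ab bT; apply: integrable_subitv hi.
have hyi' a b : 0 <= a -> a <= b -> b <= T ->
    mu.-integrable `[a, b] (EFin \o (fun s => h s * y s)).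
  by move=> a0 ab bT; apply: integrable_subitv hyi.
have Hmono a b : 0 <= a -> a <= b -> b <= T -> H a <= H b.
  move=> a0 ab bT; rewrite -subr_ge0 -(integral_tail a0 ab); last first.
    by apply: hi' => //; exact: le_trans ab.
  apply: Rintegral_ge0 => s /=; rewrite in_itv /= => /andP[as_ sb]; apply: h0.
  by rewrite (le_trans a0 as_) (le_trans sb bT).
have step (a b : R) : 0 <= a -> a <= b -> b <= T ->
    (forall s, 0 <= s <= a -> y s = 0) -> H b - H a <= 2^-1 ->
    forall s, 0 <= s <= b -> y s = 0.
  move=> a0 ab bT ya Hab.
  have M0 : 0 <= M by have /andP[/le_trans/(_ _)] := yM 0 (introT andP (conj (lexx 0) T0)); apply.
  have yn n s : 0 <= s <= b -> y s <= M / 2 ^+ n.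
    elim: n s => [|n IH] s /andP[s0 sb].
      by rewrite expr0 divr1; case/andP: (yM s (introT andP (conj s0 (le_trans sb bT)))).
    have [sa|as_] := leP s a; first by rewrite ya ?s0// divr_ge0// exprn_ge0.
    have sT := le_trans sb bT; have as' := ltW as_.
    apply: le_trans (yI s _) _; first by rewrite s0.
    have <- : \int[mu]_(r in `[a, s]) (h r * y r) = \int[mu]_(r in `[0, s]) (h r * y r).
      rewrite (integral_tail a0 as'); last exact: hyi'.
      rewrite [X in _ - X](_ : _ = 0) ?subr0//.
      rewrite (eq_Rintegral _ (g := fun=> 0)) ?Rintegral_cst ?mul0r// => r.
      by rewrite mem_setE in_itv /= => ra; rewrite ya ?mulr0.
    apply: (@le_trans _ _ (\int[mu]_(r in `[a, s]) (h r * (M / 2 ^+ n)))).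
      apply: le_Rintegral => //; first exact: hyi'.
        rewrite (_ : EFin \o _ = (fun s => (M / 2 ^+ n)%:E * (h s)%:E)%E).
          by apply: integrableZl => //; exact: hi'.
        by apply/funext => r /=; rewrite -EFinM mulrC.
      move=> r /=; rewrite in_itv /= => /andP[ar rs].
      have r0 := le_trans a0 ar; have rb := le_trans rs sb.
      by rewrite ler_wpM2l ?IH ?h0 ?r0 ?rb// (le_trans rb bT).
    rewrite RintegralZr//; last exact: hi'.
    have c0 : 0 <= M / 2 ^+ n by rewrite divr_ge0 ?exprn_ge0.
    rewrite (_ : M / 2 ^+ n.+1 = 2^-1 * (M / 2 ^+ n)); last first.
      by rewrite exprS invfM mulrCA.
    apply: ler_wpM2r => //; rewrite (integral_tail a0 as'); last exact: hi'.
    by apply: le_trans Hab; rewrite lerB// Hmono.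
  move=> s sb; apply/eqP; rewrite eq_le; apply/andP; split; last first.
    by case/andP: sb => s0 sb; case/andP: (yM s (introT andP (conj s0 (le_trans sb bT)))).
  have lim0 : (fun n => M / 2 ^+ n) @ \oo --> (0 : R).
    rewrite -[X in _ --> X](mulr0 M); apply: cvgMr.
    rewrite (_ : (fun n => (2 ^+ n)^-1) = (fun n => (2^-1) ^+ n)); last first.
      by apply/funext => n; rewrite exprVn.
    have h2 : 0 <= 2^-1 :> R by rewrite invr_ge0.
    by apply: cvg_expr; rewrite ger0_norm//; lra.
  have <- := cvg_lim (@Rhausdorff R) lim0.
  by apply: limr_ge; [apply/cvg_ex; exists 0|apply: nearW => n; exact: yn].
have H0 : H 0 = 0 by rewrite /H set_itv1 Rintegral_set1.
have main n : forall t, 0 <= t <= T -> H t <= n%:R / 2 -> forall s, 0 <= s <= t -> y s = 0.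
  elim: n => [|n IH] t /andP[t0 tT] Ht.
    apply: (step 0 t) => //.
      move=> s s0; have {s0}-> : s = 0 by apply/eqP; rewrite eq_le andbC.
      apply/eqP; rewrite eq_le; have /andP[-> _] := yM 0 (introT andP (conj (lexx 0) T0)).
      rewrite andbT; apply: le_trans (yI 0 _) _; first by rewrite lexx.
      by rewrite set_itv1 Rintegral_set1.
    by rewrite H0 subr0 (le_trans Ht)// mul0r invr_ge0.
  have [le_n|lt_n] := leP (H t) (n%:R / 2); first by apply: IH => //; rewrite t0.
  have Hc : {within `[0, t], continuous H}.
    by apply: parameterized_integral_continuous => //; exact: hi'.
  (* Continuity of [H] provides a point with H(a) = n/2: the induction hypothesis reaches a, and one
     more half-unit increment reaches t. *)
  have [|a] := IVT (v := n%:R / 2) t0 Hc.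
    rewrite H0 minEle maxEle (le_trans _ (ltW lt_n)) ?divr_ge0//.
    by rewrite /= ltW.
  rewrite in_itv /= => /andP[a0 at_] Ha.
  apply: (step a t) => //; first by apply: IH; rewrite ?a0 ?(le_trans at_)// Ha.
  by rewrite Ha lerBlDr (le_trans Ht)// -natr1; lra.
move=> t /andP[t0 tT].
have [n Hn] : exists n : nat, H t <= n%:R / 2.
  exists (Num.truncn (2 * H t)).+1.
  have := truncnS_gt (2 * H t); lra.
by apply: (main n t) => //; rewrite t0 ?lexx.
Qed.

End RealIntegrals.

(** * Complex-valued integrals and their measurability *)

Section ComplexIntegrals.
Context {R : realType}.
Notation mu := (@lebesgue_measure R).
Implicit Types (D : set (measurableTypeR R)) (f g : R -> R[i]).

Definition cintegrable D f :=
  mu.-integrable D (EFin \o (fun s => complex.Re (f s))) /\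
  mu.-integrable D (EFin \o (fun s => complex.Im (f s))).

Lemma eq_cintegrable D f g : measurable D -> (forall s, D s -> f s = g s) ->
  cintegrable D f -> cintegrable D g.
Proof.
move=> mD fg [fr fj]; split; [move: fr|move: fj].
  by apply: eq_integrable => // s /set_mem/fg /= <-.
by apply: eq_integrable => // s /set_mem/fg /= <-.
Qed.

Lemma cintegrableD D f g : measurable D -> cintegrable D f -> cintegrable D g ->
  cintegrable D (fun s => f s + g s).
Proof.
move=> mD [fr fj] [gr gj]; split.
  rewrite (_ : (fun s => _) = (fun s => complex.Re (f s) + complex.Re (g s))).
    exact: RintegrableD.
  by apply/funext => s; rewrite cReD.
rewrite (_ : (fun s => _) = (fun s => complex.Im (f s) + complex.Im (g s))).
  exact: RintegrableD.
by apply/funext => s; rewrite cImD.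
Qed.

Lemma cintegrableZ D f (z : R[i]) : measurable D -> cintegrable D f ->
  cintegrable D (fun s => z * f s).
Proof.
move=> mD [fr fj]; split.
  rewrite (_ : (fun s => _) =
      (fun s => complex.Re z * complex.Re (f s) - complex.Im z * complex.Im (f s))).
    by apply: RintegrableB => //; exact: RintegrableZ.
  by apply/funext => s; rewrite cReM.
rewrite (_ : (fun s => _) =
    (fun s => complex.Re z * complex.Im (f s) + complex.Im z * complex.Re (f s))).
  by apply: RintegrableD => //; exact: RintegrableZ.
by apply/funext => s; rewrite cImM.
Qed.

Lemma cintegralD D f g : measurable D -> cintegrable D f -> cintegrable D g ->
  cintegral D (fun s => f s + g s) = cintegral D f + cintegral D g.
Proof.
move=> mD [fr fj] [gr gj]; apply: complex_eqP; rewrite ?cReD ?cImD /=.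
  by rewrite -RintegralD//; apply: eq_Rintegral => s _; rewrite cReD.
by rewrite -RintegralD//; apply: eq_Rintegral => s _; rewrite cImD.
Qed.

Lemma cintegralZ D f (z : R[i]) : measurable D -> cintegrable D f ->
  cintegral D (fun s => z * f s) = z * cintegral D f.
Proof.
move=> mD [fr fj]; apply: complex_eqP; rewrite ?cReM ?cImM /=.
  rewrite -!RintegralZl// -RintegralB; [|by []|exact: RintegrableZ..].
  by apply: eq_Rintegral => s _; rewrite cReM.
rewrite -!RintegralZl// -RintegralD; [|by []|exact: RintegrableZ..].
by apply: eq_Rintegral => s _; rewrite cImM.
Qed.

Lemma eq_cintegral D f g : (forall s, D s -> f s = g s) ->
  cintegral D f = cintegral D g.
Proof.
move=> fg; apply: complex_eqP => /=; apply: eq_Rintegral => s /set_mem sD; by rewrite fg.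
Qed.

End ComplexIntegrals.

Section DominatedIntegrability.
Context {R : realType}.
Notation mu := (@lebesgue_measure R).

Lemma integrable_dominated (D : set (measurableTypeR R)) (f g : measurableTypeR R -> R) :
  measurable D -> measurable_fun D f -> mu.-integrable D (EFin \o g) ->
  {ae mu, forall s, D s -> `|f s| <= g s} -> mu.-integrable D (EFin \o f).
Proof.
move=> mD mf gi fg; apply/integrableP; split; first exact/measurable_EFinP.
have /integrableP[mg gy] := gi; apply: le_lt_trans gy.
apply: ae_ge0_le_integral => //.
- by apply: measurableT_comp => //; exact/measurable_EFinP.
- by apply: measurableT_comp.
- by apply: filterS fg => s fgs Ds; rewrite lee_fin (le_trans (fgs Ds))// ler_norm.
Qed.

End DominatedIntegrability.

Section ComplexMeasurability.
Context {R : realType}.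
Implicit Types (D : set (measurableTypeR R)) (f g : measurableTypeR R -> R[i]).

Definition cmeas D f :=
  measurable_fun D (fun s => complex.Re (f s)) /\
  measurable_fun D (fun s => complex.Im (f s)).

Lemma cmeasurable_cmeas (D : set R) (f : R -> R[i]) : cmeasurable_fun D f -> cmeas D f.
Proof. by []. Qed.

Lemma eq_cmeas D f g : (forall s, D s -> f s = g s) -> cmeas D f -> cmeas D g.
Proof.
move=> fg [fr fj]; split; [apply: eq_measurable_fun fr|apply: eq_measurable_fun fj];
by move=> s /set_mem/fg ->.
Qed.

Lemma cmeasM D f g : cmeas D f -> cmeas D g -> cmeas D (fun s => f s * g s).
Proof.
move=> [fr fj] [gr gj]; split.
  rewrite (_ : (fun s => _) = (fun s => complex.Re (f s) * complex.Re (g s)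
     - complex.Im (f s) * complex.Im (g s))).
    by apply: measurable_funB; exact: measurable_funM.
  by apply/funext => s; rewrite cReM.
rewrite (_ : (fun s => _) = (fun s => complex.Re (f s) * complex.Im (g s)
     + complex.Im (f s) * complex.Re (g s))).
  by apply: measurable_funD; exact: measurable_funM.
by apply/funext => s; rewrite cImM.
Qed.

Lemma cmeas_cst D (z : R[i]) : cmeas D (fun=> z).
Proof. by split; exact: measurable_cst. Qed.

Lemma cmeasD D f g : cmeas D f -> cmeas D g -> cmeas D (fun s => f s + g s).
Proof.
move=> [fr fj] [gr gj]; split.
  rewrite (_ : (fun s => _) = (fun s => complex.Re (f s) + complex.Re (g s))).
    exact: measurable_funD.
  by apply/funext => s; rewrite cReD.
rewrite (_ : (fun s => _) = (fun s => complex.Im (f s) + complex.Im (g s))).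
  exact: measurable_funD.
by apply/funext => s; rewrite cImD.
Qed.

Lemma cmeasB D f g : cmeas D f -> cmeas D g -> cmeas D (fun s => f s - g s).
Proof.
move=> fm gm; apply: (eq_cmeas (f := fun s => f s + (-1) * g s)).
  by move=> s _; rewrite mulN1r.
by apply: cmeasD => //; apply: cmeasM => //; exact: cmeas_cst.
Qed.

Lemma cmeas_sqr_cmod D f : cmeas D f -> measurable_fun D (fun s => cmod (f s) ^+ 2).
Proof.
move=> [fr fj].
rewrite (_ : (fun s => _) = (fun s => complex.Re (f s) ^+ 2 + complex.Im (f s) ^+ 2)).
  by apply: measurable_funD; exact: measurable_funX.
by apply/funext => s; rewrite sqr_cmod.
Qed.

Lemma cmeas_csum {T : countType} (A : set T) D (f : T -> measurableTypeR R -> R[i]) :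
  (forall i, A i -> cmeas D (f i)) -> cmeas D (fun s => csum A (f^~ s)).
Proof.
move=> fm; split; rewrite /csum /=.
  exact: (@measurable_rsum R T _ _ D A (fun i s => complex.Re (f i s))
    (fun i Ai => (fm i Ai).1)).
exact: (@measurable_rsum R T _ _ D A (fun i s => complex.Im (f i s))
  (fun i Ai => (fm i Ai).2)).
Qed.

Lemma cintegrable_dominated D f (g : measurableTypeR R -> R) : measurable D ->
  cmeas D f -> lebesgue_measure.-integrable D (EFin \o g) ->
  {ae lebesgue_measure, forall s, D s -> cmod (f s) <= g s} -> cintegrable D f.
Proof.
move=> mD [fr fj] gi fg.
split; apply: (integrable_dominated mD _ gi) => //; apply: filterS fg => s fgs Ds;
  apply: le_trans (fgs Ds); [exact: ler_norm_Re|exact: ler_norm_Im].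
Qed.

End ComplexMeasurability.

Section TwoPointSums.
Context {R : realType}.

Lemma conjcM (x y : R[i]) : conjc (x * y) = conjc x * conjc y.
Proof. exact: rmorphM. Qed.

Lemma esum_two_points (T : choiceType) (D : set T) (f : T -> R) (a b : T) : D a -> D b ->
  (forall j, 0 <= f j) -> (forall j, D j -> j != a -> j != b -> f j = 0) ->
  (\esum_(i in D) (f i)%:E < +oo)%E.
Proof.
move=> Da Db f0 fab; pose g x (j : T) := if j == x then f x else 0.
have gs x : D x -> (\esum_(i in D) (g x i)%:E < +oo)%E.
  move=> Dx; have [/summableP + _] := @rsum_set1_supp R T D (g x) x Dx
    (fun _ _ ix => ifN _ _ ix).
  by rewrite (eq_esum (b := fun i => (g x i)%:E))// => i _; rewrite ger0_norm// /g; case: ifP.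
apply: le_lt_trans (lte_add_pinfty (gs a Da) (gs b Db)); rewrite -esumD;
  try by move=> i _; rewrite lee_fin /g; case: ifP.
apply: le_esum => i Di; rewrite -EFinD lee_fin /g.
case: (eqVneq i a) => [->|ia]; first by case: ifP => _; rewrite ?addr0// lerDl.
case: (eqVneq i b) => [->|ib]; first by rewrite add0r.
by rewrite fab// addr0.
Qed.

End TwoPointSums.

(** * Modal equations of Leray solutions *)

Section TestFields.
Context {R : realType}.
Variable phi : 'rV[int]_3 -> bool -> 'rV[R[i]]_3.
Hypothesis phi_basis : helical_basis phi.
Implicit Types (u v w : vfield R) (i c : mode) (z : R[i]).

Lemma negm_neq c : modes c -> negm c != c.
Proof.
case: c => n s n0; apply/eqP => -[] /eqP; rewrite eq_sym -addr_eq0 => /eqP nn.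
have e j : n 0 j = 0.
  have := congr1 (fun m : 'rV[int]_3 => m 0 j) nn; rewrite !mxE => /eqP.
  by rewrite -mulr2n mulrn_eq0 => /eqP.
by move/eqP: n0; apply; apply: row3_int_inj; rewrite mxE e.
Qed.

Lemma pairing_two_points (f g : mode -> R[i]) c : modes c ->
  (forall i, modes i -> i != c -> i != negm c -> g i = 0) ->
  pairing f g = f c * conjc (g c) + f (negm c) * conjc (g (negm c)).
Proof.
move=> c0 gc; have nc0 : modes (negm c) by exact/modes_negm.
pose h i := f i * conjc (g i); pose h1 x i := if i == x then h x else 0.
have [s1 e1] := @csum_set1_supp R _ modes (h1 c) c c0 (fun i _ ix => ifN _ _ ix).
have [s2 e2] := @csum_set1_supp R _ modes (h1 (negm c)) _ nc0 (fun i _ ix => ifN _ _ ix).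
rewrite -[f c * _]/(h c) -[X in _ + X]/(h (negm c)).
move: e1 e2; rewrite /h1 !eqxx => <- <-; rewrite -csumD//.
apply: eq_csum => i i0; have [->|ic] := eqVneq i c.
  by rewrite eq_sym (negPf (negm_neq c0)) addr0.
have [->|inc] := eqVneq i (negm c); first by rewrite add0r.
by rewrite gc// conjc0 mulr0 addr0.
Qed.

(* Real-valued fields cannot isolate the mode c from its opposite; the fields
   with z = 1 and z = i together do. *)
Definition test_field c z : vfield R := fun k =>
  if k == c.1 then z *: phi c.1 c.2
  else if k == - c.1 then conjv (z *: phi c.1 c.2) else 0.

(** Eigenvectors at opposite wave vectors are chosen independently. This is the coefficient of the
    conjugate of the one at c on the one at -c; [isolate_mode] eliminates it. *)
Definition opp_phase c : R[i] :=
  dotv (conjv (phi c.1 c.2)) (conjv (phi (- c.1) c.2)).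

Lemma opp_neq c : modes c -> (- c.1 == c.1) = false.
Proof.
move=> c0; apply/negbTE; apply: contraNN (negm_neq c0) => /eqP e.
by case: c e {c0} => n s /= e; rewrite /negm /= e.
Qed.

Lemma component_test_field c z : modes c ->
  [/\ component phi (test_field c z) c = z,
      component phi (test_field c z) (negm c) = conjc z * opp_phase c &
      forall i, modes i -> i != c -> i != negm c -> component phi (test_field c z) i = 0].
Proof.
case: c => n s c0; have [ph1 nph _] := phi_basis s c0.
have eph := phi_eigen phi_basis s c0.
have n0 : n != 0 by exact: c0.
have nn0 : - n != 0 by rewrite oppr_eq0.
split.
- by rewrite /component /test_field /= eqxx dotvZl ph1 mulr1.
- by rewrite /component /test_field /= (opp_neq c0) eqxx conjvZ dotvZl.
- move=> [k s'] k0 kc knc; rewrite /component /test_field /=.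
  have [kn|kn] := eqVneq k n.
    have ss : s' = ~~ s.
      by move: kc; rewrite kn xpair_eqE eqxx /=; case: (s) (s') => -[].
    by rewrite dotvZl kn ss phi_orth// mulr0.
  have [kN|kN] := eqVneq k (- n); last by rewrite dotv0l.
  have ss : s' = ~~ s.
    by move: knc; rewrite kN /negm xpair_eqE eqxx /=; case: (s) (s') => -[].
  rewrite conjvZ dotvZl kN ss.
  have e1 : imC *: crossv (cvec (- n)) (conjv (phi n s)) = (sgnb s * klen n)%:C *: conjv (phi n s).
    by rewrite cvecN crossvNl scalerN (eigen_conj eph) rmorphN /= scaleNr opprK.
  have e2 : imC *: crossv (cvec (- n)) (conjv (phi (- n) (~~ s))) =
     (sgnb s * klen n)%:C *: conjv (phi (- n) (~~ s)).
    rewrite (eigen_conj (phi_eigen phi_basis (~~ s) nn0)) klenN; congr (_%:C *: _).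
    by case: (s); rewrite /sgnb /= ?expr0 ?expr1; ring.
  by rewrite (dotv_eigen0 (sgn_klen_neq0 s n0) e1 e2) mulr0.
Qed.

Lemma smooth_test_field c z : modes c -> smooth_field phi (test_field c z).
Proof.
move=> c0 N; have [_ _ cf] := component_test_field z c0.
have nc0 : modes (negm c) by exact/modes_negm.
have n0 : c.1 != 0 by exact: c0.
have [ph1 nph _] := phi_basis c.2 c0.
split.
- by rewrite /test_field eq_sym (negPf n0) eq_sym oppr_eq0 (negPf n0).
- move=> k; rewrite /test_field; case: eqP => [->|_]; first by rewrite dotvZr nph mulr0.
  case: eqP => [->|_]; last by rewrite dotvC dotv0l.
  by rewrite cvecN dotvNl -conjv_cvec dotv_conj dotvZr nph mulr0 conjc0 oppr0.
- move=> k; rewrite /test_field eqr_opp eqr_oppLR.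
  have [->|kn] := eqVneq k c.1; first by rewrite eq_sym (opp_neq c0).
  have [_|_] := eqVneq k (- c.1); first by rewrite conjvK.
  by apply/matrixP => i j; rewrite !mxE conjc0.
- rewrite /sobolev_normsq; apply: (esum_two_points c0 nc0) => i.
    by rewrite mulr_ge0 ?powR_ge0 ?sqr_ge0.
  by move=> i0 ic inc; rewrite cf// cmod0 expr0n mulr0.
Qed.

Lemma pairing_test_field (f : mode -> R[i]) c z : modes c ->
  pairing f (component phi (test_field c z)) =
    f c * conjc z + f (negm c) * (z * conjc (opp_phase c)).
Proof.
move=> c0; have [e1 e2 e3] := component_test_field z c0.
by rewrite (pairing_two_points f c0 e3) e1 e2 conjcM conjcK.
Qed.

Lemma component_laplacian u i : component phi (laplacian u) i =
  (- (4 * pi ^+ 2 * klen i.1 ^+ 2))%:C * component phi u i.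
Proof.
rewrite /component /laplacian /pderiv sum_ord3 !scalerA -!scalerDl dotvZl; congr (_ * _).
have key (I t x y z : R[i]) : I * I = -1 ->
    I * t * x * (I * t * x) + I * t * y * (I * t * y) + I * t * z * (I * t * z)
    = - (t * t * (x * x + y * y + z * z)).
  move=> II; transitivity ((I * I) * (t * t * (x * x + y * y + z * z))); first by ring.
  by rewrite II mulN1r.
rewrite key; last exact: sqr_imC.
rewrite sqr_klen !intr_complex -!rmorphM /= -!rmorphD /= -rmorphM /= -rmorphN /=.
by congr (_%:C); ring.
Qed.

Lemma pairing_laplacian (f : mode -> R[i]) c z : modes c ->
  pairing f (component phi (laplacian (test_field c z))) =
    (- (4 * pi ^+ 2 * klen c.1 ^+ 2))%:C *
      (f c * conjc z + f (negm c) * (z * conjc (opp_phase c))).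
Proof.
move=> c0; have [e1 e2 e3] := component_test_field z c0.
rewrite (pairing_two_points f c0); last first.
  by move=> i i0 ic inc; rewrite component_laplacian e3// mulr0.
rewrite !component_laplacian e1 e2 /negm /= klenN.
set K := (_)%:C; have KJ : conjc K = K by exact: conjc_real.
by rewrite !conjcM conjcK KJ; ring.
Qed.

(** The choice z = 1 gives x + y e, the choice z = i multiplied by i gives x - y e, and their sum
    contains x only. *)
Lemma isolate_mode (x y P Q e : R[i]) :
  (forall z, x * conjc z + y * (z * e) = P * conjc z + Q * (z * e)) -> x = P.
Proof.
move=> h; have := h 1; have := h imC; rewrite conj_imC conjc1 !mul1r !mulr1 => hi h1.
have hi' : x - y * e = P - Q * e.
  have := congr1 (fun r : R[i] => imC * r) hi.
  have J (a b : R[i]) : imC * (a * - imC + b * (imC * e)) = - (imC * imC) * (a - b * e).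
    by ring.
  by rewrite !J sqr_imC opprK !mul1r.
have h2 : (2 : R[i]) != 0 by rewrite pnatr_eq0.
apply: (mulfI h2); transitivity ((x + y * e) + (x - y * e)); first by ring.
by rewrite h1 hi'; ring.
Qed.

Section Solutions.
Variables (nu : R) (u0 : vfield R) (U : R -> vfield R).
Hypothesis U_sol : leray_solution phi nu u0 U.

(** Weak measurability is available against real fields only, each of which sees c together with its
    opposite; the combination of z = 1 and z = i used in [isolate_mode] separates them. *)
Lemma cmeas_component c : modes c -> cmeas `[0, +oo[%classic (fun s => component phi (U s) c).
Proof.
move=> c0; have [_ [_ mU] _ _ _] := U_sol.
have L z : cmeas `[0, +oo[%classic
    (fun s => component phi (U s) c * conjc z
      + component phi (U s) (negm c) * (z * conjc (opp_phase c))).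
  have tf : sobolev phi 0 (test_field c z) by exact: (smooth_test_field z c0 0%N).
  apply: eq_cmeas (cmeasurable_cmeas (mU _ tf)) => s _.
  by rewrite pairing_test_field.
have L1 := L 1; have Li := cmeasM (cmeas_cst _ imC) (L imC).
have := cmeasM (cmeas_cst _ 2^-1) (cmeasD L1 Li).
apply: eq_cmeas => s _.
set x := component _ _ c; set y := component _ _ (negm c); set e := conjc (opp_phase c).
rewrite conj_imC conjc1 !mulr1 mul1r.
rewrite (_ : imC * _ = - (imC * imC) * x + imC * imC * (y * e)); last ring.
by rewrite sqr_imC; field.
Qed.

(** Each test field yields one equation coupling the coefficients at c and at its opposite. The
    integrability hypotheses allow its integrals to be split between these two modes before
    [isolate_mode] is applied. *)
Lemma mode_equation c t : modes c -> 0 <= t ->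
  (forall i, modes i -> cintegrable `[0, t]%classic (fun s => component phi (U s) i)) ->
  (forall i, modes i -> cintegrable `[0, t]%classic (fun s => Btilde phi (U s) (U s) i)) ->
  component phi (U t) c = component phi u0 c
    - cintegral `[0, t]%classic (fun s => Btilde phi (U s) (U s) c)
    - (nu * (4 * pi ^+ 2 * klen c.1 ^+ 2))%:C
      * cintegral `[0, t]%classic (fun s => component phi (U s) c).
Proof.
move=> c0 t0 iU iB; have [_ _ _ weak _] := U_sol.
have nc0 : modes (negm c) by exact/modes_negm.
have mD : measurable (`[0, t]%classic : set (measurableTypeR R)) by exact: measurable_itv.
set K := (_)%:C; set I1 := cintegral _ (fun s => component phi (U s) c).
set B1 := cintegral _ _.
pose I2 := cintegral `[0, t]%classic (fun s => component phi (U s) (negm c)).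
pose B2 := cintegral `[0, t]%classic (fun s => Btilde phi (U s) (U s) (negm c)).
have lin (f : R -> mode -> R[i]) z :
    (forall i, modes i -> cintegrable `[0, t]%classic (fun s => f s i)) ->
    cintegrable `[0, t]%classic
      (fun s => f s c * conjc z + f s (negm c) * (z * conjc (opp_phase c))) /\
    cintegral `[0, t]%classic
      (fun s => f s c * conjc z + f s (negm c) * (z * conjc (opp_phase c))) =
    cintegral `[0, t]%classic (fun s => f s c) * conjc z +
    cintegral `[0, t]%classic (fun s => f s (negm c)) * (z * conjc (opp_phase c)).
  move=> fi.
  have c1 := cintegrableZ (conjc z) mD (fi _ c0).
  have c2 := cintegrableZ (z * conjc (opp_phase c)) mD (fi _ nc0).
  split.
    apply: eq_cintegrable (cintegrableD mD c1 c2) => // s _.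
    by rewrite mulrC [X in _ + X]mulrC.
  rewrite -[X in _ = X + _]mulrC -[X in _ = _ + X]mulrC -!cintegralZ//; [|exact: fi..].
  rewrite -cintegralD//; apply: eq_cintegral => s _.
  by rewrite mulrC [X in _ + X]mulrC.
apply: (@isolate_mode _ (component phi (U t) (negm c)) _
  (component phi u0 (negm c) - B2 - K * I2) (conjc (opp_phase c))) => z.
rewrite -pairing_test_field// (weak _ _ (smooth_test_field z c0) t0).
rewrite pairing_test_field//.
have [iBz eBz] := lin (fun s => Btilde phi (U s) (U s)) z iB.
have [iUz eUz] := lin (fun s => component phi (U s)) z iU.
rewrite (eq_cintegral (g := fun s => Btilde phi (U s) (U s) c * conjc z
   + Btilde phi (U s) (U s) (negm c) * (z * conjc (opp_phase c)))); last first.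
  by move=> s _; rewrite pairing_test_field.
have eL : cintegral `[0, t]%classic (fun s => pairing (component phi (U s))
      (component phi (laplacian (test_field c z)))) =
    cintegral `[0, t]%classic (fun s => (- (4 * pi ^+ 2 * klen c.1 ^+ 2))%:C *
      (component phi (U s) c * conjc z
       + component phi (U s) (negm c) * (z * conjc (opp_phase c)))).
  by apply: eq_cintegral => s _; rewrite pairing_laplacian.
rewrite eBz eL cintegralZ// eUz -/I1 -/I2 -/B1 -/B2.
have -> : K = - (nu%:C * (- (4 * pi ^+ 2 * klen c.1 ^+ 2))%:C).
  by rewrite -rmorphM /= mulrN rmorphN opprK.
ring.
Qed.

Lemma cmeas_Btilde (D : set (measurableTypeR R)) c : modes c ->
  (forall i, modes i -> cmeas D (fun s => component phi (U s) i)) ->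
  cmeas D (fun s => Btilde phi (U s) (U s) c).
Proof.
move=> c0 mU; rewrite /Btilde; apply: cmeasM; first exact: cmeas_cst.
apply: (cmeas_csum (f := fun p s => Btilde_term phi (U s) (U s) c p)) => p [p0 q0 _ _].
rewrite /Btilde_term; apply: cmeasM; last exact: cmeas_cst.
apply: cmeasM; last exact: mU.
apply: cmeasM; last exact: mU.
exact: cmeas_cst.
Qed.

End Solutions.

End TestFields.

(** * The energy of the difference of two solutions *)

Section AlmostEverywhere.
Context {R : realType}.
Notation mu := (@lebesgue_measure R).

Lemma integrable_cst_itv (T c : R) : mu.-integrable `[0, T] (EFin \o (fun=> c)).
Proof.
apply: measurable_bounded_integrable => //.
- have h : (lebesgue_measure (`[0%R, T]%classic : set R) < +oo)%E.
    by rewrite lebesgue_measure_itv /=; case: ifP => _; rewrite ?ltry.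
  exact: h.
- by exists `|c|; split=> // x /ltW cx y _ /=.
Qed.

Lemma ae_le_Rintegral (D : set (measurableTypeR R)) (f g : measurableTypeR R -> R) :
  measurable D -> mu.-integrable D (EFin \o f) -> mu.-integrable D (EFin \o g) ->
  {ae mu, forall s, D s -> f s <= g s} ->
  \int[mu]_(s in D) f s <= \int[mu]_(s in D) g s.
Proof.
move=> mD fi gi fg; rewrite -subr_ge0 -RintegralB//.
have gfi := RintegrableB mD gi fi.
have [mgf _] := integrableP _ _ _ gfi.
have e : (\int[mu]_(s in D) (g s - f s)%:E = \int[mu]_(s in D) `|g s - f s|%:E)%E.
  apply: ae_eq_integral => //.
    by apply/measurable_EFinP; apply: measurableT_comp => //; exact/measurable_EFinP.
  by apply: filterS fg => s h /h fgs; rewrite ger0_norm// subr_ge0.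
rewrite /Rintegral e fine_ge0//.
by apply: integral_ge0 => s _; rewrite lee_fin.
Qed.

Section IntegralOfSums.
Context {I : countType}.
Variables (A : set I) (D : set (measurableTypeR R)) (G : I -> measurableTypeR R -> R).
Hypothesis mD : measurable D.
Hypothesis Gi : forall i, A i -> mu.-integrable D (EFin \o G i).

Lemma ler_norm_sum_enumf (f : I -> R) (M : R) N :
  (\esum_(i in A) `|f i|%:E <= M%:E)%E -> `|\sum_(0 <= n < N) enumf A f n| <= M.
Proof.
rewrite esum_enumf// => h; rewrite -lee_fin; apply: le_trans h.
apply: (@le_trans _ _ (\sum_(0 <= n < N) (enumf A (fun i => `|f i|) n)%:E)%E).
  rewrite sumEFin lee_fin; apply: le_trans (ler_norm_sum _ _ _) _.
  apply: ler_sum => n _; rewrite /enumf; case: pickle_inv => [x|]; last by rewrite normr0.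
  by case: ifP => // _; rewrite normr0.
apply: nneseries_lim_ge => n _ _; rewrite lee_fin /enumf; case: pickle_inv => // x.
by case: ifP.
Qed.

Lemma integral_sum_enumf N :
  mu.-integrable D (EFin \o (fun s => \sum_(0 <= n < N) enumf A (G^~ s) n)) /\
  \int[mu]_(s in D) (\sum_(0 <= n < N) enumf A (G^~ s) n) =
    \sum_(0 <= n < N) enumf A (fun i => \int[mu]_(s in D) G i s) n.
Proof.
have z : mu.-integrable D (EFin \o (fun=> 0 : R)) := integrable0 _ _.
have z0 : \int[mu]_(s in D) (0 : R) = 0 by rewrite /Rintegral integral0.
elim: N => [|N [iN eN]].
  split; first by apply: eq_integrable z => // s _; rewrite /= big_nil.
  by rewrite big_nil -[RHS]z0; apply: eq_Rintegral => s _; rewrite big_nil.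
have [iE eE] : mu.-integrable D (EFin \o (fun s => enumf A (G^~ s) N)) /\
    \int[mu]_(s in D) enumf A (G^~ s) N = enumf A (fun i => \int[mu]_(s in D) G i s) N.
  rewrite /enumf; case: pickle_inv => [x|]; last by split.
  case: ifPn => [/set_mem xA|_]; last by split.
  by split=> //; exact: Gi.
have := RintegrableD mD iN iE => iS; split.
  by apply: eq_integrable iS => // s _; rewrite /= big_nat_recr.
rewrite big_nat_recr//= -eN -eE -RintegralD//.
by apply: eq_Rintegral => s _; rewrite big_nat_recr.
Qed.

(** Dominated convergence for the partial sums along the enumeration. The second conclusion is kept
    as a limit, so that [energy_inequality] can compare it with the same partial sums of the
    energy. *)
Lemma integral_rsum (g : measurableTypeR R -> R) :
  mu.-integrable D (EFin \o g) ->
  {ae mu, forall s, D s -> (\esum_(i in A) `|G i s|%:E <= (g s)%:E)%E} ->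
  mu.-integrable D (EFin \o (fun s => rsum A (G^~ s))) /\
  (fun N => \sum_(0 <= n < N) enumf A (fun i => \int[mu]_(s in D) G i s) n) @ \oo -->
    \int[mu]_(s in D) rsum A (G^~ s).
Proof.
move=> gi Gg; pose F N s := (\sum_(0 <= n < N) enumf A (G^~ s) n)%:E.
have mF N : measurable_fun D (F N).
  by have [/integrableP[]] := integral_sum_enumf N.
have mf : measurable_fun D (EFin \o (fun s => rsum A (G^~ s))).
  apply/measurable_EFinP; apply: measurable_rsum => i Ai.
  by apply/measurable_EFinP; have /integrableP[] := Gi Ai.
have cF : {ae mu, forall s, D s -> F ^~ s @ \oo --> (rsum A (G^~ s))%:E}.
  apply: filterS Gg => s h /h {}h; apply: cvg_EFin; first by near=> N.
  apply: cvg_enumf; apply/summableP; exact: le_lt_trans h (ltry _).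
have bF : {ae mu, forall s N, D s -> (`|F N s| <= (g s)%:E)%E}.
  by apply: filterS Gg => s h N /h {}h; rewrite lee_fin; exact: ler_norm_sum_enumf.
have [fi _ cv] := dominated_convergence mD mF mf cF gi bF.
split=> //.
rewrite [X in X @ _](_ : _ = fine \o (fun N => \int[mu]_(s in D) F N s)%E); last first.
  by apply/funext => N; have [_ <-] := integral_sum_enumf N.
apply: fine_cvg; rewrite fineK//; exact: integral_fune_fin_num.
Unshelve. all: by end_near. Qed.

End IntegralOfSums.

End AlmostEverywhere.

(** * Integrability in time of a single solution *)

Section LeraySolutions.
Context {R : realType}.
Variable phi : 'rV[int]_3 -> bool -> 'rV[R[i]]_3.
Hypothesis phi_basis : helical_basis phi.
Notation mu := (@lebesgue_measure R).
Notation n0 := (sobolev_norm phi 0).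
Notation n1 := (sobolev_norm phi 1).
Notation amp := (amp phi).
Notation H1 := (H1 phi).

Lemma amp_le_n1 (u : vfield R) c : H1 u -> modes c -> klen c.1 * amp u c <= n1 u.
Proof.
move=> uH c0; rewrite -ler_sqr ?nnegrE ?mulr_ge0 ?klen_ge0 ?amp_ge0 ?sobolev_norm_ge0//.
rewrite exprMn -lee_fin; apply: le_trans (H1_amp1 uH).
rewrite -[leLHS](esum_set1 (a := fun i : mode => (klen i.1 ^+ 2 * amp u i ^+ 2)%:E)).
  apply: esum_subset; first by move=> i ->.
  by move=> i _; rewrite lee_fin mulr_ge0 ?sqr_ge0.
by rewrite lee_fin mulr_ge0 ?sqr_ge0.
Qed.

Lemma n0_le_n1 (u : vfield R) : H1 u -> n0 u <= n1 u.
Proof.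
move=> uH; rewrite -ler_sqr ?nnegrE ?sobolev_norm_ge0// -lee_fin.
rewrite -(sobolev_normsqE (H1_0 uH)) -(sobolev_normsqE uH).
exact: sobolev_normsq01.
Qed.

Lemma sobolev_norm_sq s (u : vfield R) :
  sobolev_norm phi s u ^+ 2 = fine (sobolev_normsq phi s u).
Proof. by rewrite sqr_sqrtr// fine_ge0// sobolev_normsq_ge0. Qed.

Lemma sobolev_norm_sqB s (u v : vfield R) : (sobolev_normsq phi s u < +oo)%E ->
  (sobolev_normsq phi s v < +oo)%E ->
  sobolev_norm phi s (fun k => u k - v k) ^+ 2 <=
    2 * (sobolev_norm phi s u ^+ 2 + sobolev_norm phi s v ^+ 2).
Proof.
move=> uy vy; have h := sobolev_normsqB uy vy.
have wy : (sobolev_normsq phi s (fun k => u k - v k)%R < +oo)%E.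
  apply: le_lt_trans h _; apply: lte_mul_pinfty => //; exact: lte_add_pinfty.
by move: h; rewrite (sobolev_normsqE uy) (sobolev_normsqE vy) (sobolev_normsqE wy)
  -EFinD -EFinM lee_fin.
Qed.

Section OneSolution.
Variables (nu : R) (u0 : vfield R) (U : R -> vfield R).
Hypothesis U_sol : leray_solution phi nu u0 U.
Variable T : R.
Hypothesis T0 : 0 < T.
Let D : set (measurableTypeR R) := `[0, T]%classic.

Lemma solution_L2 s : 0 <= s -> solenoidal (U s) /\ (sobolev_normsq phi 0 (U s) < +oo)%E.
Proof. by move=> s0; have [_ [/(_ s s0)[_ ud ur uy] _] _ _ _] := U_sol. Qed.

Lemma cmeas_solution c : modes c -> cmeas D (fun s => component phi (U s) c).
Proof.
move=> c0; have [mr mi] := cmeas_component phi_basis U_sol c0.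
have sub : D `<=` `[0, +oo[ by move=> s; rewrite /D /= !in_itv /= => /andP[->].
by split; [apply: measurable_funS mr|apply: measurable_funS mi].
Qed.

Lemma measurable_normsq (s : R) :
  measurable_fun D (fun t => sobolev_normsq phi s (U t) : \bar R).
Proof.
apply: (measurable_esum (f := fun i t => klen i.1 `^ (2 * s) *
    cmod (component phi (U t) i) ^+ 2)).
  by move=> i t; rewrite mulr_ge0 ?powR_ge0 ?sqr_ge0.
move=> i i0; apply: measurable_funM; first exact: measurable_cst.
exact: cmeas_sqr_cmod (cmeas_solution i0).
Qed.

Lemma integral_normsq1 : (\int[mu]_(s in D) sobolev_normsq phi 1 (U s) < +oo)%E.
Proof.
have [_ _ /(_ T T0)[_ iU] _ _] := U_sol.
rewrite /D integral_itv_bndoo//.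
have mD : measurable D by exact: measurable_itv.
apply: (measurable_funS mD _ (measurable_normsq 1)) => s.
by rewrite /D /= !in_itv /= => /andP[/ltW -> /ltW ->].
Qed.

Lemma ae_H1 : {ae mu, forall s, D s -> H1 (U s)}.
Proof.
have mD : measurable D by exact: measurable_itv.
have iN : mu.-integrable D (fun s => sobolev_normsq phi 1 (U s)).
  apply/integrableP; split; first exact: measurable_normsq.
  have -> : (\int[mu]_(s in D) `|sobolev_normsq phi 1 (U s)| =
      \int[mu]_(s in D) sobolev_normsq phi 1 (U s))%E.
    by apply: eq_integral => s _; rewrite gee0_abs// sobolev_normsq_ge0.
  exact: integral_normsq1.
apply: filterS (integrable_ae mD iN) => s h /h.
by rewrite ge0_fin_numE// sobolev_normsq_ge0.
Qed.

Lemma integrable_n1 : mu.-integrable D (EFin \o (fun s => n1 (U s) ^+ 2)).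
Proof.
have mD : measurable D by exact: measurable_itv.
have mf : measurable_fun D (EFin \o (fun s => n1 (U s) ^+ 2)).
  apply/measurable_EFinP; under eq_fun do rewrite sobolev_norm_sq.
  apply: (measurableT_comp (fine_measurable (@measurableT _ _))).
  exact: measurable_normsq.
apply/integrableP; split=> //; apply: le_lt_trans integral_normsq1.
apply: ge0_le_integral => //.
- by apply: measurableT_comp.
- exact: measurable_normsq.
(* Where the norm is infinite, [fine] makes [sobolev_norm] equal to 0, so the comparison holds at
   every time. *)
- move=> s _; rewrite /= ger0_norm ?sqr_ge0// sobolev_norm_sq.
  by have := sobolev_normsq_ge0 phi 1 (U s); case: (sobolev_normsq _ _ _).
Qed.

Lemma solution_L2_le t : 0 < nu -> 0 <= t -> n0 (U t) <= n0 u0.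
Proof.
move=> nu0 t0; have [[_ _ _ u0y] _ _ _ /(_ t t0) en] := U_sol.
have [_ Uy] := solution_L2 t0.
have Uf s (w : vfield R) : (sobolev_normsq phi s w < +oo)%E ->
    sobolev_normsq phi s w \is a fin_num.
  by move=> wy; rewrite ge0_fin_numE// sobolev_normsq_ge0.
rewrite /sobolev_norm ler_sqrt ?fine_ge0 ?sobolev_normsq_ge0//.
apply: fine_le; [exact: Uf|exact: Uf|apply: le_trans en].
rewrite leeDl// mule_ge0//; first by rewrite lee_fin mulr_ge0// ltW.
apply: integral_ge0 => s _; apply: sume_ge0 => j _; exact: sobolev_normsq_ge0.
Qed.

Lemma cintegrable_component c : modes c -> cintegrable D (fun s => component phi (U s) c).
Proof.
have mD : measurable D by exact: measurable_itv.
move=> c0; apply: (cintegrable_dominated (g := fun s => 1 + n1 (U s) ^+ 2)) => //.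
- exact: cmeas_solution.
- by apply: RintegrableD => //; [exact: integrable_cst_itv|exact: integrable_n1].
- apply: filterS ae_H1 => s h /h uH; have := amp_le_n1 uH c0.
  have := klen_ge1 (R := R) c0; have := amp_ge0 phi (U s) c; have := sobolev_norm_ge0 phi 1 (U s).
  rewrite -[amp (U s) c]/(cmod (component phi (U s) c)).
  move: (cmod _) (klen c.1) (n1 (U s)) => a k n n_ge0 a_ge0 k1 kan.
  have ka : 0 <= (k - 1) * a by rewrite mulr_ge0 ?subr_ge0.
  have := sqr_ge0 (n - 1); nra.
Qed.

Lemma cintegrable_Btilde c : modes c -> cintegrable D (fun s => Btilde phi (U s) (U s) c).
Proof.
have mD : measurable D by exact: measurable_itv.
(* 576 pi = 2 pi * 288, from the prefactor of [Btilde] and the bound on one mode, in which the L^2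
   norm is replaced by the H^1 norm. *)
move=> c0; pose K : R := 576 * pi * (klen c.1 + 1).
apply: (cintegrable_dominated (g := fun s => K * n1 (U s) ^+ 2)) => //.
- by apply: cmeas_Btilde => // i i0; exact: cmeas_solution.
- by apply: RintegrableZ => //; exact: integrable_n1.
- apply: filterS ae_H1 => s h /h uH.
  have [_ hB] := abs_summable_Btilde_term phi_basis uH uH c0.
  rewrite /Btilde cmodM cmodN cmodC ger0_norm ?mulr_ge0 ?pi_ge0//.
  have h1 := sobolev_norm_ge0 phi 1 (U s); have h0 := n0_le_n1 uH.
  have hk := klen_ge0 (R := R) c.1.
  apply: (@le_trans _ _ (2 * pi * (288 * n1 (U s) * (n1 (U s) * klen c.1 + n1 (U s))))).
    apply: ler_wpM2l; first by rewrite mulr_ge0 ?pi_ge0.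
    apply: le_trans hB _; apply: ler_wpM2l; first by rewrite mulr_ge0.
    by rewrite lerD2r ler_wpM2r.
  by rewrite le_eqVlt; apply/orP; left; apply/eqP; rewrite /K; ring.
Qed.

End OneSolution.

End LeraySolutions.

(** * Comparison of two solutions with the same datum *)

Section Uniqueness.
Context {R : realType}.
Variable phi : 'rV[int]_3 -> bool -> 'rV[R[i]]_3.
Hypothesis phi_basis : helical_basis phi.
Notation mu := (@lebesgue_measure R).
Notation n0 := (sobolev_norm phi 0).
Notation n1 := (sobolev_norm phi 1).
Notation amp := (amp phi).
Notation H1 := (H1 phi).

Section TwoSolutions.
Variables (nu : R) (u0 : vfield R) (U V : R -> vfield R).
Hypothesis nu0 : 0 < nu.
Hypothesis U_sol : leray_solution phi nu u0 U.
Hypothesis V_sol : leray_solution phi nu u0 V.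
Variable T : R.
Hypothesis T0 : 0 < T.
Let D : set (measurableTypeR R) := `[0, T]%classic.
Let W s : vfield R := fun k => U s k - V s k.
Let kappa := nu * (4 * pi ^+ 2).

(** Minus the formal time derivative of the coefficient of w at c; accordingly [energy_density]
    below is the formal derivative of its squared modulus. *)
Definition diff_rhs c s : R[i] :=
  Btilde phi (U s) (U s) c - Btilde phi (V s) (V s) c
  + (kappa * klen c.1 ^+ 2)%:C * component phi (W s) c.

Definition energy_density c s : R :=
  - 2 * complex.Re (diff_rhs c s * conjc (component phi (W s) c)).

Let mD : measurable D. Proof. exact: measurable_itv. Qed.

Let mDt t : measurable (`[0, t]%classic : set (measurableTypeR R)).
Proof. exact: measurable_itv. Qed.

Lemma cintegrable_sub t f : 0 <= t <= T -> cintegrable D f ->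
  cintegrable (`[0, t]%classic : set (measurableTypeR R)) f.
Proof.
move=> /andP[t0 tT] [fr fj]; split.
  exact: integrable_subitv (lexx 0) t0 tT fr.
exact: integrable_subitv (lexx 0) t0 tT fj.
Qed.

Lemma cintegrable_W c : modes c -> cintegrable D (fun s => component phi (W s) c).
Proof.
move=> c0; have iU := cintegrable_component phi_basis U_sol T0 c0.
have iV := cintegrableZ (-1) mD (cintegrable_component phi_basis V_sol T0 c0).
apply: eq_cintegrable (cintegrableD mD iU iV) => // s _.
by rewrite /W componentB mulN1r.
Qed.

Lemma cintegrable_diff_rhs c : modes c -> cintegrable D (diff_rhs c).
Proof.
move=> c0; apply: cintegrableD => //; last exact: cintegrableZ mD (cintegrable_W c0).
have iU := cintegrable_Btilde phi_basis U_sol T0 c0.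
have iV := cintegrableZ (-1) mD (cintegrable_Btilde phi_basis V_sol T0 c0).
by apply: eq_cintegrable (cintegrableD mD iU iV) => // s _; rewrite mulN1r.
Qed.

Lemma difference_equation c t : modes c -> 0 <= t <= T ->
  component phi (W t) c = - cintegral `[0, t]%classic (diff_rhs c).
Proof.
move=> c0 tT; have /andP[t0 _] := tT.
have iUc i : modes i -> cintegrable `[0, t]%classic (fun s => component phi (U s) i).
  by move=> i0; exact: cintegrable_sub tT (cintegrable_component phi_basis U_sol T0 i0).
have iVc i : modes i -> cintegrable `[0, t]%classic (fun s => component phi (V s) i).
  by move=> i0; exact: cintegrable_sub tT (cintegrable_component phi_basis V_sol T0 i0).
have iUB i : modes i -> cintegrable `[0, t]%classic (fun s => Btilde phi (U s) (U s) i).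
  by move=> i0; exact: cintegrable_sub tT (cintegrable_Btilde phi_basis U_sol T0 i0).
have iVB i : modes i -> cintegrable `[0, t]%classic (fun s => Btilde phi (V s) (V s) i).
  by move=> i0; exact: cintegrable_sub tT (cintegrable_Btilde phi_basis V_sol T0 i0).
have eU := mode_equation phi_basis U_sol c0 t0 iUc iUB.
have eV := mode_equation phi_basis V_sol c0 t0 iVc iVB.
(* The common initial datum drops out of the difference. *)
rewrite /W componentB eU eV.
set K := (_)%:C.
have -> : cintegral `[0, t]%classic (diff_rhs c) =
    cintegral `[0, t]%classic (fun s => Btilde phi (U s) (U s) c)
    + (-1) * cintegral `[0, t]%classic (fun s => Btilde phi (V s) (V s) c)
    + (K * cintegral `[0, t]%classic (fun s => component phi (U s) c)
    + (- K) * cintegral `[0, t]%classic (fun s => component phi (V s) c)).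
  rewrite -(cintegralZ (-1) (mDt t) (iVB c c0)) -(cintegralZ K (mDt t) (iUc c c0)).
  rewrite -(cintegralZ (- K) (mDt t) (iVc c c0)).
  have i1 := cintegrableZ (-1) (mDt t) (iVB _ c0).
  have i2 := cintegrableZ K (mDt t) (iUc _ c0).
  have i3 := cintegrableZ (- K) (mDt t) (iVc _ c0).
  rewrite -cintegralD//; last exact: iUB.
  rewrite -cintegralD// -cintegralD//; last 2 first.
  - by apply: cintegrableD => //; exact: iUB.
  - exact: cintegrableD.
  apply: eq_cintegral => s _; rewrite /diff_rhs /W componentB.
  rewrite (_ : (kappa * klen c.1 ^+ 2)%:C = K); last by rewrite /K /kappa; congr (_%:C); ring.
  by ring.
move: (cintegral _ _) (cintegral _ _) (cintegral _ _) (cintegral _ _) => x1 x2 x3 x4.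
move: (component _ _ _) K => x5 k; clear; ring.
Qed.

(** The chain rule for the squared modulus: [sqr_integral] is applied to the real and imaginary
    parts of [diff_rhs], whose primitives are minus those of the coefficient of w. *)
Lemma amplitude_equation c t : modes c -> 0 <= t <= T ->
  mu.-integrable `[0, t] (EFin \o energy_density c) /\
  amp (W t) c ^+ 2 = \int[mu]_(s in `[0, t]) energy_density c s.
Proof.
move=> c0 tT; have /andP[t0 tT'] := tT.
have [fr fj] := cintegrable_sub tT (cintegrable_diff_rhs c0).
have [iX eX] := sqr_integral t0 fr; have [iY eY] := sqr_integral t0 fj.
have sE s : `[0, t]%classic s -> complex.Re (component phi (W s) c) =
      (- \int[mu]_(r in `[0, s]) complex.Re (diff_rhs c r)) /\
    complex.Im (component phi (W s) c) =
      - \int[mu]_(r in `[0, s]) complex.Im (diff_rhs c r).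
  rewrite /= in_itv /= => /andP[s0 st].
  by rewrite difference_equation ?s0 ?(le_trans st)// cReN cImN.
have eE s : `[0, t]%classic s -> energy_density c s =
   2 * (complex.Re (diff_rhs c s) * \int[mu]_(r in `[0, s]) complex.Re (diff_rhs c r)
   + complex.Im (diff_rhs c s) * \int[mu]_(r in `[0, s]) complex.Im (diff_rhs c r)).
  move=> /sE[sr si]; rewrite /energy_density cReM.
  move: sr si; case: (component phi (W s) c) => a b /= -> ->; ring.
have iXY := RintegrableZ 2 (mDt t) (RintegrableD (mDt t) iX iY).
split.
  by apply: eq_integrable iXY => // s /set_mem/eE /= ->.
have tt : `[0, t]%classic t by rewrite /= in_itv /= t0 lexx.
rewrite /amp sqr_cmod; have [-> ->] := sE t tt.
rewrite !sqrrN eX eY -mulrDr -RintegralD// -RintegralZl//; last exact: RintegrableD.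
by apply: eq_Rintegral => s /set_mem/eE ->.
Qed.

Definition dissip s : R := n1 (U s) ^+ 2 + n1 (V s) ^+ 2.

(** Here x = |u|_1, a = |u|_0, z = |w|_1, c = |w|_0 and A = |u|_1^2 + |v|_1^2. From x z <= (x^2 +
    z^2)/2 <= 3A/2 the two terms are at most 3/2 m A and 2 m A, whence 7/2. *)
Lemma trilinear_bound (m x a z c A : R) : 0 <= x -> 0 <= a -> 0 <= z -> 0 <= c ->
  a <= m -> c <= 2 * m -> x ^+ 2 <= A -> z ^+ 2 <= 2 * A ->
  x * (a * z + x * c) <= 7 / 2 * m * A.
Proof.
move=> hx ha hz hc am cm xA zA.
have xz : x * z <= 3 / 2 * A by have := sqr_ge0 (x - z); nra.
have xz0 : 0 <= x * z by rewrite mulr_ge0.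
have h1 : a * (x * z) <= m * (3 / 2 * A) by rewrite ler_pM.
have h2 : x ^+ 2 * c <= A * (2 * m) by rewrite ler_pM ?sqr_ge0.
by move: h1 h2; rewrite expr2; nra.
Qed.

(** The viscous term 2 k z^2 absorbs the H^1 norm z of w. After multiplication by k, twice the
    difference of the two sides is (P (x + y) - 2 k z)^2 + (P (x - y))^2. *)
Lemma young_bound (k P x y z : R) : 0 < k ->
  2 * (P * (x + y) * z) - 2 * k * z ^+ 2 <= P ^+ 2 * (x ^+ 2 + y ^+ 2) / k.
Proof.
move=> k0; rewrite ler_pdivlMr//.
have two_gt0 : (0 : R) < 2 by [].
rewrite -subr_ge0 -(pmulr_rge0 _ two_gt0).
rewrite [leRHS](_ : _ = (P * (x + y) - 2 * k * z) ^+ 2 + (P * (x - y)) ^+ 2); last by ring.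
by rewrite addr_ge0 ?sqr_ge0.
Qed.

Lemma dissip_ge0 s : 0 <= dissip s.
Proof. by rewrite addr_ge0 ?sqr_ge0. Qed.

Lemma integrable_dissip : mu.-integrable D (EFin \o dissip).
Proof. exact: RintegrableD mD (integrable_n1 phi_basis U_sol T0) (integrable_n1 phi_basis V_sol T0). Qed.

Lemma kappa_gt0 : 0 < kappa.
Proof. by rewrite /kappa; apply: mulr_gt0 => //; apply: mulr_gt0 => //; rewrite exprn_gt0// pi_gt0. Qed.

(** Two bounds with different purposes: the unsigned one dominates the series for its integration in
    time, while the signed one keeps the viscous term negative, so that [young_bound] leaves only
    the L^2 norm of w for the Gronwall argument. *)
Lemma energy_density_sum (m s : R) : H1 (U s) -> H1 (V s) -> solenoidal (U s) ->
  solenoidal (V s) -> n0 (U s) <= m -> n0 (V s) <= m ->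
  (\esum_(c in modes) `|energy_density c s|%:E
     <= ((8064 * pi * m + 4 * kappa) * dissip s)%:E)%E /\
  rsum modes (fun c => energy_density c s)
     <= (1728 * pi) ^+ 2 / kappa * dissip s * n0 (W s) ^+ 2.
Proof.
move=> uH vH us vs um vm.
have wH : H1 (W s) := H1B uH vH.
pose q c := (Btilde phi (U s) (U s) c - Btilde phi (V s) (V s) c)
  * conjc (component phi (W s) c).
pose d c := klen c.1 ^+ 2 * amp (W s) c ^+ 2.
have eE c : energy_density c s = - 2 * complex.Re (q c) - 2 * kappa * d c.
  rewrite /energy_density /diff_rhs mulrDl -mulrA mulcJ cReD -rmorphM /=.
  by rewrite /q /d /amp; ring.
have kp := kappa_gt0; have pp := pi_ge0 R.
have x0 := sobolev_norm_ge0 phi 1 (U s); have y0 := sobolev_norm_ge0 phi 1 (V s).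
have z0 := sobolev_norm_ge0 phi 1 (W s); have a0 := sobolev_norm_ge0 phi 0 (U s).
have b0 := sobolev_norm_ge0 phi 0 (V s); have c0 := sobolev_norm_ge0 phi 0 (W s).
have xA : n1 (U s) ^+ 2 <= dissip s by rewrite /dissip lerDl sqr_ge0.
have yA : n1 (V s) ^+ 2 <= dissip s by rewrite /dissip lerDr sqr_ge0.
have zA : n1 (W s) ^+ 2 <= 2 * dissip s := sobolev_norm_sqB uH vH.
have m0 : 0 <= m := le_trans a0 um.
have c2m : n0 (W s) <= 2 * m.
  rewrite -ler_sqr ?nnegrE ?mulr_ge0//.
  have := sobolev_norm_sqB (H1_0 uH) (H1_0 vH); rewrite -/(W s) => h.
  apply: le_trans h _.
  have : n0 (U s) ^+ 2 <= m ^+ 2 by rewrite lerXn2r ?nnegrE.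
  have : n0 (V s) ^+ 2 <= m ^+ 2 by rewrite lerXn2r ?nnegrE.
  lra.
have dW : (\esum_(c in modes) (d c)%:E <= (n1 (W s) ^+ 2)%:E)%E by exact: H1_amp1.
have dE : (\esum_(c in modes) (d c)%:E = (n1 (W s) ^+ 2)%:E)%E.
  by rewrite -(sobolev_normsqE wH) sobolev_normsq1.
have d0 c : 0 <= d c by rewrite mulr_ge0 ?sqr_ge0.
have bU := Btilde_abs_estimate phi_basis uH uH wH.
have bV := Btilde_abs_estimate phi_basis vH vH wH.
have qle : (\esum_(c in modes) (cmod (q c))%:E <= (4032 * pi * m * dissip s)%:E)%E.
  apply: (@le_trans _ _ (\esum_(c in modes)
      ((cmod (Btilde phi (U s) (U s) c * conjc (component phi (W s) c)))%:E
      + (cmod (Btilde phi (V s) (V s) c * conjc (component phi (W s) c)))%:E))%E).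
    by apply: le_esum => c _; rewrite -EFinD lee_fin /q mulrBl ler_cmodB.
  rewrite esumD; try by move=> *; rewrite lee_fin cmod_ge0.
  apply: le_trans (leeD bU bV) _; rewrite -EFinD lee_fin.
  have hU := trilinear_bound x0 a0 z0 c0 um c2m.
  have hV := trilinear_bound y0 b0 z0 c0 vm c2m.
  have {}hU := hU _ xA zA.
  have {}hV := hV _ yA zA.
  rewrite -!(mulrA (576 * pi)) -mulrDr.
  (* 4032 = 576 * 7, where each of the two solutions contributes 7/2. *)
  rewrite (_ : 4032 * pi * m * dissip s = 576 * pi * (7 * m * dissip s)); last ring.
  apply: (ler_wpM2l (mulr_ge0 (ler0n R 576) pp)).
  apply: le_trans (lerD hU hV) _.
  rewrite le_eqVlt; apply/orP; left; apply/eqP; by field.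
have qs : abs_summable modes q by exact: abs_summable_le qle.
have ds : summable modes (EFin \o d).
  by apply: summable_esum => //; rewrite dE ltry.
split.
  apply: (@le_trans _ _ (\esum_(c in modes) ((2 * cmod (q c))%:E + (2 * kappa * d c)%:E))%E).
    apply: le_esum => c _; rewrite -EFinD lee_fin eE.
    have dk0 : 0 <= 2 * kappa * d c by apply: mulr_ge0 (d0 c); exact: mulr_ge0 (ler0n R 2) (ltW kp).
    apply: le_trans (ler_normB _ _) _.
    rewrite (normrM (- 2)) normrN (ger0_norm dk0) (ger0_norm (ler0n R 2)) lerD2r.
    by apply: ler_wpM2l => //; exact: ler_norm_Re.
  have k20 : 0 <= 2 * kappa by rewrite mulr_ge0// ltW.
  rewrite esumD; try by move=> c _; rewrite lee_fin mulr_ge0 ?cmod_ge0.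
  rewrite !esumZ_ge0//; last by move=> c; exact: cmod_ge0.
  rewrite dE -EFinM.
  apply: (@le_trans _ _ ((2 * (4032 * pi * m * dissip s))%:E + (2 * kappa * n1 (W s) ^+ 2)%:E)%E).
    by apply: leeD => //; rewrite [leRHS]EFinM lee_wpmul2l.
  rewrite -EFinD lee_fin.
  have : 2 * kappa * n1 (W s) ^+ 2 <= 2 * kappa * (2 * dissip s) by rewrite ler_wpM2l.
  lra.
rewrite (eq_rsum (g := fun c => - 2 * complex.Re (q c) - 2 * kappa * d c)); last by move=> c _.
have qr := abs_summable_Re qs.
rewrite rsumB; [|exact: summableZ..].
rewrite !rsumZ// (rsum_ge0E (f := d))//; last by rewrite dE ltry.
rewrite dE /=.
have [_ hq] := Btilde_difference phi_basis uH vH us vs.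
have h3 : - 2 * rsum modes (fun c => complex.Re (q c)) <=
    2 * (1728 * pi * (n1 (U s) + n1 (V s)) * n0 (W s) * n1 (W s)).
  have := le_trans (ler_norm_Re (csum modes q)) hq.
  rewrite ler_norml /= => /andP[hl _]; lra.
apply: le_trans (lerD h3 (lexx _)) _.
have := @young_bound kappa (1728 * pi * n0 (W s)) (n1 (U s)) (n1 (V s)) (n1 (W s)) kp.
rewrite -/(dissip s); congr (_ <= _); rewrite /=.
  by move: (1728 * pi) => P; ring.
by move: (1728 * pi) => P; rewrite exprMn; ring.
Qed.

Let y s : R := n0 (W s) ^+ 2.
Let growth s : R := (1728 * pi) ^+ 2 / kappa * dissip s.

Lemma ae_H1_solutions :
  {ae mu, forall s, D s -> [/\ H1 (U s), H1 (V s), solenoidal (U s) & solenoidal (V s)]}.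
Proof.
apply: filterS2 (ae_H1 phi_basis U_sol T0) (ae_H1 phi_basis V_sol T0) => s uH vH Ds.
have s0 : 0 <= s by move: Ds; rewrite /D /= in_itv /= => /andP[].
by split; [exact: uH|exact: vH|have [] := solution_L2 U_sol s0|have [] := solution_L2 V_sol s0].
Qed.

Lemma diff_normsq_finite s : 0 <= s -> (sobolev_normsq phi 0 (W s) < +oo)%E.
Proof.
move=> s0; have [_ Uy] := solution_L2 U_sol s0; have [_ Vy] := solution_L2 V_sol s0.
apply: le_lt_trans (sobolev_normsqB Uy Vy) _.
by apply: lte_mul_pinfty => //; exact: lte_add_pinfty.
Qed.

Lemma diff_norm_bound s : 0 <= s -> 0 <= y s <= 4 * n0 u0 ^+ 2.
Proof.
move=> s0; have [_ Uy] := solution_L2 U_sol s0; have [_ Vy] := solution_L2 V_sol s0.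
rewrite sqr_ge0 /=; apply: le_trans (sobolev_norm_sqB Uy Vy) _.
have uu : n0 (U s) ^+ 2 <= n0 u0 ^+ 2.
  by rewrite lerXn2r ?nnegrE ?sobolev_norm_ge0//; exact: solution_L2_le U_sol _ nu0 s0.
have vv : n0 (V s) ^+ 2 <= n0 u0 ^+ 2.
  by rewrite lerXn2r ?nnegrE ?sobolev_norm_ge0//; exact: solution_L2_le V_sol _ nu0 s0.
move: uu vv; lra.
Qed.

Lemma ae_energy_density : {ae mu, forall s, D s ->
  (\esum_(c in modes) `|energy_density c s|%:E
     <= ((8064 * pi * n0 u0 + 4 * kappa) * dissip s)%:E)%E /\
  rsum modes (fun c => energy_density c s) <= growth s * y s}.
Proof.
apply: filterS ae_H1_solutions => s h Ds; have [uH vH us vs] := h Ds.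
have s0 : 0 <= s by move: Ds; rewrite /D /= in_itv /= => /andP[].
apply: energy_density_sum => //.
  exact: solution_L2_le U_sol _ nu0 s0.
exact: solution_L2_le V_sol _ nu0 s0.
Qed.

Lemma measurable_diff_norm : measurable_fun D y.
Proof.
rewrite /y; under eq_fun do rewrite sobolev_norm_sq sobolev_normsq0.
apply: (measurableT_comp (fine_measurable (@measurableT _ _))).
apply: (measurable_esum (f := fun c s => amp (W s) c ^+ 2)).
  by move=> c s; exact: sqr_ge0.
move=> c c0; apply: cmeas_sqr_cmod.
apply: (eq_cmeas (f := fun s => component phi (U s) c - component phi (V s) c)).
  by move=> s _; rewrite /W componentB.
by apply: cmeasB; [exact: (cmeas_solution phi_basis U_sol)|exact: (cmeas_solution phi_basis V_sol)].
Qed.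

Lemma integrable_growth : mu.-integrable D (EFin \o growth).
Proof. exact: RintegrableZ mD integrable_dissip. Qed.

Lemma growth_ge0 s : 0 <= growth s.
Proof.
apply: mulr_ge0 (dissip_ge0 s); apply: divr_ge0; [exact: sqr_ge0|exact: ltW kappa_gt0].
Qed.

Lemma integrable_growth_diff : mu.-integrable D (EFin \o (fun s => growth s * y s)).
Proof.
have /integrableP[/measurable_EFinP mg _] := integrable_growth.
apply: (integrable_dominated (g := fun s => 4 * n0 u0 ^+ 2 * growth s)) => //.
- by apply: measurable_funM => //; exact: measurable_diff_norm.
- exact: RintegrableZ mD integrable_growth.
- apply: aeW => s Ds; have s0 : 0 <= s by move: Ds; rewrite /D /= in_itv /= => /andP[].
  have /andP[y0 yM] := diff_norm_bound s0; have g0 := growth_ge0 s.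
  move: (growth s) (y s) (n0 u0) g0 y0 yM => g z n g0 z0 zM.
  by rewrite ger0_norm ?mulr_ge0// mulrC ler_wpM2r.
Qed.

Lemma energy_inequality t : 0 <= t <= T -> y t <= \int[mu]_(s in `[0, t]) (growth s * y s).
Proof.
move=> tT; have /andP[t0 tT'] := tT.
have sub s : `[0, t]%classic s -> D s.
  by rewrite /D /= !in_itv /= => /andP[-> st]; exact: le_trans st tT'.
have Gi c (c0 : modes c) := (amplitude_equation c0 tT).1.
have ae_bound : {ae mu, forall s, `[0, t]%classic s ->
    (\esum_(c in modes) `|energy_density c s|%:E
       <= ((8064 * pi * n0 u0 + 4 * kappa) * dissip s)%:E)%E}.
  by apply: filterS ae_energy_density => s h /sub/h[].
have [ri rc] := integral_rsum (mDt t) Gi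
  (integrable_subitv (lexx 0) t0 tT'
     (RintegrableZ (8064 * pi * n0 u0 + 4 * kappa) mD integrable_dissip))
  ae_bound.
(* Partial sums of the squared amplitudes converge to y(t); by [amplitude_equation] they are also
   the partial sums of the integrated densities, so the two limits agree. *)
have -> : y t = \int[mu]_(s in `[0, t]) rsum modes (energy_density^~ s).
  have Wy := diff_normsq_finite t0; rewrite /y sobolev_norm_sq sobolev_normsq0.
  rewrite sobolev_normsq0 in Wy.
  apply: (cvg_unique _ (cvg_enumf_ge0 (fun c => sqr_ge0 (amp (W t) c)) Wy)).
    exact: Rhausdorff.
  rewrite [X in X @ _](_ : _ = (fun N => \sum_(0 <= n < N)
    enumf modes (fun c => \int[mu]_(s in `[0, t]) energy_density c s) n))//.
  apply/funext => N; apply: eq_bigr => n _; rewrite /enumf; case: pickle_inv => // c.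
  by case: ifPn => // /set_mem c0; have [_] := amplitude_equation c0 tT.
apply: ae_le_Rintegral => //.
  exact: integrable_subitv (lexx 0) t0 tT' integrable_growth_diff.
by apply: filterS ae_energy_density => s h /sub/h[].
Qed.

Lemma diff_norm_zero t : 0 <= t <= T -> y t = 0.
Proof.
apply: (gronwall_zero (M := 4 * n0 u0 ^+ 2) (ltW T0) integrable_growth
  integrable_growth_diff) => //.
- by move=> s _; exact: growth_ge0.
- by move=> s /andP[s0 _]; exact: diff_norm_bound.
- exact: energy_inequality.
Qed.

End TwoSolutions.

(** Vanishing of all helical coefficients kills w(k) for nonzero k, since a divergence-free w(k) is
    the sum of its two helical parts; the mode k = 0 is covered by the mean-zero condition. *)
Lemma field_eq0 (w : vfield R) : w 0 = 0 -> (forall k, dotv (cvec k) (w k) = 0) ->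
  (sobolev_normsq phi 0 w < +oo)%E -> n0 w = 0 -> w = fun=> 0.
Proof.
move=> w0 wd wy nw; apply/funext => k; have [->//|k0] := eqVneq k 0.
have comp0 s : component phi w (k, s) = 0.
  have c0 : modes (k, s) by [].
  have : ((amp w (k, s) ^+ 2)%:E <= 0%:E)%E.
    have <- : (sobolev_normsq phi 0 w = 0%:E)%E by rewrite (sobolev_normsqE wy) nw expr0n.
    rewrite sobolev_normsq0 -[leLHS](esum_set1 (a := fun i : mode => (amp w i ^+ 2)%:E)).
      apply: esum_subset; first by move=> i ->.
      by move=> i _; rewrite lee_fin sqr_ge0.
    by rewrite lee_fin sqr_ge0.
  rewrite lee_fin => h; have : amp w (k, s) ^+ 2 == 0 by rewrite eq_le h sqr_ge0.
  by rewrite sqrf_eq0 => /eqP; exact: cmod_eq0.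
by rewrite (hproj_sum phi_basis k0 (wd k)) /hproj !comp0 !scale0r addr0.
Qed.

Lemma leray_unique (nu : R) (u0 : vfield R) (U V : R -> vfield R) : 0 < nu ->
  leray_solution phi nu u0 U -> leray_solution phi nu u0 V ->
  forall t, 0 <= t -> U t = V t.
Proof.
move=> nu0 U_sol V_sol t t0.
have [/(_ t t0)[U0 _ _ _] _] : (forall t, 0 <= t -> sobolev phi 0 (U t)) /\ True.
  by have [_ [hU _] _ _ _] := U_sol.
have [/(_ t t0)[V0 _ _ _] _] : (forall t, 0 <= t -> sobolev phi 0 (V t)) /\ True.
  by have [_ [hV _] _ _ _] := V_sol.
have [[Ud _] _] := solution_L2 U_sol t0; have [[Vd _] _] := solution_L2 V_sol t0.
suff : (fun k => U t k - V t k) = fun=> 0.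
  by move=> h; apply/funext => k; apply/eqP; rewrite -subr_eq0 (congr1 (fun f => f k) h).
apply: field_eq0.
- by rewrite U0 V0 subr0.
- by move=> k; rewrite dotvDr Ud add0r -scaleN1r dotvZr Vd mulr0.
- exact: diff_normsq_finite U_sol V_sol _ t0.
(* The horizon t + 1 is positive even when t = 0. *)
- have T0 : 0 < t + 1 by rewrite ltr_wpDl.
  apply/eqP; rewrite -sqrf_eq0; apply/eqP.
  have tT : 0 <= t <= t + 1 by rewrite t0 lerDl ler01.
  exact: (diff_norm_zero nu0 U_sol V_sol T0 tT).
Qed.

End Uniqueness.

Theorem theorem1p1 (R : realType) (phi : 'rV[int]_3 -> bool -> 'rV[R[i]]_3)
    (phi_basis : helical_basis phi) :
  (exists C : R, 0 < C /\
     forall u v : vfield R, sobolev phi 1 u -> sobolev phi 1 v ->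
       Btilde_pairing_converges phi u v u /\
       cmod (pairing (Btilde phi u v) (component phi u))
         <= C * sobolev_norm phi 0 u * sobolev_norm phi 1 u
              * sobolev_norm phi 1 v) /\
  (forall (nu : R) (u0 : vfield R) (u v : R -> vfield R), 0 < nu ->
     leray_solution phi nu u0 u -> leray_solution phi nu u0 v ->
     forall t : R, 0 <= t -> u t = v t).
Proof.
split; last by move=> nu u0 u v; exact: leray_unique.
(* For w = u the two terms of [Btilde_estimate] coincide, which doubles 576 pi. *)
exists (1152 * pi); split; first by apply: mulr_gt0; [exact: ltr0n|exact: pi_gt0].
move=> u v [_ _ _ uH] [_ _ _ vH].
split; first by have [] := Btilde_pairing_csum phi_basis uH vH uH.
apply: le_trans (Btilde_estimate phi_basis uH vH uH) _.
move: (sobolev_norm _ _ _) (sobolev_norm _ _ _) (sobolev_norm _ _ _) => x y z.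
rewrite le_eqVlt; apply/orP; left; apply/eqP; ring.
Qed.
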